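(* Let $d\ge3$ and let $V=U+g$ be a potential where $U,g\in C^{2,\alpha}(\mathbb R,\mathbb R_+)$ for some $\alpha>0$, $U$ and $g$ are even, $c^{-1}\le U''\le c$ for some $c\in(1,\infty)$, $g$ has compact support, and $V(\eta)\ge A\eta^2-B$ for all $\eta\in\mathbb R$, for some $A>0$, $B\in\mathbb R$. There exists a constant $c_{24}>0$, depending only on $d$ and $c$, such that, if $\beta>0$ satisfies $\sqrt\beta\,\|g''\|_{L^1(\mathbb R)}<c_{24}$, then $$h^+(\mu_\beta)<\infty\quad\text{for all }\mu_\beta\in\mathscr W_\beta(V).$$
   Context: $C^{2,\alpha}$ denotes $C^2$ functions with $\alpha$-Hölder second derivatives. $\mathbb Z^d$ carries its usual nearest-neighbor edges ($x\sim y$ iff $|x-y|_1=1$), and $|x-y|$ denotes graph distance. $\Omega=\mathbb R^{\mathbb Z^d}$ with coordinates $\varphi_x$. For finite $\Lambda\subset\mathbb Z^d$ and $\beta>0$, $\mu^0_{\Lambda,\beta}$ is the probability measure on $\Omega$ under which $\varphi=0$ on $\Lambda^c$ and $(\varphi_x)_{x\in\Lambda}$ has density, with respect to Lebesgue measure on $\mathbb R^\Lambda$, proportional to $e^{-\beta H_\Lambda(\varphi)}$, with $\varphi=0$ on $\Lambda^c$, where $$H_\Lambda(\varphi)=\sum_{\{x,y\}:\,x\sim y,\ \{x,y\}\cap\Lambda\neq\emptyset}V(\varphi_x-\varphi_y)$$ (sum over unordered nearest-neighbor edges with at least one endpoint in $\Lambda$; equivalently one half of the sum over oriented edges). Let $\mathbb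 Z^d_e=\{x\in\mathbb Z^d:\sum_ix_i\text{ even}\}$ and $\Lambda_e=\Lambda\cap\mathbb Z^d_e$. $F^*$ is the collection of finite $\Lambda\subset\mathbb Z^d$ such that if $x\in\Lambda_e$ and $|y-x|_1=1$ then $y\in\Lambda$. $\mathscr W_\beta(V)$ is the set of probability measures on $\Omega$ that are weak limits of sequences $\mu^0_{\Lambda_n,\beta}$, where $(\Lambda_n)$ is increasing with union $\mathbb Z^d$, $\Lambda_n\in F^*$ for all $n$, and the graph with vertex set $\Lambda_n\cup\partial\Lambda_n$ ($\partial\Lambda_n$ the outer vertex boundary) and all edges having at least one endpoint in $\Lambda_n$ is connected. For a probability measure $\mu$ on $\Omega$, $h^+(\mu)$ is the infimum of all $h\in\mathbb R$ for which there exist $c(h),c'(h)>0$ and $\rho=\rho(h)>0$ with $\mu(x\stackrel{\geqslant h}{\longleftrightarrow}y)\le c(h)e^{-c'(h)|x-y|^{\rho}}$ for all $x,y\in\mathbb Z^d$, where $\{x\stackrel{\geqslant h}{\longleftrightarrow}y\}$ is the event that $x$ and $y$ are joined by a nearest-neighbor path of sites $z$ with $\varphi_z\ge h$. *)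

(* Defs.v *)
From HB Require Import structures.
From mathcomp Require Import all_boot all_order all_algebra finmap.
From mathcomp Require Import all_classical all_reals all_analysis.

Set Implicit Arguments.
Unset Strict Implicit.
Unset Printing Implicit Defensive.

Import Order.TTheory GRing.Theory Num.Theory.
Import numFieldNormedType.Exports.

Local Open Scope ring_scope.
Local Open Scope classical_set_scope.

Definition Zd (d : nat) := {ffun 'I_d -> int}.

Definition adj (d : nat) : rel (Zd d) :=
  fun x y => \sum_i `|x i - y i| == 1.

Definition gdist (R : realType) (d : nat) (x y : Zd d) : R :=
  inf [set (size p)%:R | p in
    [set p : seq (Zd d) | path (@adj d) x p /\ last x p = y]].

Definition even_site (d : nat) (x : Zd d) : bool := (2 %| \sum_i x i)%Z.

Definition Fstar (d : nat) (L : {fset Zd d}) : Prop :=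
  forall x y, x \in L -> even_site x -> adj x y -> y \in L.

Definition edge_meets (d : nat) (L : {fset Zd d}) : rel (Zd d) :=
  fun x y => adj x y && ((x \in L) || (y \in L)).

(* L together with its outer vertex boundary; every edge meeting L has both
   endpoints in this set. *)
Definition closed_domain (d : nat) (L : {fset Zd d}) : set (Zd d) :=
  [set x | x \in L \/ exists2 y, y \in L & adj x y].

Definition graph_connected (d : nat) (L : {fset Zd d}) : Prop :=
  forall x y, closed_domain L x -> closed_domain L y ->
    exists p, path (edge_meets L) x p /\ last x p = y.

(* Omega = R^(Z^d) carries the product sigma-algebra; since Z^d is countable,
   this is also the Borel sigma-algebra of the product topology. *)
Definition cylinders (R : realType) (d : nat) : set (set (Zd d -> R)) :=
  [set (fun phi : Zd d -> R => phi x) @^-1` B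
    | x in [set: Zd d] & B in (measurable : set (set R))].

Definition Omega (R : realType) (d : nat) :
    measurableType (@cylinders R d).-sigma :=
  g_sigma_algebraType (@cylinders R d).

(* The sum runs over oriented edges, whence the factor 1/2. *)
Definition energy (R : realType) (d : nat) (V : R -> R) (L : {fset Zd d})
    (phi : Zd d -> R) : R :=
  2^-1 * \sum_(e \in [set e : Zd d * Zd d | edge_meets L e.1 e.2])
           V (phi e.1 - phi e.2).

(* Integral of F over the coordinates listed in s, the other coordinates being
   those of phi: by Tonelli, for F nonnegative measurable and s duplicate-free,
   this is the integral against Lebesgue measure on R^s. *)
Fixpoint leb_int (R : realType) (d : nat) (s : seq (Zd d))
    (F : (Zd d -> R) -> \bar R) (phi : Zd d -> R) : \bar R :=
  if s is x :: s' then
    (\int[lebesgue_measure]_t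
       leb_int s' F (fun y => if y == x then t else phi y))%E
  else F phi.

(* mu is the Gibbs measure on L with boundary condition 0: the integral is taken
   over the coordinates in L with all the others frozen at 0. Taking A = Omega
   shows that Z is the (finite) partition function. *)
Definition is_gibbs0 (R : realType) (d : nat) (V : R -> R) (beta : R)
    (L : {fset Zd d}) (mu : probability (Omega R d) R) : Prop :=
  exists2 Z : R, 0 < Z &
    forall A : set (Omega R d), measurable A ->
      mu A = ((Z^-1)%:E *
        leb_int L (fun phi =>
          (\1_A phi * expR (- (beta * energy V L phi)))%R%:E) (fun=> 0%R))%E.

Definition weak_cvg (R : realType) (d : nat)
    (mu_ : nat -> probability (Omega R d) R) (mu : probability (Omega R d) R) :
    Prop :=
  forall f : {ptws Zd d -> R} -> R,
    continuous f -> (exists M, forall phi, `|f phi| <= M) ->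
    (\int[mu_ n]_phi (f phi)%:E)%E @[n --> \oo]
      --> (\int[mu]_phi (f phi)%:E)%E.

(* Weak limits of Gibbs measures with zero boundary condition, along sequences
   of domains increasing (not necessarily strictly) to Z^d. *)
Definition Wset (R : realType) (d : nat) (V : R -> R) (beta : R) :
    set (probability (Omega R d) R) :=
  [set mu | exists (L : nat -> {fset Zd d})
                   (mu_ : nat -> probability (Omega R d) R),
    [/\ (forall n, {subset L n <= L n.+1}) /\ (forall x, exists n, x \in L n),
        forall n, Fstar (L n),
        forall n, graph_connected (L n),
        forall n, is_gibbs0 V beta (L n) (mu_ n)
      & weak_cvg mu_ mu]].

Definition connect_ge (R : realType) (d : nat) (h : R) (x y : Zd d) :
    set (Omega R d) :=
  [set phi | exists p, [/\ path (@adj d) x p, last x p = y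
                         & forall z, z \in x :: p -> h <= phi z]].

Definition hplus (R : realType) (d : nat) (mu : probability (Omega R d) R) :
    \bar R :=
  ereal_inf [set h%:E | h in [set h : R |
    exists c c' rho : R, [/\ 0 < c, 0 < c', 0 < rho
      & forall x y : Zd d,
          (mu (connect_ge h x y) <=
             (c * expR (- (c' * gdist R x y `^ rho)))%:E)%E]]].

Definition holder (R : realType) (alpha : R) (f : R -> R) : Prop :=
  exists K : R, forall x y, `|f x - f y| <= K * `|x - y| `^ alpha.

Definition C2holder (R : realType) (alpha : R) (f : R -> R) : Prop :=
  [/\ forall x, derivable f x 1,
      forall x, derivable f^`() x 1,
      continuous f^`(2)
    & holder alpha f^`(2)].

Definition compactly_supported (R : realType) (f : R -> R) : Prop :=
  compact (closure [set x | f x != 0]).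

(* Main.v *)
Require Import Defs.
From HB Require Import structures.
From mathcomp Require Import all_boot all_order all_algebra finmap.
From mathcomp Require Import all_classical all_reals all_analysis measurable_realfun.
From mathcomp Require Import ring lra zify.

(** In a domain of the class considered, every edge that meets the domain has its odd
endpoint inside ([odd_endpoint]). The energy is thus a sum over odd sites, and given
the even spins the odd spins are independent: each of them integrates to a function
J(a) = \int exp (- beta \sum_i V (t - a_i)) dt of the spins a_i of its neighbours.

Although V is not convex, J is strongly log-concave in the directions transverse to
the constants ([site_pair]), because averaging over one spin repairs the convexity.
After rescaling to beta = 1, the function g' is uniformly small, being the integral
of g''. Replacing g by its average over unit intervals yields a potential W that is
uniformly convex; for W the claim follows from the Prekopa-Leindler inequality
([site_J_pair]). It amounts to an upper bound on the second derivative of ln J, which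
is a variance minus a mean stiffness. V - W is small together with its first
derivative, and its second derivative is small in L^1 while the spin has a bounded
density; so the bound survives the passage from W to V ([site_variance_perturbed]).

A second use of Prekopa-Leindler, now over all even spins, bounds the partition
function tilted by the sum of the spins over a set S of even sites
([partition_exponential]): the logarithm of the ratio is O(B) as soon as
(\sum_(x in S) f x)^2 <= B E(f) for all f supported in the domain, E being the
Dirichlet energy. In dimension at least three this holds with B = O(#S), uniformly in
the domain, for sets S whose number of points in a box grows at most like the cube
root of its side ([sparse_dirichlet_bound]): f is telescoped along its averages over
boxes of doubling sizes, and the successive contributions decay geometrically.

Finally, a path reaching distance 8^n passes through all points of some sparse set
of 2^n even sites, the leaves of a binary tree embedded at scales 1, 8, 64, and so on
([path_contains_tree]), and at most exp (C 2^n) such sets are available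
([trees_count]). For h large, the Chernoff bound, which passes to weak limits through
a continuous cutoff, beats this entropy and gives a connection probability of order
exp (- 2^n), a stretched exponential with exponent 1/3 since 2^n is the cube root
of 8^n. *)

Set Implicit Arguments.
Unset Strict Implicit.
Unset Printing Implicit Defensive.

Import Order.TTheory GRing.Theory Num.Theory.
Import numFieldNormedType.Exports.

Local Open Scope ring_scope.
Local Open Scope classical_set_scope.

(** * Affine changes of variable *)

Section affine_change.
Context {R : realType}.
Local Notation mu := (@lebesgue_measure R).
Local Open Scope ereal_scope.

Lemma measurable_affine (a b : R) :
  measurable_fun [set: R] (fun t : R => (a * t + b)%R : measurableTypeR R).
Proof. by apply: measurable_realfun.measurable_funD => //; apply: measurable_funM. Qed.

Lemma lebesgue_measure_affine (a b : R) (A : set R) : (0 < a)%R ->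
  measurable A -> mu A = a%:E * mu ((fun t => (a * t + b)%R) @^-1` A).
Proof.
move=> a0 mA.
pose phi : R -> measurableTypeR R := fun t : R => (a * t + b)%R.
pose m : {measure set (measurableTypeR R) -> \bar R} :=
  mscale (NngNum (ltW a0)) (pushforward mu phi).
rewrite -[RHS]/(m (@measurable_affine a b) A).
apply: lebesgue_measure_unique => //= _ [[x y]] _ <-.
rewrite /m /mscale /= /pushforward.
have -> : phi @^-1` `]x, y]%classic = `]((x - b) / a)%R, ((y - b) / a)%R]%classic.
  apply/seteqP; split => t /=; rewrite !in_itv/= ltr_pdivrMr// ler_pdivlMr//;
    by rewrite ltrBlDr lerBrDr mulrC.
rewrite !lebesgue_measure_itv/= !lte_fin ltr_pM2r ?invr_gt0// ltrD2r.
case: ifPn => _; last by rewrite mule0.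
rewrite !EFinN -!EFinD -EFinM; congr EFin; field; exact: lt0r_neq0.
Qed.

Lemma ge0_integral_affine (a b : R) (f : R -> \bar R) : (0 < a)%R ->
  measurable_fun [set: R] f -> (forall t, 0 <= f t) ->
  \int[mu]_t f t = a%:E * \int[mu]_t f (a * t + b)%R.
Proof.
move=> a0 mf f0.
pose phi : R -> measurableTypeR R := fun t : R => (a * t + b)%R.
pose m : {measure set (measurableTypeR R) -> \bar R} :=
  pushforward mu phi.
rewrite -[RHS](_ : (NngNum (ltW a0))%:num%:E * \int[m (@measurable_affine a b)]_t f t = _).
  rewrite -ge0_integral_mscale//=.
  apply: eq_measure_integral => A mA _.
  transitivity (a%:E * mu (phi @^-1` A)); last by [].
  exact: (@lebesgue_measure_affine a b A a0 mA).
by rewrite ge0_integral_pushforward//; exact: measurable_affine.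
Qed.

Lemma ge0_integral_opp (f : R -> \bar R) :
  measurable_fun [set: R] f -> (forall t, 0 <= f t) ->
  \int[mu]_t f (- t)%R = \int[mu]_t f t.
Proof.
move=> mf f0.
transitivity (\int[pushforward mu (-%R : R -> measurableTypeR R)]_t f t).
  by rewrite ge0_integral_pushforward.
by apply: eq_measure_integral => //= A mA _; rewrite lebesgue_measureN.
Qed.

End affine_change.

(** * The Prekopa-Leindler inequality on the line *)

Section brunn_minkowski.
Context {R : realType}.
Local Notation mu := (@lebesgue_measure R).
Local Open Scope ereal_scope.

Lemma lebesgue_measure_shift (b : R) (A : set R) : measurable A ->
  mu ((fun t => (t + b)%R) @^-1` A) = mu A.
Proof.
move=> mA; rewrite [RHS](@lebesgue_measure_affine _ 1 b)// mul1e.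
by congr (mu _); apply/funext => t /=; rewrite mul1r.
Qed.

Lemma compact_has_max (K : set R) : K !=set0 -> compact K ->
  exists2 a, K a & forall x, K x -> (x <= a)%R.
Proof.
move=> K0 cK.
have [|a Ka am] := @compact_EVT_max R R id K K0 cK.
  by apply: continuous_subspaceT => x; exact: cvg_id.
by exists a => [|x Kx]; [exact: set_mem|apply: am; rewrite inE].
Qed.

(** On the line, K shifted by the minimum b of L and L shifted by the maximum a of K
both lie in K + L and meet only at a + b. *)
Lemma brunn_minkowski_compact (K L C : set R) : K !=set0 -> L !=set0 ->
  compact K -> compact L -> measurable C ->
  (forall a b, K a -> L b -> C (a + b)%R) -> mu K + mu L <= mu C.
Proof.
move=> K0 L0 cK cL mC KLC.
have [a Ka amax] := compact_has_max K0 cK.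
have [b Lb bmin] : exists2 b, L b & forall x, L x -> (b <= x)%R.
  have [x [Lx]] : exists x, L x /\ True by case: L0 => x; exists x.
  have [||b' [b Lb <-] bm] := @compact_has_max [set (- x)%R | x in L].
  - by exists (- x)%R, x.
  - apply: continuous_compact => //; apply: continuous_subspaceT => z.
    exact: opp_continuous.
  - by exists b => // z Lz; rewrite -lerN2; apply: bm; exists z.
have mK : measurable K by exact: compact_measurable.
have mL : measurable L by exact: compact_measurable.
set s := (a + b)%R.
have mKa : measurable (K `\ a) by apply: measurableD => //; exact: measurable_set1.
have -> : mu K = mu (K `\ a).
  rewrite (measureDI mu mK (measurable_set1 a)) -[RHS]adde0; congr (_ + _).
  apply/eqP; rewrite eq_le measure_ge0 andbT -(lebesgue_measure_set1 a).
  by apply: le_measure; rewrite ?inE//; exact: measurableI.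
rewrite -(lebesgue_measure_shift (- b) mKa) -(lebesgue_measure_shift (- a) mL).
have mK' : measurable ((fun t => t - b)%R @^-1` (K `\ a)).
  by rewrite -[X in measurable X]setTI; apply: measurable_funB.
have mL' : measurable ((fun t => t - a)%R @^-1` L).
  by rewrite -[X in measurable X]setTI; apply: measurable_funB.
rewrite -measureU//.
  apply: le_measure; rewrite ?inE//; first exact: measurableU.
  move=> t [[/= Kt _]|/= Lt].
    by rewrite -(subrK b t); exact: KLC.
  by rewrite -(subrK a t) addrC; exact: KLC.
apply/seteqP; split => // t [[/= Kt /eqP ta] Lt].
have := amax _ Kt; have := bmin _ Lt; move/eqP: ta; lra.
Qed.

(** Inner regularity reduces to compact sets; a point of A and a point of B are added to
the approximating compact sets to keep them nonempty. *)
Lemma brunn_minkowski1 (A B C : set R) : A !=set0 -> B !=set0 ->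
  measurable A -> measurable B -> measurable C ->
  (forall a b, A a -> B b -> C (a + b)%R) -> mu A + mu B <= mu C.
Proof.
move=> [a0 Aa0] [b0 Bb0] mA mB mC ABC.
have [->|Coo] := eqVneq (mu C) +oo; first by rewrite leey.
have Cfin : mu C \is a fin_num by rewrite ge0_fin_numE// lt_neqAle Coo leey.
have KL K L : K `<=` A -> L `<=` B -> K !=set0 -> L !=set0 ->
    compact K -> compact L -> mu K + mu L <= mu C.
  move=> KA LB K0 L0 cK cL; apply: brunn_minkowski_compact => // a b Ka Lb.
  by apply: ABC; [exact: KA|exact: LB].
have KL' K L : K `<=` A -> L `<=` B -> compact K -> compact L ->
    mu K + mu L <= mu C.
  move=> KA LB cK cL.
  have mono (X Y : set R) : compact X -> compact Y -> mu X <= mu (X `|` Y).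
    move=> cX cY; apply: le_measure; rewrite ?inE//.
    - exact: compact_measurable.
    - by apply: measurableU; exact: compact_measurable.
  have c1 (x : R) : compact [set x] by exact: compact_set1.
  apply: (@le_trans _ _ (mu (K `|` [set a0]) + mu (L `|` [set b0]))).
    by apply: leeD; apply: mono => //; exact: compact_set1.
  apply: KL; do ?[exact: compactU].
  - by move=> x [/KA|->].
  - by move=> x [/LB|->].
  - by exists a0; right.
  - by exists b0; right.
have KB K : K `<=` A -> compact K -> mu K + mu B <= mu C.
  move=> KA cK.
  have Kfin : mu K \is a fin_num.
    rewrite ge0_fin_numE//; apply: le_lt_trans (_ : mu C < +oo).
      have := KL' K set0 KA (sub0set _) cK compact0.
      by rewrite measure0 adde0.
    by rewrite lt_neqAle Coo leey.
  rewrite addeC -leeBrDr// (lebesgue_regularity_inner_sup mB).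
  apply: ge_ereal_sup => _ [L [cL LB] <-].
  by rewrite leeBrDr// addeC; exact: KL'.
have Bfin : mu B \is a fin_num.
  rewrite ge0_fin_numE//; apply: le_lt_trans (_ : mu C < +oo).
    by have := KB set0 (sub0set _) compact0; rewrite measure0 add0e.
  by rewrite lt_neqAle Coo leey.
rewrite -leeBrDr// (lebesgue_regularity_inner_sup mA).
by apply: ge_ereal_sup => _ [K [cK KA] <-]; rewrite leeBrDr//; exact: KB.
Qed.

End brunn_minkowski.

Section prekopa_leindler_line.
Context {R : realType}.
Local Notation mu := (@lebesgue_measure R).
Local Open Scope ereal_scope.

Lemma lebesgue_measure_below (y : \bar R) : 0 <= y ->
  mu [set u | (0 <= u)%R /\ u%:E < y] = y.
Proof.
case: y => [r r0|_|]; last by rewrite leNgt ltNye.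
- have -> : [set u | (0 <= u)%R /\ u%:E < r%:E] = `[0%R, r[%classic.
    by apply/seteqP; split => u; rewrite /= in_itv/= lte_fin => /andP.
  rewrite lebesgue_measure_itv/= lte_fin; case: ifPn => [_|]; first by rewrite sube0.
  by rewrite -leNgt => r0'; congr EFin; rewrite lee_fin in r0; lra.
- have -> : [set u : R | (0 <= u)%R /\ u%:E < +oo] = `[0%R, +oo[%classic.
    apply/seteqP; split => u; rewrite /= in_itv/= ltry andbT; first by case.
    by split.
  by rewrite lebesgue_measure_itv/= ltry.
Qed.

(** Tonelli's theorem for the region below the graph of f. *)
Lemma layer_cake (f : R -> \bar R) : measurable_fun [set: R] f ->
  (forall x, 0 <= f x) ->
  \int[mu]_x f x = \int[mu]_(u in `[0%R, +oo[) mu [set x | u%:E < f x].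
Proof.
move=> mf f0.
pose S := [set z : R * R | (0 <= z.2)%R /\ z.2%:E < f z.1].
have mS : measurable S.
  have -> : S = [set z : R * R | 0 <= z.2%:E] `&` [set z | z.2%:E < f z.1].
    by apply/seteqP; split=> z /=; rewrite /S/= lee_fin.
  apply: measurableI; rewrite -[X in measurable X]setTI.
    apply: measurable_lee => //; apply/measurable_EFinP; exact: measurable_snd.
  apply: measurable_lte => //; first by apply/measurable_EFinP; exact: measurable_snd.
  by apply: measurableT_comp => //; exact: measurable_fst.
have mS1 : measurable_fun setT (fun z : R * R => (\1_S z)%:E : \bar R).
  by apply/measurable_EFinP; exact: measurable_indic.
have S0 (z : R * R) : 0 <= (\1_S z)%:E :> \bar R by rewrite lee_fin.
have e := @fubini_tonelli _ _ _ _ R mu mu _ mS1 S0.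
transitivity (\int[mu]_x \int[mu]_u (\1_S (x, u))%:E); last first.
  rewrite e [RHS]integral_mkcond; apply: eq_integral => u _; rewrite patchE.
  have mSu : measurable [set x | S (x, u)].
    have -> : [set x | S (x, u)] = ysection S u.
      by apply/seteqP; split => x /=; rewrite /ysection/= inE.
    exact: measurable_ysection.
  transitivity (mu [set x | S (x, u)]).
    transitivity (\int[mu]_x (\1_[set x | S (x, u)] x)%:E).
      apply: eq_integral => x _; rewrite !indicE.
      suff -> : ((x, u) \in S) = (x \in [set x | S (x, u)]) by [].
      by apply/idP/idP => /set_mem ?; exact/mem_set.
    by rewrite (integral_indic mu measurableT mSu) setIT.
  case: ifPn; rewrite ?inE ?notin_setE/= in_itv/= andbT => u0.
    by congr (mu _); apply/seteqP; split => x /=; [case|split].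
  have -> : [set x | S (x, u)] = set0.
    apply/seteqP; split; first exact: (fun x H => u0 (proj1 H)).
    exact: sub0set.
  exact: measure0.
apply: eq_integral => x _.
have mSx : measurable [set u | S (x, u)].
  have -> : [set u | S (x, u)] = xsection S x.
    by apply/seteqP; split => u /=; rewrite /xsection/= inE.
  exact: measurable_xsection.
transitivity (mu [set u | S (x, u)]); last first.
  transitivity (\int[mu]_u (\1_[set u | S (x, u)] u)%:E).
    by rewrite (integral_indic mu measurableT mSx) setIT.
  apply: eq_integral => u _; rewrite !indicE.
  suff -> : ((x, u) \in S) = (u \in [set u | S (x, u)]) by [].
  by apply/idP/idP => /set_mem ?; exact/mem_set.
exact: esym (lebesgue_measure_below (f0 x)).
Qed.

Lemma measurable_superlevel_measure (h : R -> \bar R) : measurable_fun [set: R] h ->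
  measurable_fun setT (fun u : R => mu [set x | u%:E < h x]).
Proof.
move=> mh; pose S := [set z : R * R | z.2%:E < h z.1].
have mS : measurable S.
  rewrite -[X in measurable X]setTI; apply: measurable_lte => //.
    by apply/measurable_EFinP; exact: measurable_snd.
  by apply: measurableT_comp => //; exact: measurable_fst.
have := @measurable_fun_ysection _ _ _ _ R mu S mS.
congr measurable_fun; apply/funext => u; congr (mu _).
by apply/seteqP; split => x /=; rewrite /ysection/= inE.
Qed.

(** The sets {f > u} and {g > u} are both nonempty below the common supremum 1,
so that the one-dimensional Brunn-Minkowski inequality applies to them. *)
Lemma prekopa_leindler_normalized (f g M : R -> \bar R) :
  measurable_fun [set: R] f -> measurable_fun [set: R] g ->
  measurable_fun [set: R] M ->
  (forall x, 0 <= f x <= 1) -> (forall x, 0 <= g x <= 1) -> (forall x, 0 <= M x) ->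
  (forall u, (u < 1)%R -> exists x, u%:E < f x) ->
  (forall u, (u < 1)%R -> exists x, u%:E < g x) ->
  (forall u a b, (0 <= u)%R -> u%:E < f a -> u%:E < g b -> u%:E < M (a + b)%R) ->
  \int[mu]_x f x + \int[mu]_x g x <= \int[mu]_x M x.
Proof.
move=> mf mg mM f01 g01 M0 fne gne fgM.
have f0 x : 0 <= f x by case/andP: (f01 x).
have g0 x : 0 <= g x by case/andP: (g01 x).
rewrite (layer_cake mf f0) (layer_cake mg g0) (layer_cake mM M0).
have mlev (h : R -> \bar R) u : measurable_fun [set: R] h ->
    measurable [set x | u%:E < h x].
  by move=> mh; rewrite -[X in measurable X]setTI; exact: measurable_lte.
pose I : set R := `[0%R, +oo[%classic.
have mmlev (h : R -> \bar R) : measurable_fun [set: R] h ->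
    measurable_fun I (fun u : R => mu [set x | u%:E < h x]).
  by move=> mh; apply: measurable_funTS; exact: measurable_superlevel_measure.
have mI : measurable I by exact: measurable_itv.
have mge0 (h : R -> \bar R) (u : R) : 0 <= mu [set x | u%:E < h x].
  exact: measure_ge0.
have empty (h : R -> \bar R) (u : R) : (forall x, 0 <= h x <= 1) -> (1 <= u)%R ->
    mu [set x | u%:E < h x] = 0.
  move=> h01 u1; have -> : [set x | u%:E < h x] = set0; last exact: measure0.
  apply/seteqP; split; last exact: sub0set.
  move=> x /= ux; have /andP[_ /(lt_le_trans ux)] := h01 x.
  by rewrite lte_fin ltNge u1.
rewrite -ge0_integralD//; do ?[exact: mmlev]; do ?[by move=> u _; exact: mge0].
apply: ge0_le_integral => //; do ?[exact: mmlev].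
- by move=> u _; apply: adde_ge0; exact: mge0.
- by apply: emeasurable_funD; exact: mmlev.
move=> u; rewrite /= in_itv/= andbT => u0.
have [u1|u1] := leP 1%R u.
  rewrite (empty f u f01 u1) (empty g u g01 u1) adde0; exact: mge0.
apply: brunn_minkowski1; do ?[exact: mlev].
- exact: fne.
- exact: gne.
- by move=> a b /= fa gb; exact: fgM fa gb.
Qed.

(** Products of extended reals are discontinuous at the pairs (0, +oo); monotone
truncation still passes to the limit in one factor. *)
Lemma lee_mul_of_lim (u : (\bar R)^nat) (l y X : \bar R) :
  0 <= y -> (forall n, 0 <= u n) -> u n @[n --> \oo] --> l ->
  (forall n, u n * y <= X) -> l * y <= X.
Proof.
move=> y0 u0 ul uX.
have l0 : 0 <= l.
  rewrite -(cvg_lim _ ul)//; apply: lime_ge; first by apply/cvg_ex; exists l.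
  by near=> n.
have X0 : 0 <= X by apply: le_trans (uX 0%N); exact: mule_ge0.
case: y => [y| |]// in y0 uX *.
  have c : u n * y%:E @[n --> \oo] --> l * y%:E by exact: cvgeZr.
  rewrite -(cvg_lim _ c)//; apply: lime_le; first by apply/cvg_ex; exists (l * y%:E).
  by near=> n.
have [->|ln0] := eqVneq l 0; first by rewrite mul0e.
have lpos : 0 < l by rewrite lt_neqAle eq_sym ln0.
have [n un] : exists n, 0 < u n.
  apply: contrapT => un; move: ln0; apply/negP; rewrite negbK.
  rewrite eq_le l0 andbT -(cvg_lim _ ul)//; apply: lime_le.
    by apply/cvg_ex; exists l.
  near=> n.
  by rewrite leNgt; apply/negP => un0; apply: un; exists n.
have := uX n; rewrite gt0_muley// leye_eq => /eqP ->; exact: leey.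
Unshelve. all: by end_near. Qed.

(** Dividing f and g by their suprema F and G reduces to the normalized case, with M divided
by the geometric mean of F and G; the arithmetic-geometric inequality then turns the
sum of integrals into their product, at the cost of the factor 4. *)
Lemma prekopa_leindler_bounded (f g : R -> R) (M : R -> \bar R) (K : R) :
  measurable_fun [set: R] f -> measurable_fun [set: R] g ->
  measurable_fun [set: R] M ->
  (forall x, 0 <= f x <= K)%R -> (forall x, 0 <= g x <= K)%R ->
  (forall x, 0 <= M x) ->
  (forall a b, (f a * g b)%:E <= M (a + b)%R * M (a + b)%R) ->
  4%:E * ((\int[mu]_x (f x)%:E) * \int[mu]_x (g x)%:E) <=
    (\int[mu]_x M x) * \int[mu]_x M x.
Proof.
move=> mf mg mM f0 g0 M0 fgM.
have MM0 : 0 <= \int[mu]_x M x by apply: integral_ge0 => x _.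
have triv (h : R -> R) : (forall x, 0 <= h x)%R -> ~ (exists x, 0 < h x)%R ->
    \int[mu]_x (h x)%:E = 0.
  move=> h0 hn; apply: integral0_eq => x _; congr EFin.
  by apply/eqP; rewrite eq_le h0 andbT leNgt; apply/negP => hx; apply: hn; exists x.
have fge0 x : (0 <= f x)%R by case/andP: (f0 x).
have gge0 x : (0 <= g x)%R by case/andP: (g0 x).
have [fpos|/(triv f fge0) ->] := pselect (exists x, 0 < f x)%R; last first.
  by rewrite mul0e mule0 mule_ge0.
have [gpos|/(triv g gge0) ->] := pselect (exists x, 0 < g x)%R; last first.
  by rewrite mule0 mule0 mule_ge0.
have supP (h : R -> R) : (forall x, 0 <= h x <= K)%R -> (exists x, 0 < h x)%R ->
    exists2 H, (0 < H)%R & (forall x, 0 <= h x / H <= 1)%R /\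
      (forall u, u < 1 -> exists x, u < h x / H)%R.
  move=> hK [x0 hx0].
  have hs : has_sup [set h x | x in setT].
    by split; [exists (h x0), x0|exists K => _ [x _ <-]; case/andP: (hK x)].
  have le x : (h x <= sup [set h x | x in setT])%R.
    by apply: sup_upper_bound => //; exists x.
  have pos : (0 < sup [set h x | x in setT])%R by exact: lt_le_trans (le x0).
  exists (sup [set h x | x in setT]); first exact: pos.
  split=> [x|u u1].
    by rewrite ler_pdivrMr// mul1r le andbT divr_ge0 ?(ltW pos)//; case/andP: (hK x).
  have [_ [x _ <-] hx] := sup_adherent (eps := (1 - u) * sup [set h x | x in setT])
     ltac:(by rewrite mulr_gt0// subr_gt0) hs.
  by exists x; rewrite ltr_pdivlMr//; apply: le_lt_trans hx; lra.
have [F Fp [F01 Fn]] := supP f f0 fpos.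
have [G Gp [G01 Gn]] := supP g g0 gpos.
(* level u of f / F and g / G forces level u of M / H *)
pose H := Num.sqrt (F * G).
have Hp : (0 < H)%R by rewrite sqrtr_gt0 mulr_gt0.
have := @prekopa_leindler_normalized (fun x => (f x / F)%:E) (fun x => (g x / G)%:E)
   (fun x => (H^-1)%:E * M x).
have mMH : measurable_fun [set: R] (fun x => (H^-1)%:E * M x) by exact: measurable_funeM.
have mfF : measurable_fun [set: R] (fun x => (f x / F)%:E).
  by apply/measurable_EFinP; exact: measurable_funM.
have mgG : measurable_fun [set: R] (fun x => (g x / G)%:E).
  by apply/measurable_EFinP; exact: measurable_funM.
move=> /(_ mfF mgG mMH).
have key : (forall u a b, (0 <= u)%R -> u%:E < (f a / F)%:E -> u%:E < (g b / G)%:E ->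
  u%:E < (H^-1)%:E * M (a + b)%R).
  move=> u a b u0; rewrite !lte_fin !ltr_pdivlMr// => fa gb.
  have := fgM a b; have := M0 (a + b)%R.
  case: (M (a + b)%R) => [m m0| _ _|//]; last first.
    by rewrite gt0_muley ?lte_fin ?invr_gt0// ltry.
  rewrite -!EFinM lte_fin lee_fin => fgm; rewrite lee_fin in m0.
  rewrite mulrC ltr_pdivlMr//.
  have HH : (H * H = F * G)%R by rewrite -expr2 sqr_sqrtr// mulr_ge0// ltW.
  rewrite ltNge; apply/negP => mu1.
  have : (m * m <= (u * H) * (u * H))%R by exact: ler_pM.
  have -> : ((u * H) * (u * H) = (u * F) * (u * G))%R by rewrite mulrACA HH mulrACA.
  apply/negP; rewrite -ltNge; apply: lt_le_trans fgm.
  by apply: ltr_pM => //; rewrite mulr_ge0// ltW.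
move=> /(_ _ _ _ _ _ key) PL.
have {}PL : (F^-1)%:E * (\int[mu]_x (f x)%:E) + (G^-1)%:E * (\int[mu]_x (g x)%:E)
   <= (H^-1)%:E * \int[mu]_x M x.
{ rewrite -!ge0_integralZl ?lee_fin ?invr_ge0 ?(ltW Fp) ?(ltW Gp) ?(ltW Hp)//.
  - under eq_integral do rewrite -EFinM mulrC.
    under [X in _ + X <= _]eq_integral do rewrite -EFinM mulrC.
    apply: PL => [x|x|x|u u1|u u1].
    + by rewrite !lee_fin.
    + by rewrite !lee_fin.
    + by rewrite mule_ge0// lee_fin invr_ge0 ltW.
    + by have [x hx] := Fn u u1; exists x; rewrite lte_fin.
    + by have [x hx] := Gn u u1; exists x; rewrite lte_fin.
  all: try exact/measurable_EFinP.
  all: by move=> x _; rewrite lee_fin. }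
have Fi0 : 0 < (F^-1)%:E by rewrite lte_fin invr_gt0.
have Gi0 : 0 < (G^-1)%:E by rewrite lte_fin invr_gt0.
have notNy (x : \bar R) : 0 <= x -> x != -oo.
  by move=> x0; rewrite gt_eqF// (lt_le_trans _ x0)// ltNyr.
move: PL MM0.
have : 0 <= \int[mu]_x (f x)%:E by apply: integral_ge0 => x _; rewrite lee_fin.
have : 0 <= \int[mu]_x (g x)%:E by apply: integral_ge0 => x _; rewrite lee_fin.
move: (\int[mu]_x (g x)%:E) (\int[mu]_x (f x)%:E) (\int[mu]_x M x) => J I.
case=> [m| |] J0 I0; last 2 first.
- by move=> _ _; rewrite mulyy leey.
- by move=> _; rewrite leeNy_eq.
move: J0 I0; case: I => [i| |]//; last first.
  move=> J0 _; rewrite gt0_muley// addye ?leye_eq//.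
  by apply: notNy; rewrite mule_ge0// ltW.
case: J => [j| |]//; last first.
  by move=> _ _; rewrite gt0_muley// addey.
  rewrite -!EFinM -EFinD !lee_fin => j0 i0 le m0.
  have HH : (H * H = F * G)%R by rewrite -expr2 sqr_sqrtr// mulr_ge0// ltW.
  have : ((F^-1 * i + G^-1 * j) ^+ 2 <= (H^-1 * m) ^+ 2)%R.
    by rewrite lerXn2r// nnegrE ?addr_ge0// mulr_ge0// ?invr_ge0 ltW.
  have -> : ((H^-1 * m) ^+ 2 = F^-1 * G^-1 * m ^+ 2)%R.
    by rewrite exprMn exprVn expr2 HH invfM.
  have q : (0 <= (F^-1 * i - G^-1 * j) ^+ 2)%R by exact: sqr_ge0.
  have : (0 < F^-1 * G^-1)%R by rewrite mulr_gt0// invr_gt0.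
  set s := (F^-1 * G^-1)%R => s0 le2.
  rewrite -(ler_pM2l s0) -expr2; apply: le_trans le2; rewrite /s; move: q; clear; nra.
Qed.

Lemma cvg_min_nat (y : \bar R) : 0 <= y ->
  Order.min y n%:R%:E @[n --> \oo] --> y.
Proof.
case: y => [r r0|_|]; last by rewrite leNgt ltNye.
  apply: cvg_near_cst; near=> n.
  rewrite min_l// lee_fin; near: n; exact: nbhs_infty_ger.
have -> : (fun n : nat => Order.min +oo n%:R%:E) = (fun n => n%:R%:E) :> (nat -> \bar R).
  by apply/funext => n; rewrite min_r// leey.
exact/cvgenyP.
Unshelve. all: by end_near. Qed.

(** Truncation reduces to bounded functions; the factor 4 of the bounded case is
absorbed by the change of variable from a + b to (a + b) / 2. *)
Lemma prekopa_leindler (f g M : R -> \bar R) :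
  measurable_fun [set: R] f -> measurable_fun [set: R] g ->
  measurable_fun [set: R] M ->
  (forall x, 0 <= f x) -> (forall x, 0 <= g x) -> (forall x, 0 <= M x) ->
  (forall a b, f a * g b <= M ((a + b) / 2)%R * M ((a + b) / 2)%R) ->
  (\int[mu]_x f x) * (\int[mu]_x g x) <= (\int[mu]_x M x) * \int[mu]_x M x.
Proof.
move=> mf mg mM f0 g0 M0 fgM.
pose tr (h : R -> \bar R) (n : nat) (x : R) : R := fine (Order.min (h x) n%:R%:E).
have trE (h : R -> \bar R) n x : 0 <= h x -> (tr h n x)%:E = Order.min (h x) n%:R%:E.
  move=> hx0; rewrite fineK// fin_numElt; apply/andP; split.
    by rewrite lt_min ltNyr (lt_le_trans _ hx0)// ltNyr.
  by rewrite gt_min ltry orbT.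
have tr0 (h : R -> \bar R) n x : 0 <= h x -> (0 <= tr h n x <= n%:R)%R.
  move=> hx0; rewrite -!lee_fin trE// le_min hx0/= lee_fin ler0n/=.
  by rewrite ge_min lexx orbT.
have trle (h : R -> \bar R) n x : 0 <= h x -> (tr h n x)%:E <= h x.
  by move=> hx0; rewrite trE// ge_min lexx.
have mtr (h : R -> \bar R) n : measurable_fun [set: R] h -> measurable_fun [set: R] (tr h n).
  move=> mh; apply: measurableT_comp => //.
  exact: measurable_mine.
have trcvg (h : R -> \bar R) : measurable_fun [set: R] h -> (forall x, 0 <= h x) ->
    \int[mu]_x (tr h n x)%:E @[n --> \oo] --> \int[mu]_x h x.
  move=> mh h0.
  have lim_tr x : limn (fun n => (tr h n x)%:E) = h x.
    apply/cvg_lim => //; under eq_cvg do rewrite trE//.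
    exact: cvg_min_nat.
  rewrite (_ : \int[mu]_x h x = \int[mu]_x limn (fun n => (tr h n x)%:E)).
    apply: cvg_monotone_convergence => //.
    - by move=> n; apply/measurable_EFinP; exact: mtr.
    - by move=> n x _; rewrite lee_fin; case/andP: (tr0 h n x (h0 x)).
    - move=> x _ m n mn; rewrite !trE// le_min ge_min lexx/= ge_min lee_fin ler_nat mn.
      by rewrite orbT.
  by apply: eq_integral => x _; rewrite lim_tr.
have trI0 h n : (forall x, 0 <= h x) -> 0 <= \int[mu]_x (tr h n x)%:E.
  by move=> h0; apply: integral_ge0 => x _; rewrite lee_fin; case/andP: (tr0 h n x (h0 x)).
have MI0 : 0 <= \int[mu]_x M x by exact: integral_ge0.
have gI0 : 0 <= \int[mu]_x g x by exact: integral_ge0.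
have MM : \int[mu]_x M (2^-1 * x)%R = 2%:E * \int[mu]_x M x.
  rewrite (@ge0_integral_affine _ 2^-1 0 M)// ?invr_gt0// muleA -EFinM divff// mul1e.
  by apply: eq_integral => x _; rewrite addr0.
have bnd n m : (\int[mu]_x (tr f n x)%:E) * (\int[mu]_x (tr g m x)%:E) <=
    (\int[mu]_x M x) * \int[mu]_x M x.
  have := @prekopa_leindler_bounded (tr f n) (tr g m) (fun x => M (2^-1 * x)%R)
    (maxn n m)%:R (mtr _ _ mf) (mtr _ _ mg).
  rewrite MM => H.
  have : 4%:E * ((\int[mu]_x (tr f n x)%:E) * (\int[mu]_x (tr g m x)%:E)) <=
     4%:E * ((\int[mu]_x M x) * \int[mu]_x M x).
    apply: le_trans (H _ _ _ _ _) _.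
    - by apply: measurableT_comp.
    - move=> x; have /andP[-> /=] := tr0 f n x (f0 x).
      by move=> /le_trans; apply; rewrite ler_nat leq_maxl.
    - move=> x; have /andP[-> /=] := tr0 g m x (g0 x).
      by move=> /le_trans; apply; rewrite ler_nat leq_maxr.
    - by move=> x; exact: M0.
    - move=> a b; rewrite EFinM mulrC; apply: le_trans (fgM a b).
      apply: lee_pmul; rewrite ?trle//.
      by rewrite lee_fin; case/andP: (tr0 f n a (f0 a)).
      by rewrite lee_fin; case/andP: (tr0 g m b (g0 b)).
    by rewrite muleACA -EFinM -natrM.
  by rewrite lee_pmul2l// lte_fin.
apply: (lee_mul_of_lim gI0 _ (trcvg f mf f0)) => n; first exact: trI0.
rewrite muleC; apply: (lee_mul_of_lim (trI0 f n f0) _ (trcvg g mg g0)) => m.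
  exact: trI0.
by rewrite muleC.
Qed.
End prekopa_leindler_line.

(** * Integration over the spins of a list of sites *)

Section config.
Context {R : realType} {d : nat}.
Implicit Types (phi psi : Zd d -> R) (s : seq (Zd d)) (F G : (Zd d -> R) -> \bar R).
Local Notation mu := (@lebesgue_measure R).
Local Open Scope ereal_scope.

Definition upd phi (x : Zd d) (t : R) : Zd d -> R :=
  fun y => if y == x then t else phi y.

Definition cfg_measurable F := measurable_fun [set: Omega R d] (F : Omega R d -> \bar R).

Lemma leb_int_cons x s F phi :
  leb_int (x :: s) F phi = \int[mu]_t leb_int s F (upd phi x t).
Proof. by []. Qed.

Lemma measurable_coord (x : Zd d) :
  measurable_fun [set: Omega R d] (fun phi : Omega R d => phi x).
Proof.
move=> _ B mB; rewrite setTI; apply: sub_sigma_algebra; exists x => //.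
by exists B.
Qed.

Lemma measurable_to_cfg d' (T : measurableType d') (f : T -> Omega R d) :
  (forall y, measurable_fun setT (fun t => f t y)) -> measurable_fun setT f.
Proof.
move=> mf; apply: (@measurability _ _ T (Omega R d) setT f (@cylinders R d)) => [//|].
move=> _ [_ [y _ [B mB <-]] <-]; rewrite setTI.
by have := mf y measurableT B mB; rewrite setTI.
Qed.

Lemma measurable_upd (x : Zd d) :
  measurable_fun [set: R * Omega R d]
    (fun p : R * Omega R d => upd p.2 x p.1 : Omega R d).
Proof.
apply: measurable_to_cfg => y; rewrite /upd; case: eqP => _.
  exact: measurable_fst.
by apply: (measurableT_comp (measurable_coord y)); exact: measurable_snd.
Qed.

Lemma measurable_upd1 (x : Zd d) phi :
  measurable_fun [set: R] (fun t : R => upd phi x t : Omega R d).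
Proof. by apply: measurable_to_cfg => y; rewrite /upd; case: eqP. Qed.

Lemma leb_int_ge0 s F phi : (forall phi, 0 <= F phi) -> 0 <= leb_int s F phi.
Proof.
by move=> F0; elim: s phi => //= x s IH phi; apply: integral_ge0 => t _; exact: IH.
Qed.

Lemma measurable_leb_int s F : (forall phi, 0 <= F phi) -> cfg_measurable F ->
  cfg_measurable (leb_int s F).
Proof.
move=> F0 mF; elim: s => //= x s IH.
apply: (@measurable_fun_fubini_tonelli_G _ _ (measurableTypeR R) (Omega R d) R mu
  (fun p : R * Omega R d => leb_int s F (upd p.2 x p.1))).
  exact: measurableT_comp IH (measurable_upd x).
by move=> p; exact: leb_int_ge0.
Qed.

Lemma leb_int_ext s F G phi : (forall psi, F psi = G psi) ->
  leb_int s F phi = leb_int s G phi.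
Proof. by move=> FG; have -> : F = G by exact/funext. Qed.

Lemma leb_int_le s F G phi : (forall psi, 0 <= F psi) ->
  cfg_measurable F -> cfg_measurable G -> (forall psi, F psi <= G psi) ->
  leb_int s F phi <= leb_int s G phi.
Proof.
move=> F0 mF mG FG; have G0 psi : 0 <= G psi by exact: le_trans (FG psi).
elim: s phi => //= x s IH phi; apply: ge0_le_integral => //.
- by move=> t _; exact: leb_int_ge0.
- exact: measurableT_comp (measurable_leb_int s F0 mF) (measurable_upd1 x phi).
- exact: measurableT_comp (measurable_leb_int s G0 mG) (measurable_upd1 x phi).
Qed.

Lemma leb_intZl s F (k : R) phi : (0 <= k)%R -> (forall psi, 0 <= F psi) ->
  cfg_measurable F ->
  leb_int s (fun psi => k%:E * F psi) phi = k%:E * leb_int s F phi.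
Proof.
move=> k0 F0 mF; elim: s phi => //= x s IH phi.
under eq_integral do rewrite IH.
rewrite ge0_integralZl_EFin//; first by move=> t _; exact: leb_int_ge0.
exact: measurableT_comp (measurable_leb_int s F0 mF) (measurable_upd1 x phi).
Qed.

Lemma leb_int_cat s1 s2 F phi :
  leb_int (s1 ++ s2) F phi = leb_int s1 (leb_int s2 F) phi.
Proof. by elim: s1 phi => //= x s1 IH phi; apply: eq_integral => t _; exact: IH. Qed.

Lemma leb_int_swap x y s F phi : (forall psi, 0 <= F psi) -> cfg_measurable F ->
  leb_int [:: x, y & s] F phi = leb_int [:: y, x & s] F phi.
Proof.
move=> F0 mF; have [->//|xy] := eqVneq x y.
have m2 : measurable_fun [set: measurableTypeR R * measurableTypeR R]
    (fun p => leb_int s F (upd (upd phi x p.1) y p.2)).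
  apply: measurableT_comp (measurable_leb_int s F0 mF) _.
  apply: measurable_to_cfg => z; rewrite /upd; case: eqP => _.
    exact: measurable_snd.
  by case: eqP => _ //; exact: measurable_fst.
have nn p : 0 <= leb_int s F (upd (upd phi x p.1) y p.2) by exact: leb_int_ge0.
have := @fubini_tonelli _ _ (measurableTypeR R) (measurableTypeR R) R mu mu _ m2 nn.
move=> /= e; rewrite -[LHS]/(\int[mu]_t \int[mu]_u leb_int s F (upd (upd phi x t) y u)).
rewrite e; apply: eq_integral => u _; apply: eq_integral => t _.
congr (leb_int _ _ _); apply/funext => z; rewrite /upd.
by have [->|//] := eqVneq z y; rewrite eq_sym (negbTE xy).
Qed.

(** Tonelli's theorem, transposition by transposition. *)
Lemma leb_int_perm s1 s2 F phi : (forall psi, 0 <= F psi) -> cfg_measurable F ->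
  perm_eq s1 s2 -> leb_int s1 F phi = leb_int s2 F phi.
Proof.
move=> F0 mF; elim: s1 s2 phi => [|x s1 IH] s2 phi.
  by move=> p; have /esym/size0nil -> := perm_size p.
have front a b psi : leb_int (a ++ x :: b) F psi = leb_int (x :: a ++ b) F psi.
  elim: a psi => // y a IHa psi; rewrite leb_int_swap//.
  by rewrite 2!leb_int_cons; apply: eq_integral => t _; exact: IHa.
move=> p; have xs2 : x \in s2 by rewrite -(perm_mem p) mem_head.
case/splitPr: xs2 p => a b p; rewrite front !leb_int_cons.
apply: eq_integral => t _; apply: IH.
by rewrite -(perm_cons x) (permPl p) perm_catC/= perm_cons perm_catC.
Qed.

Lemma leb_int_opp s F phi : (forall psi, 0 <= F psi) -> cfg_measurable F ->
  leb_int s (fun psi => F (fun x => - psi x)%R) phi = leb_int s F (fun x => - phi x)%R.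
Proof.
move=> F0 mF; elim: s phi => // x s IH phi; rewrite !leb_int_cons.
have mm : measurable_fun [set: R] (fun t => leb_int s F (upd (fun y => - phi y)%R x t)).
  exact: measurableT_comp (measurable_leb_int s F0 mF) (measurable_upd1 x _).
rewrite -(ge0_integral_opp mm); last by move=> t; exact: leb_int_ge0.
apply: eq_integral => t _; rewrite IH; congr (leb_int _ _ _); apply/funext => y.
by rewrite /upd; case: eqP.
Qed.

Definition mid phi psi : Zd d -> R := fun x => ((phi x + psi x) / 2)%R.

Definition agree_off s phi psi := forall x, x \notin s -> phi x = psi x.

(** The inequality tensorizes: integrated over one spin, its hypothesis for a list of
sites becomes its hypothesis for the remaining ones. *)
Lemma prekopa_leindler_cfg s F G M phi psi :
  (forall psi, 0 <= F psi) -> (forall psi, 0 <= G psi) -> (forall psi, 0 <= M psi) ->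
  cfg_measurable F -> cfg_measurable G -> cfg_measurable M ->
  (forall phi' psi', agree_off s phi' phi -> agree_off s psi' psi ->
     F phi' * G psi' <= M (mid phi' psi') * M (mid phi' psi')) ->
  leb_int s F phi * leb_int s G psi <=
    leb_int s M (mid phi psi) * leb_int s M (mid phi psi).
Proof.
move=> F0 G0 M0 mF mG mM; elim: s phi psi => [|x s IH] phi psi FGM.
  by apply: FGM.
rewrite !leb_int_cons; apply: prekopa_leindler.
- exact: measurableT_comp (measurable_leb_int s F0 mF) (measurable_upd1 x phi).
- exact: measurableT_comp (measurable_leb_int s G0 mG) (measurable_upd1 x psi).
- exact: measurableT_comp (measurable_leb_int s M0 mM) (measurable_upd1 x _).
- by move=> t; exact: leb_int_ge0.
- by move=> t; exact: leb_int_ge0.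
- by move=> t; exact: leb_int_ge0.
move=> t u.
have -> : upd (mid phi psi) x ((t + u) / 2) = mid (upd phi x t) (upd psi x u).
  by apply/funext => y; rewrite /upd /mid; case: eqP.
apply: IH => phi' psi' a b; apply: FGM => y; rewrite inE negb_or => /andP[yx ys].
  by rewrite a// /upd (negbTE yx).
by rewrite b// /upd (negbTE yx).
Qed.

(** Each w y depends on the coordinate y and on coordinates outside s only, so
the integrals over the coordinates in s decouple. *)
Lemma leb_int_prod s (w : Zd d -> (Zd d -> R) -> R) (f : (Zd d -> R) -> R) phi : uniq s ->
  (forall y psi, 0 <= w y psi)%R -> (forall y, cfg_measurable (EFin \o w y)) ->
  (forall psi, 0 <= f psi)%R -> cfg_measurable (EFin \o f) ->
  (forall y psi psi', y \in s -> psi y = psi' y -> agree_off s psi psi' -> w y psi = w y psi') ->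
  (forall psi psi', agree_off s psi psi' -> f psi = f psi') ->
  leb_int s (fun psi => (f psi * \prod_(y <- s) w y psi)%:E) phi =
   (f phi)%:E * \prod_(y <- s) \int[mu]_t (w y (upd phi y t))%:E.
Proof.
move=> us w0 mw; elim: s us f phi => [|x s IH] us f phi F0 mF ws Fs.
  by rewrite /= !big_nil mulr1 mule1.
move: us => /= /andP[xs us].
rewrite big_cons.
have P0 : 0 <= \prod_(y <- s) \int[mu]_u (w y (upd phi y u))%:E.
  apply: (big_ind (fun z : \bar R => 0 <= z)); first exact: lee01.
    by move=> a b a0 b0; exact: mule_ge0.
  by move=> y _; apply: integral_ge0 => u _; rewrite lee_fin.
have mwx : measurable_fun [set: R] (fun t => (w x (upd phi x t))%:E).
  exact: measurableT_comp (mw x) (measurable_upd1 x phi).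
transitivity (\int[mu]_t ((f phi)%:E * (w x (upd phi x t))%:E *
    \prod_(y <- s) \int[mu]_u (w y (upd phi y u))%:E)).
  apply: eq_integral => t _.
  under leb_int_ext => psi do rewrite big_cons mulrA.
  rewrite (IH us (fun psi => f psi * w x psi)%R).
  - rewrite EFinM; congr (_%:E * _ * _).
      by apply: Fs => y; rewrite inE negb_or /upd => /andP[/negbTE ->].
    apply: eq_big_seq => y ys; apply: eq_integral => u _; congr EFin.
    apply: ws; first by rewrite inE ys orbT.
      by rewrite /upd eqxx.
    move=> z; rewrite inE negb_or /upd => /andP[zx zs].
    by rewrite (negbTE zx).
  - by move=> psi; rewrite mulr_ge0.
  - have /measurable_EFinP mF' := mF; have /measurable_EFinP mw' := mw x.
    by apply/measurable_EFinP; exact: measurable_funM.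
  - move=> y psi psi' ys e ag; apply: ws => //; first by rewrite inE ys orbT.
    by move=> z; rewrite inE negb_or => /andP[_ zs]; exact: ag.
  - move=> psi psi' ag; congr (_ * _)%R.
      by apply: Fs => z; rewrite inE negb_or => /andP[_ zs]; exact: ag.
    apply: ws; [exact: mem_head|exact: ag|].
    by move=> z; rewrite inE negb_or => /andP[_ zs]; exact: ag.
rewrite ge0_integralZr//; last 2 first.
- by apply: emeasurable_funM.
- by move=> t _; rewrite mule_ge0// lee_fin.
rewrite ge0_integralZl_EFin//; last by move=> t _; rewrite lee_fin.
by rewrite muleA.
Qed.

End config.

(** * Derivatives and log-concavity *)

Section calculus.
Context {R : realType}.
Implicit Types (f g : R -> R) (x a b : R).

(** This rule and the next ones state the usual ones for functions given by their values,
in which form they apply to explicit expressions. *)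
Lemma is_derive_add f g x a b : is_derive x 1 f a -> is_derive x 1 g b ->
  is_derive x 1 (fun y => f y + g y) (a + b).
Proof. by move=> df dg; exact: is_deriveD. Qed.

Lemma is_derive_sub f g x a b : is_derive x 1 f a -> is_derive x 1 g b ->
  is_derive x 1 (fun y => f y - g y) (a - b).
Proof. by move=> df dg; exact: is_deriveB. Qed.

Lemma is_derive_mul f g x a b : is_derive x 1 f a -> is_derive x 1 g b ->
  is_derive x 1 (fun y => f y * g y) (a * g x + f x * b).
Proof.
move=> df dg; apply: (is_derive_eq (is_deriveM df dg)).
by rewrite addrC /GRing.scale/= [g x * a]mulrC.
Qed.

Lemma is_derive_comp1 f g x a b : is_derive (g x) 1 f a -> is_derive x 1 g b ->
  is_derive x 1 (fun y => f (g y)) (a * b).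
Proof. by move=> df dg; exact: is_derive1_comp. Qed.

Lemma is_derive_affine (k c x : R) : is_derive x 1 (fun y => k * y + c) k.
Proof.
apply: (is_derive_eq (is_derive_add (is_derive_mul (is_derive_cst k x 1)
  (is_derive_id x 1)) (is_derive_cst c x 1))).
by rewrite mul0r add0r mulr1 addr0.
Qed.

Lemma is_derive_bigsum (I : Type) (r : seq I) (F : I -> R -> R) (dF : I -> R) (x : R) :
  (forall i, is_derive x 1 (F i) (dF i)) ->
  is_derive x 1 (fun y => \sum_(i <- r) F i y) (\sum_(i <- r) dF i).
Proof.
move=> d; elim: r => [|i r IH].
  under eq_fun do rewrite big_nil.
  by rewrite big_nil; exact: is_derive_cst.
under eq_fun do rewrite big_cons.
by rewrite big_cons; exact: is_derive_add.
Qed.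

Lemma is_derive_continuous f (df : R -> R) :
  (forall x, is_derive x 1 f (df x)) -> continuous f.
Proof.
move=> d x; apply: differentiable_continuous; apply/derivable1_diffP.
by apply: ex_derive.
Qed.

Lemma mean_value f (df : R -> R) (u v a b : R) :
  (forall x, u < x < v -> is_derive x 1 f (df x)) -> u < a -> b < v -> a < b ->
  exists2 c, a < c < b & f b - f a = df c * (b - a).
Proof.
move=> d ua bv ab.
have [||c] := @MVT R f df a b ab.
- move=> x; rewrite in_itv/= => /andP[ax xb]; apply: d.
  by rewrite (lt_trans ua ax) (lt_trans xb bv).
- apply: derivable_within_continuous => x; rewrite in_itv/= => /andP[ax xb].
  by have [] : is_derive x 1 f (df x) by apply: d; rewrite (lt_le_trans ua ax) (le_lt_trans xb bv).
by rewrite in_itv/= => cab e; exists c.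
Qed.

Lemma second_order_lower f f1 f2 (r x : R) :
  (forall y, - r < y < r -> is_derive y 1 f (f1 y)) ->
  (forall y, - r < y < r -> is_derive y 1 f1 (f2 y)) ->
  (forall y, - r < y < r -> 0 <= f2 y) -> - r < x < r ->
  f 0 + f1 0 * x <= f x.
Proof.
move=> d1 d2 f20 /andP[rx xr].
have r0 : 0 < r by lra.
have mono y z : - r < y -> z < r -> y < z -> f1 y <= f1 z.
  move=> ry zr yz; have [c /andP[yc cz] e] := mean_value d2 ry zr yz.
  rewrite -subr_ge0 e mulr_ge0 ?f20//; last by rewrite subr_ge0 ltW.
  by rewrite (lt_trans ry yc) (lt_trans cz zr).
have [x0|x0|->] := ltgtP x 0; last by rewrite mulr0 addr0.
  have [|c /andP[xc c0] e] := mean_value d1 rx _ x0; first lra.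
  have : f1 c <= f1 0 by apply: mono => //; lra.
  nra.
have [|c /andP[xc c0] e] := mean_value d1 _ xr x0; first lra.
have : f1 0 <= f1 c by apply: mono => //; lra.
nra.
Qed.

(** If f2 were positive, f1 would be positive just to the right of 0, and f would increase
there. *)
Lemma second_derivative_max f f1 (f2 r : R) : 0 < r ->
  (forall y, - r < y < r -> is_derive y 1 f (f1 y)) -> f1 0 = 0 ->
  is_derive (0:R) 1 f1 f2 ->
  (forall y, - r < y < r -> f y <= f 0) -> f2 <= 0.
Proof.
move=> r0 d1 f10 [df1 df1E] fmax; rewrite leNgt; apply/negP => f2pos.
have cv : h^-1 *: (f1 (h *: (1 : R) + 0) - f1 0) @[h --> 0^'] --> f2.
  by rewrite -df1E; exact: df1.
have /cvgrPdist_lt/(_ _ f2pos) := cv.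
move=> /nbhs_ballP[e /= e0 he].
pose h := Num.min (e / 2) (r / 2).
have h0 : 0 < h by rewrite lt_min; apply/andP; split; lra.
have hr : h < r by rewrite gt_min; apply/orP; right; lra.
have he2 : h < e by rewrite gt_min; apply/orP; left; lra.
have [|c /andP[c0 ch] eq] := mean_value d1 _ hr h0; first lra.
have := he c; rewrite /ball/= sub0r normrN gtr0_norm//.
have /[swap] /[apply] : c < e by lra.
rewrite gt_eqF// => /(_ isT).
rewrite /GRing.scale/= mulr1 addr0 f10 subr0 => H.
have q0 : 0 < c^-1 * f1 c.
  by have := ler_norm (f2 - c^-1 * f1 c); lra.
have f1c : 0 < f1 c by move: q0; rewrite pmulr_rgt0 ?invr_gt0.
have := fmax h; have -> : - r < h < r by apply/andP; split; lra.
move=> /(_ isT); nra.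
Qed.

Lemma is_derive_oppx f x a : is_derive (- x) (1 : R) f a ->
  is_derive x (1 : R) (fun y => f (- y)) (- a).
Proof.
move=> df; apply: (is_derive_eq (is_derive_comp1 df (is_deriveN (is_derive_id x 1)))).
by rewrite mulrN1.
Qed.

End calculus.

Section log_derivatives.
Context {R : realType}.
Variables J J1 J2 : R -> R.
Hypothesis Jpos : forall x : R, -2 < x < 2 -> 0 < J x.
Hypothesis dJ : forall x : R, -2 < x < 2 -> is_derive x (1 : R) J (J1 x).
Hypothesis dJ1 : forall x : R, -2 < x < 2 -> is_derive x (1 : R) J1 (J2 x).

Lemma is_derive_lnJ (x : R) : -2 < x < 2 ->
  is_derive x (1 : R) (fun x => ln (J x)) (J1 x / J x).
Proof.
move=> x2; have J0 := Jpos x2.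
apply: (is_derive_eq (is_derive_comp1 (is_derive1_ln J0) (dJ x2))).
by rewrite mulrC.
Qed.

Lemma is_derive_lnJ1 (x : R) : -2 < x < 2 ->
  is_derive x (1 : R) (fun x => J1 x / J x) ((J2 x * J x - J1 x ^+ 2) / J x ^+ 2).
Proof.
move=> x2; have J0 := Jpos x2.
have Jn : J x != 0 by rewrite gt_eqF.
apply: (is_derive_eq (is_derive_mul (dJ1 x2)
  (is_deriveV Jn (dJ x2)))).
by rewrite /GRing.scale/=; field.
Qed.


Let G k x := ln (J x) + ln (J (- x)) + k * (x * x).
Let G1 k x := J1 x / J x - J1 (- x) / J (- x) + (k * 2) * x.
Let q x := (J2 x * J x - J1 x ^+ 2) / J x ^+ 2.

Let dG k (y : R) : -2 < y < 2 -> is_derive y (1 : R) (G k) (G1 k y).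
Proof.
move=> y2; have ny2 : -2 < - y < 2 by lra.
apply: (is_derive_eq (is_derive_add (is_derive_add (is_derive_lnJ y2)
   (is_derive_oppx (is_derive_lnJ ny2)))
   (is_derive_mul (is_derive_cst k y 1)
      (is_derive_mul (is_derive_id y 1) (is_derive_id y 1))))).
by rewrite /G1 /cst; ring.
Qed.

Let dG1 k (y : R) : -2 < y < 2 ->
  is_derive y (1 : R) (G1 k) (q y + q (- y) + 2 * k).
Proof.
move=> y2; have ny2 : -2 < - y < 2 by lra.
apply: (is_derive_eq (is_derive_add (is_derive_sub (is_derive_lnJ1 y2)
   (is_derive_oppx (is_derive_lnJ1 ny2)))
   (is_derive_mul (is_derive_cst (k * 2) y (1 : R)) (is_derive_id y (1 : R))))).
by rewrite /q /cst; ring.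
Qed.

Let G10 k : G1 k 0 = 0.
Proof. by rewrite /G1 oppr0 mulr0 addr0 subrr. Qed.

Let GE k y : -2 < y < 2 ->
  (G k y <= G k 0) = (J y * J (- y) <= expR (- (k * y ^+ 2)) * J 0 ^+ 2).
Proof.
move=> y2; have ny2 : -2 < - y < 2 by lra.
have J0 : 0 < J 0 by apply: Jpos; lra.
have Jy := Jpos y2; have Jny := Jpos ny2.
have JJ : 0 < J y * J (- y) by rewrite mulr_gt0.
have J00 : 0 < J 0 ^+ 2 by rewrite exprn_gt0.
have eJ : 0 < expR (- (k * y ^+ 2)) * J 0 ^+ 2 by rewrite mulr_gt0 ?expR_gt0.
rewrite -(ler_ln JJ eJ) (lnM (expR_gt0 _) J00) (lnM Jy Jny) expRK expr2 (lnM J0 J0).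
by rewrite /G oppr0 mulr0 mulr0 addr0; apply/idP/idP; lra.
Qed.

(** The hypothesis says that ln (J x) + ln (J (- x)) + k x^2 is maximal at 0, where its
second derivative is therefore nonpositive. *)
Lemma log_concave_of_pair k :
  (forall x, -2 < x < 2 -> J x * J (- x) <= expR (- (k * x ^+ 2)) * J 0 ^+ 2) ->
  J2 0 * J 0 - J1 0 ^+ 2 <= - k * J 0 ^+ 2.
Proof.
move=> h; have z2 : -2 < (0 : R) < 2 by lra.
have := dG1 k z2; rewrite oppr0 => d.
have : q 0 + q 0 + 2 * k <= 0.
  apply: (@second_derivative_max R (G k) (G1 k) _ 2) => //; first exact: dG.
  by move=> y y2; rewrite GE// h.
rewrite /q => qk.
have : (J2 0 * J 0 - J1 0 ^+ 2) / J 0 ^+ 2 <= - k by lra.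
by rewrite ler_pdivrMr// exprn_gt0// Jpos.
Qed.

(** Converse of the previous implication: the hypothesis makes the even function
ln (J x) + ln (J (- x)) + k x^2 concave. *)
Lemma pair_of_log_concave k :
  (forall x, -2 < x < 2 -> J2 x * J x - J1 x ^+ 2 <= - k * J x ^+ 2) ->
  forall x, -2 < x < 2 -> J x * J (- x) <= expR (- (k * x ^+ 2)) * J 0 ^+ 2.
Proof.
move=> h x x2; rewrite -GE//.
have dN (y : R) : -2 < y < 2 -> is_derive y (1 : R) (fun y => - G k y) (- G1 k y).
  by move=> y2; exact: is_deriveN (dG k y2).
have dN1 (y : R) : -2 < y < 2 ->
    is_derive y (1 : R) (fun y => - G1 k y) (- (q y + q (- y) + 2 * k)).
  by move=> y2; exact: is_deriveN (dG1 k y2).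
have qk y : -2 < y < 2 -> q y <= - k.
  by move=> y2; rewrite /q ler_pdivrMr ?exprn_gt0 ?Jpos// h.
have := second_order_lower dN dN1 _ x2; rewrite G10 oppr0 mul0r addr0 lerN2; apply.
move=> y y2; have ny2 : -2 < - y < 2 by lra.
by have := qk y y2; have := qk _ ny2; lra.
Qed.

End log_derivatives.

(** * Gaussian domination and differentiation under the integral *)

Section gaussian_domination.
Context {R : realType}.
Local Notation mu := (@lebesgue_measure R).

Lemma integrable_gauss (a : R) : 0 < a ->
  mu.-integrable [set: R] (EFin \o (fun t => expR (- (a * t ^+ 2)))).
Proof.
move=> a0; have s0 : 0 < Num.sqrt a by rewrite sqrtr_gt0.
have mg : measurable_fun [set: R] (fun t : R => (gauss_fun t)%:E).
  by apply/measurable_EFinP; exact: measurable_gauss_fun.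
have m : measurable_fun [set: R] (fun t : R => expR (- (a * t ^+ 2))).
  apply: measurableT_comp; first exact: measurable_expR.
  apply: measurableT_comp; first exact: oppr_measurable.
  by apply: measurable_funM => //; exact: measurable_funX.
apply/integrableP; split; first exact/measurable_EFinP.
under eq_integral do rewrite /= ger0_norm ?expR_ge0//.
have e := @ge0_integral_affine R (Num.sqrt a) 0 _ s0 mg (fun t => ltac:(by rewrite lee_fin gauss_fun_ge0)).
have : (\int[mu]_t (gauss_fun t)%:E < +oo)%E by rewrite integralT_gauss ltry.
rewrite e.
have -> : (\int[mu]_t (gauss_fun (Num.sqrt a * t + 0))%:E =
           \int[mu]_t (expR (- (a * t ^+ 2)))%:E)%E.
  apply: eq_integral.
  by move=> t _; rewrite /gauss_fun addr0 exprMn sqr_sqrtr// ltW.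
set I := integral _ _ _; have : (0 <= I)%E.
  by apply: integral_ge0 => t _; rewrite lee_fin expR_ge0.
case: I => [r| |]; rewrite ?ltry// => _.
by rewrite gt0_muley ?lte_fin.
Qed.

Lemma integrable_scaled_gauss (C a : R) : 0 < a ->
  mu.-integrable [set: R] (EFin \o (fun t => C * expR (- (a * t ^+ 2)))).
Proof. by move=> a0; have := integrableZl measurableT C (integrable_gauss a0). Qed.

(** The polynomial factor is absorbed by halving the exponent. *)
Lemma le_gauss (a t : R) : 0 < a ->
  (1 + t ^+ 2) * expR (- (a * t ^+ 2)) <= (1 + 2 / a) * expR (- (a / 2 * t ^+ 2)).
Proof.
move=> a0; have -> : - (a * t ^+ 2) = - (a / 2 * t ^+ 2) - a / 2 * t ^+ 2 by lra.
rewrite expRD [X in _ * X]mulrC mulrA ler_pM2r ?expR_gt0//.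
rewrite expRN ler_pdivrMr ?expR_gt0//.
have h := expR_ge1Dx (a / 2 * t ^+ 2).
have q : 0 <= t ^+ 2 by exact: sqr_ge0.
have ai : 0 < a^-1 by rewrite invr_gt0.
have aa : a * a^-1 = 1 by rewrite divff// gt_eqF.
apply: le_trans (_ : (1 + 2 / a) * (1 + a / 2 * t ^+ 2) <= _); last first.
  by rewrite ler_wpM2l//; nra.
nra.
Qed.

Lemma integrable_dominated (F G : R -> R) : continuous F ->
  mu.-integrable [set: R] (EFin \o G) -> (forall t, `|F t| <= G t) ->
  mu.-integrable [set: R] (EFin \o F).
Proof.
move=> cF iG FG; apply: (le_integrable _ _ _ iG) => //.
  by apply/measurable_EFinP; exact: continuous_measurable_fun.
by move=> t _; rewrite /= lee_fin (le_trans (FG t))// ler_norm.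
Qed.

Lemma is_derive_under_integral (F F' : R -> R -> R) (G : R -> R) (u v a : R) :
  u < a < v ->
  (forall x, u < x < v -> mu.-integrable [set: R] (EFin \o F x)) ->
  (forall x t, u < x < v -> is_derive x 1 (F^~ t) (F' x t)) ->
  (forall t, 0 <= G t) -> mu.-integrable [set: R] (EFin \o G) ->
  (forall x t, u < x < v -> `|F' x t| <= G t) ->
  is_derive a 1 (fun x => (\int[mu]_t F x t)%R) (\int[mu]_t F' a t)%R.
Proof.
move=> auv intF dF G0 intG F'G.
have Ia : `]u, v[%classic a by rewrite /= in_itv.
have p1 x t : u < x < v -> partial1of2 F x t = F' x t.
  by move=> xuv; rewrite partial1of2E; have [_ ->] := dF x t xuv.
have i1 (x : R) : `]u, v[%classic x -> mu.-integrable setT (EFin \o F x).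
  by rewrite /= in_itv/=; exact: intF.
have d1 (x : R) (t : R) : `]u, v[%classic x -> [set: R] t -> derivable (F^~ t) x 1.
  by rewrite /= in_itv/= => xuv _; have [] := dF x t xuv.
have b1 (x : R) (t : R) : `]u, v[%classic x -> [set: R] t -> `|partial1of2 F x t| <= G t.
  by rewrite /= in_itv/= => xuv _; rewrite p1//; exact: F'G.
have dd := derivable_under_integral measurableT Ia i1 d1 G0 intG b1.
have := differentiation_under_integral measurableT Ia i1 d1 G0 intG b1.
rewrite derive1E => e; apply: DeriveDef => //.
rewrite e; apply: eq_Rintegral => t _.
by have := p1 a t auv; rewrite /partial1of2 derive1E.
Qed.

End gaussian_domination.

(** * The integral over one spin and its derivatives *)

(** V1 and V2 stand for the first two derivatives of V. The growth conditions are those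
that make all integrals over one spin converge. *)
Definition c2_potential {R : realType} (V V1 V2 : R -> R) (lam b K : R) :=
  [/\ 0 < lam,
      forall x, is_derive x (1 : R) V (V1 x),
      forall x, is_derive x (1 : R) V1 (V2 x) /\ {for x, continuous V2},
      forall x, lam * x ^+ 2 - b <= V x
    & forall x, `|V1 x| <= K * (1 + `|x|) /\ `|V2 x| <= K].

Section single_site.
Context {R : realType} {I : finType}.
Variables (V V1 V2 : R -> R) (lam b K : R).
Hypothesis hV : c2_potential V V1 V2 lam b K.
Variables (i0 : I) (m dl : I -> R).
Local Notation mu := (@lebesgue_measure R).

(** The neighbouring spins move along the line m + x dl; x is the parameter in which
log-concavity is studied. *)
Definition site_arg (x t : R) (i : I) : R := t - m i - x * dl i.
Definition site_energy x t := \sum_i V (site_arg x t i).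
Definition site_weight x t := expR (- site_energy x t).
Definition site_force x t := \sum_i dl i * V1 (site_arg x t i).
Definition site_stiff x t := \sum_i dl i ^+ 2 * V2 (site_arg x t i).

(** A Gaussian bound, uniform in the parameter, for every integrand that occurs in the
first two derivatives of the single-spin integral. *)
Lemma site_dominated : exists2 C : R, 0 <= C & forall x t, -2 < x < 2 ->
  (1 + site_force x t ^+ 2 + `|site_stiff x t|) * site_weight x t <=
    C * expR (- (lam / 4 * t ^+ 2)).
Proof.
have [lam0 dV dV1 Vlow Vup] := hV.
(* a bound on all the points m i + x * dl i with |x| < 2 *)
pose M := \sum_i (`|m i| + 2 * `|dl i|).
have M0 : 0 <= M by apply: sumr_ge0 => i _; rewrite addr_ge0// mulr_ge0.
have Mi i x : -2 < x < 2 -> `|m i + x * dl i| <= M.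
  move=> x2; rewrite /M (bigD1 i)//= ler_wpDr//.
    by apply: sumr_ge0 => j _; rewrite addr_ge0// mulr_ge0.
  apply: le_trans (ler_normD _ _) _; rewrite lerD2l normrM ler_wpM2r//.
  by rewrite ler_norml; case/andP: x2 => *; apply/andP; split; apply: ltW.
pose N : R := #|I|%:R.
have N1 : 1 <= N by rewrite ler1n; apply/card_gt0P; exists i0.
have K0 : 0 <= K by have [_] := Vup 0; apply: le_trans.
have Slow x t : -2 < x < 2 -> lam / 2 * t ^+ 2 - N * (lam * M ^+ 2 + `|b|) <= site_energy x t.
  move=> x2.
  apply: le_trans (_ : \sum_(i : I) (lam / 2 * t ^+ 2 - (lam * M ^+ 2 + `|b|)) <= _).
    rewrite sumr_const -[X in _ <= X]mulr_natl -/N.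
    have : 0 <= (N - 1) * (lam * t ^+ 2) by apply: mulr_ge0; [rewrite subr_ge0|rewrite mulr_ge0 ?sqr_ge0 ?(ltW lam0)].
    nra.
  apply: ler_sum => i _; apply: le_trans (Vlow _); rewrite /site_arg.
  have := Mi i x x2; rewrite ler_norml => /andP[a1 a2].
  have -> : t - m i - x * dl i = t - (m i + x * dl i) by lra.
  move: (m i + x * dl i) a1 a2 => c a1 a2.
  have cM : c ^+ 2 <= M ^+ 2 by nra.
  have q : t ^+ 2 / 2 - c ^+ 2 <= (t - c) ^+ 2.
    by have := sqr_ge0 (t - 2 * c); nra.
  have := ler_norm b; nra.
pose D := \sum_i `|dl i|.
have D0 : 0 <= D by apply: sumr_ge0.
have flow x t : -2 < x < 2 -> `|site_force x t| <= D * K * (1 + M + `|t|).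
  move=> x2; apply: le_trans (ler_norm_sum _ _ _) _.
  rewrite /D -mulrA mulr_suml; apply: ler_sum => i _.
  rewrite normrM ler_wpM2l//; apply: le_trans (proj1 (Vup _)) _.
  rewrite ler_wpM2l// -addrA lerD2l /site_arg.
  have -> : t - m i - x * dl i = t - (m i + x * dl i) by lra.
  by have := Mi i x x2; have := ler_normB t (m i + x * dl i); lra.
pose E := \sum_i dl i ^+ 2 * K.
have E0 : 0 <= E by apply: sumr_ge0 => i _; rewrite mulr_ge0// sqr_ge0.
have elow x t : `|site_stiff x t| <= E.
  apply: le_trans (ler_norm_sum _ _ _) _; apply: ler_sum => i _.
  by rewrite normrM ger0_norm ?sqr_ge0// ler_wpM2l ?sqr_ge0// (proj2 (Vup _)).
pose F := 2 * (D * K) ^+ 2 * (1 + M) ^+ 2.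
have F0 : 0 <= F by apply: mulr_ge0; [apply: mulr_ge0|]; rewrite ?sqr_ge0.
exists ((1 + F + E) * expR (N * (lam * M ^+ 2 + `|b|)) * (1 + 2 / (lam / 2))).
  apply: mulr_ge0; first by apply: mulr_ge0; rewrite ?expR_ge0// !addr_ge0.
  by rewrite addr_ge0// divr_ge0// divr_ge0// ltW.
move=> x t x2.
apply: le_trans (_ : (1 + F + E) * (1 + t ^+ 2) *
   (expR (N * (lam * M ^+ 2 + `|b|)) * expR (- (lam / 2 * t ^+ 2))) <= _).
  apply: ler_pM; [|exact: expR_ge0| |].
  - by rewrite !addr_ge0// sqr_ge0.
  - have f2 : site_force x t ^+ 2 <= F * (1 + t ^+ 2).
      apply: le_trans (_ : (D * K * (1 + M + `|t|)) ^+ 2 <= _).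
        by rewrite -[X in X <= _]real_normK ?num_real// lerXn2r ?nnegrE ?flow// !mulr_ge0// !addr_ge0.
      have -> : F * (1 + t ^+ 2) = (D * K) ^+ 2 * (2 * ((1 + M) ^+ 2 * (1 + t ^+ 2))).
        by rewrite /F; ring.
      rewrite exprMn; apply: ler_wpM2l; first exact: sqr_ge0.
      rewrite -(real_normK (num_real t)); move: (normr_ge0 t).
      have : 1 <= 1 + M by lra.
      move: (1 + M) `|t| => a s a1 s0.
      have : 0 <= (a ^+ 2 - 1) * s ^+ 2.
        by apply: mulr_ge0; [nra|exact: sqr_ge0].
      have := sqr_ge0 (a - s); lra.
    have := elow x t; have := sqr_ge0 t; nra.
  - by rewrite -expRD ler_expR; have := Slow x t x2; lra.
have := @le_gauss R (lam / 2) t; rewrite divr_gt0// => /(_ isT) g.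
have -> : lam / 4 = lam / 2 / 2 by lra.
rewrite -[X in _ <= X]mulrA -[X in X <= _]mulrA.
rewrite [X in _ * X <= _]mulrCA -[X in _ <= X]mulrA ler_wpM2l ?addr_ge0//.
by rewrite ler_wpM2l ?expR_ge0.
Qed.

Lemma continuous_site_comp (f : R -> R) x : continuous f -> forall i,
  continuous (fun t => f (site_arg x t i)).
Proof.
move=> cf i t; apply: (@continuous_comp _ _ _ (fun t => site_arg x t i) f).
  by do 2![apply: continuousB; last exact: cst_continuous].
exact: cf.
Qed.

Lemma continuous_bigsum (r : seq I) (F : I -> R -> R) :
  (forall i, continuous (F i)) -> continuous (fun t => \sum_(i <- r) F i t).
Proof.
move=> cF; elim: r => [|i r IH].
  by under eq_fun do rewrite big_nil; exact: cst_continuous.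
under eq_fun do rewrite big_cons.
by move=> t; apply: continuousD; [exact: cF|exact: IH].
Qed.

Lemma continuous_site_weight x : continuous (site_weight x).
Proof.
have [_ dV _ _ _] := hV.
move=> t; apply: (@continuous_comp _ _ _ (fun t => - site_energy x t) expR).
  apply: continuousN; apply: continuous_bigsum => i.
  exact/continuous_site_comp/is_derive_continuous.
exact: continuous_expR.
Qed.

Lemma continuous_site_force x : continuous (site_force x).
Proof.
have [_ _ dV1 _ _] := hV.
apply: (@continuous_bigsum _ (fun i t => dl i * V1 (site_arg x t i))) => i t.
apply: cvgM; first exact: cvg_cst.
apply: continuous_site_comp; apply: is_derive_continuous => y.
exact: (proj1 (dV1 y)).
Qed.

Lemma continuous_site_stiff x : continuous (site_stiff x).
Proof.
have [_ _ dV1 _ _] := hV.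
apply: (@continuous_bigsum _ (fun i t => dl i ^+ 2 * V2 (site_arg x t i))) => i t.
apply: cvgM; first exact: cvg_cst.
by apply: continuous_site_comp => y; exact: (proj2 (dV1 y)).
Qed.

Lemma site_integrable (F : R -> R) x (c : R) : -2 < x < 2 -> 0 <= c -> continuous F ->
  (forall t, `|F t| <= c * (1 + site_force x t ^+ 2 + `|site_stiff x t|)) ->
  mu.-integrable [set: R] (EFin \o (fun t => F t * site_weight x t)).
Proof.
move=> x2 c0 cF Fle; have [C C0 dom] := site_dominated.
have lam0 : 0 < lam by case: hV.
apply: (@integrable_dominated _ _ (fun t => c * C * expR (- (lam / 4 * t ^+ 2)))).
- by move=> t; apply: cvgM; [exact: cF|exact: continuous_site_weight].
- by apply: integrable_scaled_gauss; rewrite divr_gt0.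
move=> t; rewrite normrM [X in _ * X]ger0_norm ?expR_ge0//.
apply: le_trans (_ : c * (1 + site_force x t ^+ 2 + `|site_stiff x t|) * site_weight x t <= _).
  by rewrite ler_wpM2r ?expR_ge0.
by rewrite -[X in X <= _]mulrA -[X in _ <= X]mulrA ler_wpM2l//; exact: dom.
Qed.

Definition site_J x := (\int[mu]_t site_weight x t)%R.
Definition site_J1 x := (\int[mu]_t (site_force x t * site_weight x t))%R.
(** With [site_J1], the candidate derivatives of [site_J], so that J2 / J - (J1 / J)^2,
the second derivative of ln J, is the variance of the force minus the mean stiffness. *)
Definition site_J2 x :=
  (\int[mu]_t ((site_force x t ^+ 2 - site_stiff x t) * site_weight x t))%R.

Lemma integrable_site_weight x : -2 < x < 2 ->
  mu.-integrable [set: R] (EFin \o site_weight x).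
Proof.
move=> x2; have := @site_integrable (fun=> 1) x 1 x2 ler01.
under [X in _ -> _ -> mu.-integrable _ X]eq_fun do rewrite /= mul1r.
apply; first exact: cst_continuous.
by move=> t; rewrite normr1 mul1r -addrA lerDl addr_ge0// sqr_ge0.
Qed.

Lemma integrable_site_force x : -2 < x < 2 ->
  mu.-integrable [set: R] (EFin \o (fun t => site_force x t * site_weight x t)).
Proof.
move=> x2; apply: (@site_integrable _ x 1) => //; first exact: continuous_site_force.
move=> t; rewrite mul1r ler_wpDr// -(real_normK (num_real (site_force x t))).
by have := sqr_ge0 (`|site_force x t| - 1); have := normr_ge0 (site_force x t); nra.
Qed.

Lemma integrable_site_force2 x : -2 < x < 2 ->
  mu.-integrable [set: R] (EFin \o (fun t => site_force x t ^+ 2 * site_weight x t)).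
Proof.
move=> x2; apply: (@site_integrable _ x 1) => //.
  move=> t; apply: (@continuous_comp _ _ _ (site_force x) (fun y => y ^+ 2)).
    exact: continuous_site_force.
  exact: exprn_continuous.
by move=> t; rewrite mul1r ger0_norm ?sqr_ge0// ler_wpDr// lerDr.
Qed.

Lemma integrable_site_stiff x : -2 < x < 2 ->
  mu.-integrable [set: R] (EFin \o (fun t => site_stiff x t * site_weight x t)).
Proof.
move=> x2; apply: (@site_integrable _ x 1) => //; first exact: continuous_site_stiff.
by move=> t; rewrite mul1r lerDr addr_ge0// sqr_ge0.
Qed.

Lemma site_J_gt0 x : -2 < x < 2 -> 0 < site_J x.
Proof.
move=> x2; rewrite lt_neqAle; apply/andP; split; last first.
  by apply: Rintegral_ge0 => t _; exact: expR_ge0.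
apply/eqP => J0.
have iw := integrable_site_weight x2.
have I0 : (\int[mu]_t `|(site_weight x t)%:E| = 0)%E.
  under eq_integral do rewrite gee0_abs ?lee_fin ?expR_ge0//.
  by rewrite -(fineK (integrable_fin_num measurableT iw)); congr EFin.
have mw : measurable_fun [set: R] (fun t => (site_weight x t)%:E).
  apply/measurable_EFinP; apply: continuous_measurable_fun.
  exact: continuous_site_weight.
have /(ae_eq_integral_abs mu measurableT mw)[N [mN N0 sub]] := I0.
have : mu [set: R] = 0%E.
  apply/eqP; rewrite eq_le measure_ge0 andbT -N0.
  apply: le_measure; rewrite ?inE//.
  move=> t _; apply: sub => /= h.
  by have /eqP := h Logic.I; rewrite gt_eqF // lte_fin expR_gt0.
have -> : [set: R] = `]-oo, +oo[%classic by rewrite set_itvNyy.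
by rewrite lebesgue_measure_itv.
Qed.

Lemma is_derive_site_arg x t i :
  is_derive x (1 : R) (fun x => site_arg x t i) (- dl i).
Proof.
have -> : (fun x => site_arg x t i) = (fun y => - dl i * y + (t - m i)).
  by apply/funext => y; rewrite /site_arg; ring.
exact: is_derive_affine.
Qed.

Lemma is_derive_site_weight x t :
  is_derive x (1 : R) (site_weight^~ t) (site_force x t * site_weight x t).
Proof.
have [_ dV _ _ _] := hV.
have dS : is_derive x (1 : R) (site_energy^~ t) (- site_force x t).
  apply: (is_derive_eq (is_derive_bigsum _ (fun i => is_derive_comp1 (dV _)
     (is_derive_site_arg x t i)))).
  by rewrite -sumrN; apply: eq_bigr => i _; rewrite mulrN mulrC.
apply: (is_derive_eq (is_derive_comp1 (is_derive_expR _) (is_deriveN dS))).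
by rewrite opprK mulrC.
Qed.

Lemma is_derive_site_force x t :
  is_derive x (1 : R) (site_force^~ t) (- site_stiff x t).
Proof.
have [_ _ dV1 _ _] := hV.
apply: (is_derive_eq (is_derive_bigsum _ (fun i =>
   is_derive_mul (is_derive_cst (dl i) x 1)
     (is_derive_comp1 (proj1 (dV1 _)) (is_derive_site_arg x t i))))).
by rewrite -sumrN; apply: eq_bigr => i _; rewrite mul0r add0r /cst/= ; ring.
Qed.

Lemma is_derive_site_J (x : R) : -2 < x < 2 -> is_derive x (1 : R) site_J (site_J1 x).
Proof.
move=> x2; have [C C0 dom] := site_dominated.
have lam0 : 0 < lam by case: hV.
apply: (@is_derive_under_integral _ site_weight
   (fun x t => site_force x t * site_weight x t)
   (fun t => C * expR (- (lam / 4 * t ^+ 2))) (-2) 2) => //.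
- exact: integrable_site_weight.
- by move=> y t _; exact: is_derive_site_weight.
- by move=> t; rewrite mulr_ge0// expR_ge0.
- by apply: integrable_scaled_gauss; rewrite divr_gt0.
move=> y t y2; apply: le_trans (dom y t y2).
rewrite normrM [X in _ * X]ger0_norm ?expR_ge0// ler_wpM2r ?expR_ge0//.
rewrite ler_wpDr// -(real_normK (num_real (site_force y t))).
by have := sqr_ge0 (`|site_force y t| - 1); have := normr_ge0 (site_force y t); nra.
Qed.

Lemma is_derive_site_J1 (x : R) : -2 < x < 2 -> is_derive x (1 : R) site_J1 (site_J2 x).
Proof.
move=> x2; have [C C0 dom] := site_dominated.
have lam0 : 0 < lam by case: hV.
apply: (@is_derive_under_integral _ (fun x t => site_force x t * site_weight x t)
   (fun x t => (site_force x t ^+ 2 - site_stiff x t) * site_weight x t)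
   (fun t => C * expR (- (lam / 4 * t ^+ 2))) (-2) 2) => //.
- exact: integrable_site_force.
- move=> y t _; apply: (is_derive_eq (is_derive_mul (is_derive_site_force y t)
    (is_derive_site_weight y t))); ring.
- by move=> t; rewrite mulr_ge0// expR_ge0.
- by apply: integrable_scaled_gauss; rewrite divr_gt0.
move=> y t y2; apply: le_trans (dom y t y2).
rewrite normrM [X in _ * X]ger0_norm ?expR_ge0// ler_wpM2r ?expR_ge0//.
apply: le_trans (ler_normB _ _) _; rewrite lerD2r ger0_norm ?sqr_ge0//.
by rewrite lerDr.
Qed.

Lemma site_J2E x : -2 < x < 2 ->
  site_J2 x = (\int[mu]_t (site_force x t ^+ 2 * site_weight x t))%R -
              (\int[mu]_t (site_stiff x t * site_weight x t))%R.
Proof.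
move=> x2; rewrite -RintegralB//; last 2 first.
- exact: integrable_site_force2.
- exact: integrable_site_stiff.
by apply: eq_Rintegral => t _; rewrite mulrBl.
Qed.

End single_site.

(** * Uniformly convex potentials *)

Section has_integral.
Context {R : realType}.
Local Notation mu := (@lebesgue_measure R).

(** Integrability and value in one predicate, so that linear combinations of integrals
are computed as values rather than rewritten. *)
Definition has_integral (F : R -> R) (v : R) :=
  mu.-integrable [set: R] (EFin \o F) /\ (\int[mu]_t F t)%R = v.

Lemma has_integralD F G u v : has_integral F u -> has_integral G v ->
  has_integral (fun t => F t + G t) (u + v).
Proof.
move=> [iF <-] [iG <-]; split; first exact: (integrableD measurableT iF iG).
by rewrite RintegralD.
Qed.

Lemma has_integralZ F c u : has_integral F u -> has_integral (fun t => c * F t) (c * u).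
Proof.
move=> [iF <-]; split; first exact: (integrableZl measurableT c iF).
by rewrite RintegralZl.
Qed.

Lemma has_integral_sum (I : Type) (r : seq I) (F : I -> R -> R) (v : I -> R) :
  (forall i, has_integral (F i) (v i)) ->
  has_integral (fun t => \sum_(i <- r) F i t) (\sum_(i <- r) v i).
Proof.
move=> h; elim: r => [|i r IH].
  under [X in has_integral X]eq_fun do rewrite big_nil.
  rewrite big_nil; split; first exact: integrable0.
  by rewrite /Rintegral integral0.
under [X in has_integral X]eq_fun do rewrite big_cons.
by rewrite big_cons; exact: has_integralD.
Qed.

Lemma has_integral_le F G u v : has_integral F u -> has_integral G v ->
  (forall t, F t <= G t) -> u <= v.
Proof. by move=> [iF <-] [iG <-] FG; apply: le_Rintegral. Qed.

Lemma has_integralE F u : has_integral F u -> (\int[mu]_t (F t)%:E = u%:E)%E.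
Proof. by move=> [iF <-]; rewrite fineK//; exact: integrable_fin_num. Qed.

Lemma has_integral_shift (F : R -> R) (u c : R) : continuous F -> (forall t, 0 <= F t) ->
  has_integral F u -> has_integral (fun t => F (t - c)) u.
Proof.
move=> cF F0 /has_integralE eF.
have mF : measurable_fun [set: R] (fun t => (F t)%:E).
  by apply/measurable_EFinP; exact: continuous_measurable_fun.
have e : (\int[mu]_t (F (t - c))%:E = u%:E)%E.
  rewrite -eF (@ge0_integral_affine R 1 (- c) _ ltr01 mF) ?mul1e//.
    by apply: eq_integral => t _; rewrite mul1r.
have mF' : measurable_fun [set: R] (fun t => (F (t - c))%:E).
  apply/measurable_EFinP; apply: continuous_measurable_fun => t.
  apply: (@continuous_comp _ _ _ (fun t => t - c) F); last exact: cF.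
  by apply: continuousB; [exact: cvg_id|exact: cst_continuous].
split; last by rewrite /Rintegral e.
apply/integrableP; split=> //.
by under eq_integral do rewrite /= ger0_norm//; rewrite e ltry.
Qed.

End has_integral.

Section log_derivatives.
Context {R : realType} {I : finType}.
Variables (V V1 V2 : R -> R) (lam b K : R).
Hypothesis hV : c2_potential V V1 V2 lam b K.
Variables (i0 : I) (m dl : I -> R).
Local Notation mu := (@lebesgue_measure R).
Local Notation J := (site_J V m dl).
Local Notation J1 := (site_J1 V V1 m dl).
Local Notation J2 := (site_J2 V V1 V2 m dl).

Hypothesis dl0 : \sum_i dl i = 0.
Local Notation D := (\sum_i dl i ^+ 2).

(** V is strongly convex along pairs of points, and so is the energy; since dl has zero
sum, the gap in strong convexity is at least that of equal spins, whatever the two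
values s and t of the integrated spin. Prekopa-Leindler integrates this over s and t. *)
Lemma site_J_pair (c x : R) : (forall y, c <= V2 y) -> 0 <= c -> -2 < x < 2 ->
  J x * J (- x) <= expR (- (c * x ^+ 2 * D)) * J 0 ^+ 2.
Proof.
move=> V2c c0 x2; have [lam0 dV dV1 _ _] := hV.
have nx2 : -2 < - x < 2 by lra.
have z2 : -2 < (0 : R) < 2 by lra.
have conv u v : V u + V v - 2 * V ((u + v) / 2) >= c / 4 * (u - v) ^+ 2.
  pose mi := (u + v) / 2; pose s := (u - v) / 2.
  pose f y := V (1 * y + mi) + V (-1 * y + mi) + (- c) * (y * y).
  pose f1 y := V1 (1 * y + mi) - V1 (-1 * y + mi) + (- c * 2) * y.
  pose f2 y := V2 (1 * y + mi) + V2 (-1 * y + mi) + (- c) * 2.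
  have d1 y : is_derive y (1 : R) f (f1 y).
    apply: (is_derive_eq (is_derive_add (is_derive_add
      (is_derive_comp1 (dV _) (is_derive_affine 1 mi y))
      (is_derive_comp1 (dV _) (is_derive_affine (-1) mi y)))
      (is_derive_mul (is_derive_cst (- c) y 1)
        (is_derive_mul (is_derive_id y 1) (is_derive_id y 1))))).
    by rewrite /f1 /cst; ring.
  have d2 y : is_derive y (1 : R) f1 (f2 y).
    apply: (is_derive_eq (is_derive_add (is_derive_sub
      (is_derive_comp1 (proj1 (dV1 _)) (is_derive_affine 1 mi y))
      (is_derive_comp1 (proj1 (dV1 _)) (is_derive_affine (-1) mi y)))
      (is_derive_mul (is_derive_cst (- c * 2) y 1) (is_derive_id y 1)))).
    by rewrite /f2 /cst; ring.
  have f20 y : 0 <= f2 y.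
    by rewrite /f2; have := V2c (1 * y + mi); have := V2c (-1 * y + mi); lra.
  have := @second_order_lower R f f1 f2 (`|s| + 1) s (fun y _ => d1 y) (fun y _ => d2 y)
    (fun y _ => f20 y).
  have -> : - (`|s| + 1) < s < `|s| + 1.
    by have := ler_norm s; have := ler_norm (- s); rewrite normrN; lra.
  move=> /(_ isT); rewrite /f /f1 !(mulr0, add0r, addr0, subrr, mul0r).
  have -> : 1 * s + mi = u by rewrite /s /mi; lra.
  have -> : -1 * s + mi = v by rewrite /s /mi; lra.
  rewrite -/mi; have -> : s * s = (u - v) ^+ 2 / 4 by rewrite /s; field.
  lra.
have Sconv s t : site_energy V m dl x s + site_energy V m dl (- x) t >=
    2 * site_energy V m dl 0 ((s + t) / 2) + c * x ^+ 2 * D.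
  have : \sum_i (2 * V (site_arg m dl 0 ((s + t) / 2) i)
      + c / 4 * ((s - t) - 2 * x * dl i) ^+ 2) <=
     site_energy V m dl x s + site_energy V m dl (- x) t.
    rewrite /site_energy -big_split/=; apply: ler_sum => i _.
    have := conv (site_arg m dl x s i) (site_arg m dl (- x) t i).
    rewrite /site_arg.
    have -> : (s - m i - x * dl i + (t - m i - - x * dl i)) / 2 = (s + t) / 2 - m i - 0 * dl i by lra.
    have -> : (s - m i - x * dl i - (t - m i - - x * dl i)) = s - t - 2 * x * dl i by lra.
    lra.
  apply: le_trans; rewrite big_split/= -mulr_sumr lerD2l -mulr_sumr.
  have -> : \sum_i (s - t - 2 * x * dl i) ^+ 2 =
     \sum_(i : I) (s - t) ^+ 2 + 4 * x ^+ 2 * D.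
    transitivity (\sum_i ((s - t) ^+ 2 + (4 * x ^+ 2 * dl i ^+ 2 + (- 4 * (s - t) * x) * dl i))).
      by apply: eq_bigr => i _; ring.
    by rewrite big_split/= big_split/= -!mulr_sumr dl0 mulr0 addr0.
  have : 0 <= \sum_(i : I) (s - t) ^+ 2 by apply: sumr_ge0 => i _; exact: sqr_ge0.
  have := c0; nra.
have iJ y : -2 < y < 2 -> has_integral (site_weight V m dl y) (J y).
  move=> y2; split; [exact: (integrable_site_weight hV i0 m dl y2)|by []].
have mw y : measurable_fun [set: R] (fun t => (site_weight V m dl y t)%:E).
  apply/measurable_EFinP; apply: continuous_measurable_fun.
  exact: (continuous_site_weight hV).
pose e := expR (- (c * x ^+ 2 * D / 2)).
have := @prekopa_leindler R (fun t => (site_weight V m dl x t)%:E)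
  (fun t => (site_weight V m dl (- x) t)%:E)
  (fun t => (e * site_weight V m dl 0 t)%:E).
rewrite (has_integralE (iJ x x2)) (has_integralE (iJ _ nx2)).
rewrite (has_integralE (has_integralZ e (iJ 0 z2))).
move=> /(_ (mw _) (mw _)).
have mM : measurable_fun [set: R] (fun t => (e * site_weight V m dl 0 t)%:E).
  by have /measurable_EFinP m0 := mw 0; apply/measurable_EFinP; apply: measurable_funM.
move=> /(_ mM) H.
have : J x * J (- x) <= e * J 0 * (e * J 0).
  rewrite -lee_fin !EFinM; apply: H => [t|t|t|s t].
  - by rewrite lee_fin expR_ge0.
  - by rewrite lee_fin expR_ge0.
  - by rewrite lee_fin mulr_ge0 ?expR_ge0.
  rewrite -!EFinM lee_fin /e /site_weight -!expRD ler_expR.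
  by have := Sconv s t; lra.
have -> // : e * J 0 * (e * J 0) = expR (- (c * x ^+ 2 * D)) * J 0 ^+ 2.
transitivity ((e * e) * J 0 ^+ 2); first by ring.
by rewrite /e -expRD; congr (expR _ * _); lra.
Qed.

(** This is a Brascamp-Lieb inequality for the variance of the force. *)
Lemma site_variance_convex (c : R) : (forall y, c <= V2 y) -> 0 <= c ->
  J2 0 * J 0 - J1 0 ^+ 2 <= - (c * D) * J 0 ^+ 2.
Proof.
move=> V2c c0.
apply: (log_concave_of_pair (fun x x2 => site_J_gt0 hV i0 m dl x2)
  (fun x x2 => is_derive_site_J hV i0 m dl x2)
  (fun x x2 => is_derive_site_J1 hV i0 m dl x2)) => x x2.
have -> : - (c * D * x ^+ 2) = - (c * x ^+ 2 * D) by rewrite mulrAC.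
exact: site_J_pair.
Qed.

End log_derivatives.

(** * Perturbation of a uniformly convex potential *)

Lemma cauchy_schwarz_sum (R : realType) (I : Type) (r : seq I) (a b : I -> R) :
  (\sum_(i <- r) a i * b i) ^+ 2 <=
    (\sum_(i <- r) a i ^+ 2) * (\sum_(i <- r) b i ^+ 2).
Proof.
elim: r => [|i r IH]; first by rewrite !big_nil expr0n mul0r.
rewrite !big_cons; move: IH.
have : 0 <= \sum_(j <- r) a j ^+ 2 by apply: sumr_ge0 => j _; exact: sqr_ge0.
have : 0 <= \sum_(j <- r) b j ^+ 2 by apply: sumr_ge0 => j _; exact: sqr_ge0.
move: (\sum_(j <- r) a j ^+ 2) (\sum_(j <- r) b j ^+ 2) (\sum_(j <- r) a j * b j) => A B S.
move: (a i) (b i) => x y B0 A0 SAB.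
suff : 0 <= A * y ^+ 2 + B * x ^+ 2 - 2 * (S * (x * y)) by nra.
have [A1|A1|A1] := ltgtP A 0; first by lra.
  have : 0 <= A * (A * y ^+ 2 + B * x ^+ 2 - 2 * (S * (x * y))).
    have -> : A * (A * y ^+ 2 + B * x ^+ 2 - 2 * (S * (x * y))) =
      (A * y - S * x) ^+ 2 + (A * B - S ^+ 2) * x ^+ 2 by ring.
    by rewrite addr_ge0 ?sqr_ge0// mulr_ge0 ?sqr_ge0// subr_ge0.
  by rewrite pmulr_rge0.
have -> : S = 0.
  apply/eqP; rewrite -sqrf_eq0 eq_le sqr_ge0 andbT.
  by apply: le_trans SAB _; rewrite A1 mul0r.
by rewrite A1 !mul0r add0r mulr0 subr0 mulr_ge0// sqr_ge0.
Qed.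

Lemma sum_sqr_le_card (R : realType) (I : finType) (a : I -> R) :
  (\sum_i a i) ^+ 2 <= #|I|%:R * \sum_i a i ^+ 2.
Proof.
have := @cauchy_schwarz_sum R I (index_enum I) (fun=> 1) a.
under eq_bigr do rewrite mul1r.
by under [X in _ <= X * _]eq_bigr do rewrite expr1n; rewrite sumr_const.
Qed.

Lemma has_integral_unit_interval (R : realType) (a c : R) :
  has_integral (fun t => c * \1_(`[a, a + 1]%classic : set R) t) c.
Proof.
rewrite -[X in has_integral _ X]mulr1; apply: has_integralZ.
have e : (\int[@lebesgue_measure R]_t (\1_(`[a, a + 1]%classic : set R) t)%:E = 1%:E)%E.
  have mI : measurable (`[a, a + 1]%classic : set R) by exact: measurable_itv.
  have e : @lebesgue_measure R `[a, a + 1]%classic = 1%:E.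
    by rewrite lebesgue_measure_itv/= lte_fin ltrDl ltr01 -EFinD addrAC subrr add0r.
  by rewrite (integral_indic (@lebesgue_measure R) measurableT mI) setIT.
split; last by rewrite /Rintegral e.
apply/integrableP; split; first by apply/measurable_EFinP; exact: measurable_indic.
by under eq_integral do rewrite /= ger0_norm//; rewrite e ltry.
Qed.

Lemma expR_le_1D2x (R : realType) (x : R) : 0 <= x -> x <= 2^-1 -> expR x <= 1 + 2 * x.
Proof.
move=> x0 x2; have y0 := expR_gt0 x; have := expR_ge1Dx (- x).
have y1 : 1 <= expR x by rewrite -[X in X <= _]expR0 ler_expR.
rewrite expRN => h.
have : expR x * (1 - x) <= 1 by rewrite -ler_pdivlMl// mulr1.
move: (expR x) y1 => y y1 {}h.
have : 0 <= (y - 1) * (2^-1 - x) by rewrite mulr_ge0 ?subr_ge0.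
lra.
Qed.

(** The arithmetic of the perturbation argument. Letters with a final t refer to the
convex potential; mt is its mean force. The second moment of the force about mt
dominates the variance under the perturbed weight, which is why the left side of the
long hypothesis is expanded about mt. *)
Lemma variance_perturbation_algebra (R : realType)
  (F2 E J1 J F2t Et J1t Jt mt q qi Q eps N D C c u : R) :
  0 < Jt -> 0 < J -> mt * Jt = J1t -> 0 <= Et -> Et <= C * D * Jt -> 0 <= D ->
  1 <= N -> 0 < eps -> N * eps <= 2^-1 -> 1 <= q -> q <= 1 + 2 * (N * eps) ->
  1 - N * eps <= qi -> 0 <= Q -> 0 <= c -> 0 <= C -> u <= eps -> J <= q * Jt ->
  eps * ((5 * N + 1) * C + 3 * (2 * N + 1 + Q)) <= c / 2 ->
  (F2t - Et) * Jt - J1t ^+ 2 <= - (c * D) * Jt ^+ 2 ->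
  F2 + - 2 * mt * J1 + mt ^+ 2 * J + - 1 * E <=
    q * (1 + eps) * F2t + q * (1 + eps) * (- 2 * mt) * J1t
    + (q * (1 + eps) * mt ^+ 2 + q * eps * ((2 * N + 1) * D)) * Jt
    + - qi * Et + q * Q * Jt * (D * u) ->
  (F2 - E) * J - J1 ^+ 2 <= - (c / 4 * D) * J ^+ 2.
Proof.
move=> Jt0 J0 <- Et0 EtC D0 N1 e0 Ne q1 q2 qi1 Q0 c0 C0 ue JJt small var LR.
have eps1 : eps <= 1.
  have : 0 <= (N - 1) * eps by apply: mulr_ge0; lra.
  lra.
have DJ : 0 <= D * Jt by rewrite mulr_ge0// ltW.
pose X := F2t - mt * (mt * Jt).
have hX : X - Et <= - (c * (D * Jt)).
  rewrite -(ler_pM2r Jt0); rewrite /X.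
  have -> : (F2t - mt * (mt * Jt) - Et) * Jt = (F2t - Et) * Jt - (mt * Jt) ^+ 2 by ring.
  lra.
have A1 : 1 <= q * (1 + eps).
  have : 0 <= q * eps by apply: mulr_ge0; lra.
  lra.
have Aq : q * (1 + eps) - qi <= eps * (5 * N + 1).
  have : q * (1 + eps) <= (1 + 2 * (N * eps)) * (1 + eps) by rewrite ler_pM2r//; lra.
  have : 0 <= N * eps * (1 - eps).
    by apply: mulr_ge0; [apply: mulr_ge0|]; lra.
  lra.
have s1 : q * (1 + eps) * X <= q * (1 + eps) * (Et - c * (D * Jt)).
  by rewrite ler_wpM2l//; lra.
have s2 : (q * (1 + eps) - qi) * Et <= eps * (5 * N + 1) * (C * D * Jt).
  apply: le_trans (_ : eps * (5 * N + 1) * Et <= _); first by rewrite ler_wpM2r.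
  by rewrite ler_wpM2l// mulr_ge0//; lra.
have s3 : c * (D * Jt) <= q * (1 + eps) * (c * (D * Jt)).
  by rewrite -[X in X <= _]mul1r ler_wpM2r// mulr_ge0.
have s4 : q * (eps * (2 * N + 1 + Q) * (D * Jt)) <= 3 * (eps * (2 * N + 1 + Q) * (D * Jt)).
  rewrite ler_wpM2r//; last by lra.
  by apply: mulr_ge0 => //; apply: mulr_ge0; lra.
have s5 : q * Q * Jt * (D * u) <= q * Q * Jt * (D * eps).
  by rewrite ler_wpM2l ?ler_wpM2l// !mulr_ge0//; lra.
have s6 : eps * ((5 * N + 1) * C + 3 * (2 * N + 1 + Q)) * (D * Jt) <= c / 2 * (D * Jt).
  by rewrite ler_wpM2r.
have key : F2 + - 2 * mt * J1 + mt ^+ 2 * J + - 1 * E <= - (c / 2 * (D * Jt)).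
  apply: le_trans LR _; rewrite /X in s1; lra.
have s7 : J * (F2 + - 2 * mt * J1 + mt ^+ 2 * J + - 1 * E) <= J * (- (c / 2 * (D * Jt))).
  by rewrite ler_wpM2l// ltW.
have s8 : 0 <= (mt * J - J1) ^+ 2 by exact: sqr_ge0.
have s9 : c / 4 * D * (J * J) <= c / 4 * D * (J * (2 * Jt)).
  apply: ler_wpM2l; first by rewrite mulr_ge0// divr_ge0.
  rewrite ler_wpM2l ?(ltW J0)//; apply: le_trans JJt _.
  by rewrite ler_pM2r//; lra.
lra.
Qed.

Section perturbation.
Context {R : realType} {I : finType}.
Variables (V V1 V2 : R -> R) (lam b K : R) (W W1 W2 : R -> R) (lam' b' K' : R).
Hypothesis hV : c2_potential V V1 V2 lam b K.
Hypothesis hW : c2_potential W W1 W2 lam' b' K'.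
Variables (i0 : I) (m dl : I -> R).
Hypothesis dl0 : \sum_i dl i = 0.
Variables (eps c C u : R) (k : R -> R).
Local Notation N := (#|I|%:R : R).
Local Notation Q := (expR (N * C / 2)).
Hypothesis eps0 : 0 < eps.
Hypothesis c0 : 0 < c.
Hypothesis W2cC : forall x, c <= W2 x <= C.
Hypothesis WV : forall x, `|W x - V x| <= eps.
Hypothesis WV1 : forall x, `|W1 x - V1 x| <= eps.
Hypothesis WV2 : forall x, `|W2 x - V2 x| <= eps + k x.
Hypothesis ck : continuous k.
Hypothesis k0 : forall x, 0 <= k x.
Hypothesis ik : has_integral k u.
Hypothesis ueps : u <= eps.
Local Notation mu := (@lebesgue_measure R).
Local Notation D := (\sum_i dl i ^+ 2).

Let D0 : 0 <= D. Proof. by apply: sumr_ge0 => i _; exact: sqr_ge0. Qed.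
Let N1 : 1 <= N. Proof. by rewrite ler1n; apply/card_gt0P; exists i0. Qed.

(** The upper bound on W'' gives a lower bound for the weight at distance at most 1 from t,
on the side where the linear part of the energy decreases; the mass is at least the integral
over that unit interval. *)
Lemma site_weight_le_mass t : site_weight W m dl 0 t <= Q * site_J W m dl 0.
Proof.
have z2 : -2 < (0 : R) < 2 by lra.
have [_ dW dW1 _ _] := hW.
have up y r : W (y + r) <= W y + W1 y * r + C / 2 * r ^+ 2.
  pose f z := C / 2 * (z * z) - W (1 * z + y).
  pose f1 z := C * z - W1 (1 * z + y).
  pose f2 z := C - W2 (1 * z + y).
  have d1 z : is_derive z (1 : R) f (f1 z).
    apply: (is_derive_eq (is_derive_sub
      (is_derive_mul (is_derive_cst (C / 2) z 1)
        (is_derive_mul (is_derive_id z 1) (is_derive_id z 1)))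
      (is_derive_comp1 (dW _) (is_derive_affine 1 y z)))).
    by rewrite /f1 /cst; field.
  have d2 z : is_derive z (1 : R) f1 (f2 z).
    apply: (is_derive_eq (is_derive_sub
      (is_derive_mul (is_derive_cst C z 1) (is_derive_id z 1))
      (is_derive_comp1 (proj1 (dW1 _)) (is_derive_affine 1 y z)))).
    by rewrite /f2 /cst; ring.
  have f20 z : 0 <= f2 z by rewrite /f2 subr_ge0; case/andP: (W2cC (1 * z + y)).
  have := @second_order_lower R f f1 f2 (`|r| + 1) r (fun z _ => d1 z) (fun z _ => d2 z)
    (fun z _ => f20 z).
  have -> : - (`|r| + 1) < r < `|r| + 1.
    by have := ler_norm r; have := ler_norm (- r); rewrite normrN; lra.
  move=> /(_ isT); rewrite /f /f1 !(mulr0, add0r, sub0r) mul1r [r + y]addrC; lra.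
pose s := \sum_i W1 (site_arg m dl 0 t i).
have Sup r : s * r <= 0 -> r ^+ 2 <= 1 ->
    site_weight W m dl 0 t * expR (- (N * C / 2)) <= site_weight W m dl 0 (t + r).
  move=> sr r1; rewrite /site_weight -expRD ler_expR.
  have /andP[cW WC] := W2cC 0.
  have C0 : 0 <= C by apply: le_trans WC; apply: le_trans cW; exact: ltW.
  have : site_energy W m dl 0 (t + r) <= site_energy W m dl 0 t + s * r + N * (C / 2 * r ^+ 2).
    rewrite /site_energy /s mulr_suml mulr_natl -sumr_const -!big_split/=.
    apply: ler_sum => i _; have := up (site_arg m dl 0 t i) r.
    have -> // : site_arg m dl 0 t i + r = site_arg m dl 0 (t + r) i.
    by rewrite /site_arg; ring.
  have : 0 <= (N * C / 2) * (1 - r ^+ 2).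
    by rewrite mulr_ge0 ?subr_ge0// divr_ge0// mulr_ge0.
  move: (site_energy W m dl 0 (t + r)) (site_energy W m dl 0 t) => X Y; lra.
have iw : has_integral (site_weight W m dl 0) (site_J W m dl 0).
  by split; first exact: (integrable_site_weight hW i0 m dl z2).
(* the interval starts or ends at t according to the sign of the total force s *)
have [a ha] : exists a, forall z, a <= z <= a + 1 ->
    site_weight W m dl 0 t * expR (- (N * C / 2)) <= site_weight W m dl 0 z.
  have [s0|s0] := leP s 0.
    exists t => z tz; rewrite -[z](subrKC t); apply: Sup.
      by rewrite mulr_le0_ge0//; lra.
    by nra.
  exists (t - 1) => z tz; rewrite -[z](subrKC t); apply: Sup.
    by rewrite mulr_ge0_le0//; lra.
  by nra.
have wle : site_weight W m dl 0 t * expR (- (N * C / 2)) <= site_J W m dl 0.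
  apply: (has_integral_le (has_integral_unit_interval a _) iw) => z; rewrite indicE.
  have [/set_mem/=|_] := boolP (z \in (`[a, a + 1]%classic : set R)).
    by rewrite in_itv/= mulr1 => az; apply: ha.
  by rewrite mulr0 expR_ge0.
by move: wle; rewrite expRN ler_pdivrMr ?expR_gt0// [X in _ <= X]mulrC.
Qed.

Local Notation q := (expR (N * eps)).
Local Notation w := (site_weight V m dl 0).
Local Notation f := (site_force V1 m dl 0).
Local Notation e := (site_stiff V2 m dl 0).
Local Notation wt := (site_weight W m dl 0).
Local Notation ft := (site_force W1 m dl 0).
Local Notation et := (site_stiff W2 m dl 0).

Lemma site_energy_close t : `|site_energy W m dl 0 t - site_energy V m dl 0 t| <= N * eps.
Proof.
rewrite /site_energy -sumrB; apply: le_trans (ler_norm_sum _ _ _) _.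
by rewrite mulr_natl -sumr_const; apply: ler_sum => i _; exact: WV.
Qed.

Lemma site_weight_le t : w t <= q * wt t.
Proof.
rewrite /site_weight -expRD ler_expR.
by have := site_energy_close t; rewrite ler_norml => /andP[]; lra.
Qed.

Lemma site_weight_ge t : wt t <= q * w t.
Proof.
rewrite /site_weight -expRD ler_expR.
by have := site_energy_close t; rewrite ler_norml => /andP[]; lra.
Qed.

Lemma site_force_close t : (ft t - f t) ^+ 2 <= eps ^+ 2 * (N * D).
Proof.
apply: le_trans (_ : (\sum_i (eps * `|dl i|)) ^+ 2 <= _).
  rewrite -[X in X <= _]real_normK ?num_real// lerXn2r ?nnegrE//.
    by apply: sumr_ge0 => i _; rewrite mulr_ge0// ltW.
  rewrite /site_force -sumrB; apply: le_trans (ler_norm_sum _ _ _) _.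
  apply: ler_sum => i _; rewrite -mulrBr normrM mulrC ler_wpM2r//.
rewrite -mulr_sumr exprMn ler_wpM2l ?sqr_ge0//.
apply: le_trans (sum_sqr_le_card _) _.
by rewrite ler_wpM2l//; apply: ler_sum => i _; rewrite real_normK ?num_real.
Qed.

(** Only this comparison involves the function k, which is small in L^1 but not
pointwise. *)
Lemma site_stiff_close t :
  - e t <= - et t + (eps * D + \sum_i dl i ^+ 2 * k (t - m i)).
Proof.
rewrite mulr_sumr -big_split/= /site_stiff -!sumrN -big_split/=.
apply: ler_sum => i _.
have -> : site_arg m dl 0 t i = t - m i by rewrite /site_arg mul0r subr0.
have := WV2 (t - m i); rewrite ler_norml => /andP[h1 h2].
have : 0 <= dl i ^+ 2 * (V2 (t - m i) - W2 (t - m i) + eps + k (t - m i)).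
  by rewrite mulr_ge0 ?sqr_ge0//; lra.
lra.
Qed.

(** Integrated over t, this compares the second moment of the force minus the mean
stiffness for the two potentials. The term in k is paired with the bounded density of
the spin, so that its integral is small. *)
Lemma site_pointwise (mt t : R) : eps <= 1 -> (forall x, 0 <= W2 x) ->
  ((f t - mt) ^+ 2 - e t) * w t <=
    q * (1 + eps) * ((ft t - mt) ^+ 2 * wt t) + q * eps * ((2 * N + 1) * D) * wt t
    + (- q^-1) * (et t * wt t)
    + q * Q * site_J W m dl 0 * \sum_i dl i ^+ 2 * k (t - m i).
Proof.
move=> eps1 W20; have e0 := eps0.
have q0 : 0 < q by exact: expR_gt0.
have kk0 : 0 <= \sum_i dl i ^+ 2 * k (t - m i).
  by apply: sumr_ge0 => i _; rewrite mulr_ge0 ?sqr_ge0.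
have et0 : 0 <= et t by apply: sumr_ge0 => i _; rewrite mulr_ge0 ?sqr_ge0.
have wle := site_weight_le t; have wge := site_weight_ge t.
have fc := site_force_close t; have sc := site_stiff_close t.
have mass := site_weight_le_mass t.
have w0 : 0 < w t by exact: expR_gt0.
have wt0 : 0 < wt t by exact: expR_gt0.
have Q0 : 0 < Q by exact: expR_gt0.
move: kk0 et0 wle wge fc sc mass w0 wt0 Q0 q0.
move: (\sum_i dl i ^+ 2 * k (t - m i)) (et t) (w t) (wt t) (f t) (ft t) (e t)
  (site_J W m dl 0) q Q => kk Et wv wW fv fW ev Jt qq QQ.
move=> kk0 Et0 wle wge fc sc mass w0 wt0 Q0 q0.
have ff : (fv - mt) ^+ 2 <= (1 + eps) * (fW - mt) ^+ 2 + 2 * (eps * (N * D)).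
  have ND : 0 <= N * D by rewrite mulr_ge0.
  have h1 : 0 <= (eps * (fW - mt) + (fW - fv)) ^+ 2 by exact: sqr_ge0.
  have : 0 <= eps * ((1 + eps) * (fW - mt) ^+ 2 + 2 * (eps * (N * D)) - (fv - mt) ^+ 2).
    have -> : eps * ((1 + eps) * (fW - mt) ^+ 2 + 2 * (eps * (N * D)) - (fv - mt) ^+ 2) =
      (eps * (fW - mt) + (fW - fv)) ^+ 2 + (1 + eps) * (eps ^+ 2 * (N * D) - (fW - fv) ^+ 2)
      + eps ^+ 2 * (1 - eps) * (N * D) by ring.
    apply: addr_ge0; first apply: addr_ge0 => //.
      by apply: mulr_ge0; [lra|rewrite subr_ge0].
    by apply: mulr_ge0 => //; apply: mulr_ge0; [exact: sqr_ge0|rewrite subr_ge0].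
  by rewrite pmulr_rge0// subr_ge0.
have s1 : (fv - mt) ^+ 2 * wv <=
   ((1 + eps) * (fW - mt) ^+ 2 + 2 * (eps * (N * D))) * (qq * wW).
  by apply: ler_pM => //; [exact: sqr_ge0|exact: ltW].
have s2 : - ev * wv <= - Et * wv + (eps * D + kk) * wv.
  by rewrite -mulrDl ler_pM2r.
have s3 : - Et * wv <= (- qq^-1) * (Et * wW).
  rewrite !mulNr lerN2 mulrCA ler_wpM2l//.
  by rewrite mulrC ler_pdivrMr// mulrC.
have s4 : (eps * D + kk) * wv <= (eps * D + kk) * (qq * wW).
  by rewrite ler_wpM2l// addr_ge0// mulr_ge0// ltW.
have s5 : kk * (qq * wW) <= qq * QQ * Jt * kk.
  rewrite [X in _ <= X]mulrC ler_wpM2l// -mulrA.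
  by rewrite ler_pM2l.
have -> : ((fv - mt) ^+ 2 - ev) * wv = (fv - mt) ^+ 2 * wv + (- ev * wv) by ring.
have -> : qq * (1 + eps) * ((fW - mt) ^+ 2 * wW) + qq * eps * ((2 * N + 1) * D) * wW +
   - qq^-1 * (Et * wW) + qq * QQ * Jt * kk =
   ((1 + eps) * (fW - mt) ^+ 2 + 2 * (eps * (N * D))) * (qq * wW) +
   eps * D * (qq * wW) + (- qq^-1 * (Et * wW)) + qq * QQ * Jt * kk by ring.
lra.
Qed.

(** The smallness that lets half of the variance bound survive at the level of integrals,
and a quarter after comparing the two normalizations. *)
Definition small_perturbation :=
  N * eps <= 2^-1 /\ eps * ((5 * N + 1) * C + 3 * (2 * N + 1 + Q)) <= c / 2.

(** Integrates the pointwise comparison, centred at the mean force of the convex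
potential, and uses the variance bound for the latter. *)
Lemma site_variance_perturbed : small_perturbation ->
  site_J2 V V1 V2 m dl 0 * site_J V m dl 0 - site_J1 V V1 m dl 0 ^+ 2 <=
   - (c / 4 * D) * site_J V m dl 0 ^+ 2.
Proof.
move=> [Neps small].
have eps1 : eps <= 1.
  have e0 := eps0; have n1 := N1.
  have : 0 <= (N - 1) * eps by apply: mulr_ge0; lra.
  lra.
have z2 : -2 < (0 : R) < 2 by lra.
have W2c x : c <= W2 x by case/andP: (W2cC x).
have W20 x : 0 <= W2 x by apply: le_trans (W2c x); exact: ltW.
have J0 := site_J_gt0 hV i0 m dl z2.
have Jt0 := site_J_gt0 hW i0 m dl z2.
have var := site_variance_convex hW i0 m dl0 W2c (ltW c0).
have iw : has_integral w (site_J V m dl 0) by split=> //; exact: (integrable_site_weight hV i0 m dl z2).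
have iwt : has_integral wt (site_J W m dl 0) by split=> //; exact: (integrable_site_weight hW i0 m dl z2).
have ifw : has_integral (fun t => f t * w t) (site_J1 V V1 m dl 0).
  by split=> //; exact: (integrable_site_force hV i0 m dl z2).
have ift : has_integral (fun t => ft t * wt t) (site_J1 W W1 m dl 0).
  by split=> //; exact: (integrable_site_force hW i0 m dl z2).
have if2 := conj (integrable_site_force2 hV i0 m dl z2) erefl : has_integral _ _.
have ie := conj (integrable_site_stiff hV i0 m dl z2) erefl : has_integral _ _.
have if2t := conj (integrable_site_force2 hW i0 m dl z2) erefl : has_integral _ _.
have iet := conj (integrable_site_stiff hW i0 m dl z2) erefl : has_integral _ _.
move: var; rewrite (site_J2E hV i0 m dl z2) (site_J2E hW i0 m dl z2).
move: if2 ie if2t iet.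
set F2 := (\int[mu]_t (f t ^+ 2 * w t))%R; set E := (\int[mu]_t (e t * w t))%R.
set F2t := (\int[mu]_t (ft t ^+ 2 * wt t))%R; set Et := (\int[mu]_t (et t * wt t))%R.
move=> if2 ie if2t iet var.
pose mt := site_J1 W W1 m dl 0 / site_J W m dl 0.
pose A := q * (1 + eps).
pose A2 := q * eps * ((2 * N + 1) * D).
pose A4 := q * Q * site_J W m dl 0.
have hk : has_integral (fun t => \sum_i dl i ^+ 2 * k (t - m i)) (\sum_i dl i ^+ 2 * u).
  apply: has_integral_sum => i; apply: has_integralZ.
  exact: has_integral_shift ck k0 ik.
have hL := has_integralD (has_integralD (has_integralD if2
  (has_integralZ (- 2 * mt) ifw)) (has_integralZ (mt ^+ 2) iw)) (has_integralZ (- 1) ie).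
have hR := has_integralD (has_integralD (has_integralD (has_integralD (has_integralZ A if2t)
  (has_integralZ (A * (- 2 * mt)) ift)) (has_integralZ (A * mt ^+ 2 + A2) iwt))
  (has_integralZ (- q^-1) iet)) (has_integralZ A4 hk).
have LR : F2 + - 2 * mt * site_J1 V V1 m dl 0 + mt ^+ 2 * site_J V m dl 0 + - 1 * E <=
    A * F2t + A * (- 2 * mt) * site_J1 W W1 m dl 0 + (A * mt ^+ 2 + A2) * site_J W m dl 0
    + - q^-1 * Et + A4 * \sum_i dl i ^+ 2 * u.
  apply: (has_integral_le hL hR) => t.
  have := site_pointwise mt t eps1 W20; rewrite -/A -/A2 -/A4.
  clear hL hR; clearbody mt A A2 A4.
  move: (\sum_i dl i ^+ 2 * k (t - m i)) (et t) (w t) (wt t) (f t) (ft t) (e t) A A2 A4 q^-1 mt.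
  move=> *; lra.
have Neps0 : 0 <= N * eps by apply: mulr_ge0 => //; exact: ltW eps0.
have q1 : 1 <= q by rewrite -[X in X <= _]expR0 ler_expR.
have qi1 : 1 - N * eps <= q^-1 by rewrite -expRN; apply: expR_ge1Dx.
have q2 : q <= 1 + 2 * (N * eps) by exact: expR_le_1D2x.
have JqJt : site_J V m dl 0 <= q * site_J W m dl 0.
  by apply: (has_integral_le iw (has_integralZ q iwt)) => t; exact: site_weight_le.
have C0 : 0 <= C by have /andP[cW WC] := W2cC 0; apply: le_trans WC; exact: W20.
have Et0 : 0 <= Et.
  by apply: Rintegral_ge0 => t _; rewrite mulr_ge0 ?expR_ge0//;
    apply: sumr_ge0 => i _; rewrite mulr_ge0 ?sqr_ge0.
have EtC : Et <= C * D * site_J W m dl 0.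
  apply: (has_integral_le iet (has_integralZ (C * D) iwt)) => t.
  rewrite ler_wpM2r ?expR_ge0// mulr_sumr; apply: ler_sum => i _.
  by rewrite mulrC ler_wpM2r ?sqr_ge0//; case/andP: (W2cC (site_arg m dl 0 t i)).
have mtE : mt * site_J W m dl 0 = site_J1 W W1 m dl 0 by rewrite /mt divfK// gt_eqF.
apply: (@variance_perturbation_algebra R _ _ _ _ F2t Et (site_J1 W W1 m dl 0) (site_J W m dl 0) mt q q^-1 Q eps N D C c u) => //.
all: try exact: expR_ge0.
all: try exact: (ltW c0).
by move: LR; rewrite -mulr_suml.
Qed.
End perturbation.

(** * Mollification of the non-convex part *)

Section mollification.
Context {R : realType}.
Local Notation mu := (@lebesgue_measure R).

Lemma bounded_of_support (f : R -> R) (A : R) : continuous f ->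
  (forall x, A < `|x| -> f x = 0) -> exists2 M, 0 <= M & forall x, `|f x| <= M.
Proof.
move=> cf f0; pose B := `|A|.
have BB : - B <= B by have := normr_ge0 A; rewrite -/B; lra.
have [|c _ cmax] := @EVT_max R (fun x => `|f x|) (- B) B BB.
  apply: continuous_subspaceT => x.
  apply: (@continuous_comp _ _ _ f (fun y : R => `|y|)); first exact: cf.
  exact: norm_continuous.
exists `|f c| => // x; have [xB|xB] := leP `|x| B.
  by apply: cmax; rewrite in_itv/= -ler_norml.
by rewrite f0 ?normr0// (le_lt_trans (ler_norm A)).
Qed.

(** The fundamental theorem of calculus. *)
Lemma variation_le_L1 (F f : R -> R) (u a b : R) :
  (forall x, is_derive x (1 : R) F (f x)) -> continuous f ->
  has_integral (fun x => `|f x|) u -> a < b -> `|F b - F a| <= u.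
Proof.
move=> dF cf hu ab.
have cF := is_derive_continuous dF.
have cfab : {within `[a, b], continuous f} by exact: continuous_subspaceT.
have [iu ue] := hu.
have iab : mu.-integrable `[a, b] (EFin \o f).
  by apply: continuous_compact_integrable => //; exact: segment_compact.
have e : (\int[mu]_(x in `[a, b]) (f x)%:E = (F b)%:E - (F a)%:E)%E.
  apply: continuous_FTC2 => //.
    split; first by move=> x _; have [] := dF x.
      by apply: cvg_at_right_filter; exact: cF.
    by apply: cvg_at_left_filter; exact: cF.
  by move=> x _; rewrite derive1E; have [_ ->] := dF x.
have -> : F b - F a = (\int[mu]_(x in `[a, b]) f x)%R by rewrite /Rintegral e.
have mab : measurable (`[a, b]%classic : set (measurableTypeR R)).
  have : measurable (`[a, b]%classic : set R) by exact: measurable_itv.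
  by [].
apply: le_trans (le_normr_Rintegral mab iab) _.
rewrite -ue /Rintegral fine_le//.
- by apply: (integrable_fin_num mab); exact: (integrableS measurableT mab _ iu).
- exact: (integrable_fin_num measurableT iu).
have mf : measurable_fun [set: R] (fun x => (`|f x|)%:E) by case/integrableP: iu.
exact: (@ge0_subset_integral _ (measurableTypeR R) R mu _ setT mab measurableT
  (fun x => (`|f x|)%:E) mf (fun x _ => ltac:(by rewrite lee_fin)) (@subsetT _ _)).
Qed.

(** For a compactly supported function, the integral from minus infinity. *)
Lemma antiderivative (G : R -> R) (A : R) : continuous G ->
  (forall x, A < `|x| -> G x = 0) ->
  exists Q : R -> R, forall x, is_derive x (1 : R) Q (G x).
Proof.
move=> cG G0.
have [M M0 GM] := bounded_of_support cG G0.
have iG : mu.-integrable [set: R] (EFin \o G).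
  apply: (@integrable_dominated _ _ (fun t => M * expR (A ^+ 2) * expR (- (1 * t ^+ 2)))) => //.
    by apply: integrable_scaled_gauss.
  move=> t; have [At|tA] := ltP A `|t|.
    by rewrite G0// normr0 !mulr_ge0// expR_ge0.
  apply: le_trans (GM t) _; rewrite -mulrA ler_peMr// -expRD.
  rewrite -[X in X <= _]expR0 ler_expR mul1r subr_ge0.
  by rewrite -(real_normK (num_real t)) lerXn2r ?nnegrE// (le_trans _ tA).
exists (fun x => (\int[mu]_(t in `]-oo, x]) G t)%R) => x.
have [||||d1 d2] := @continuous_FTC1 R G -oo%O x (x + 1).
- by rewrite ltrDl.
- apply: (integrableS (measurableT : measurable [set: measurableTypeR R]) _ _ iG) => //.
- by rewrite ltNyr.
- exact: cG.
by apply: DeriveDef; [exact: d1|rewrite -derive1E; exact: d2].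
Qed.

Lemma lipschitz_of_derive (F f : R -> R) (L x y : R) :
  (forall x, is_derive x (1 : R) F (f x)) -> (forall x, `|f x| <= L) ->
  `|F x - F y| <= L * `|x - y|.
Proof.
move=> dF fL.
wlog xy : x y / y < x.
  move=> H; have [xy|xy|->] := ltgtP x y; last by rewrite !subrr normr0 mulr0.
    rewrite [X in X <= _]distrC [X in _ <= _ * X]distrC; exact: H.
  exact: H.
have [||c _ ->] := @mean_value R F f (y - 1) (x + 1) y x (fun z _ => dF z) _ _ xy.
- lra.
- lra.
by rewrite normrM ler_wpM2r.
Qed.

Variables (U U1 U2 G G1 G2 : R -> R) (c A u eps : R).
Hypothesis dU : forall x, is_derive x (1 : R) U (U1 x).
Hypothesis dU1 : forall x, is_derive x (1 : R) U1 (U2 x).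
Hypothesis cU2 : continuous U2.
Hypothesis c1 : 1 < c.
Hypothesis U2c : forall x, c^-1 <= U2 x <= c.
Hypothesis dG : forall x, is_derive x (1 : R) G (G1 x).
Hypothesis dG1 : forall x, is_derive x (1 : R) G1 (G2 x).
Hypothesis cG2 : continuous G2.
Hypothesis G0 : forall x, 0 <= G x.
Hypothesis suppG : forall x, A < `|x| -> G x = 0.
Hypothesis iG2 : has_integral (fun x => `|G2 x|) u.
Hypothesis ueps : 2 * u <= eps.
Hypothesis epsc : eps <= c^-1 / 2.

Lemma support_derive (f f1 : R -> R) : (forall x, is_derive x (1 : R) f (f1 x)) ->
  (forall x, A < `|x| -> f x = 0) -> forall x, A < `|x| -> f1 x = 0.
Proof.
move=> df f0 x Ax; have [_ <-] := df x.
rewrite (@near_eq_derive _ _ _ _ (cst 0) x 1) ?derive_cst//.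
have := @norm_continuous _ _ x; move=> /cvgr_gt/(_ _ Ax).
by apply: filterS => y; exact: f0.
Qed.

(** G1 vanishes far to the left of x, and its total variation is at most u. *)
Lemma small_slope x : `|G1 x| <= u.
Proof.
(* a point to the left of x and outside the support *)
pose y := Num.min (x - 1) (- (`|A| + 1)).
have yx : y < x by rewrite gt_min; apply/orP; left; lra.
have yA : A < `|y|.
  have yle : y <= - (`|A| + 1) by rewrite ge_min lexx orbT.
  apply: le_lt_trans (ler_norm A) _; have := ler_norm (- y); rewrite normrN; lra.
have := variation_le_L1 dG1 cG2 iG2 yx.
by rewrite (support_derive dG suppG yA) subr0.
Qed.

(** W is U plus the average of G over the unit interval centred at x, written with an
antiderivative Q of G. The second derivative of this average is a difference of two
values of G1, hence at most eps. *)
Lemma mollified_potential : exists W W1 W2 lam b K lam' b' K',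
  [/\ c2_potential (fun x => U x + G x) (fun x => U1 x + G1 x) (fun x => U2 x + G2 x) lam b K,
      c2_potential W W1 W2 lam' b' K',
      forall x, c^-1 / 2 <= W2 x <= 2 * c
    & forall x, [/\ `|W x - (U x + G x)| <= eps, `|W1 x - (U1 x + G1 x)| <= eps
      & `|W2 x - (U2 x + G2 x)| <= eps + `|G2 x|]].
Proof.
have cG := is_derive_continuous dG.
have cG1 := is_derive_continuous dG1.
have u0 : 0 <= u := le_trans (normr_ge0 _) (small_slope 0).
have cgt1 := c1.
have ci0 : 0 < c^-1 by rewrite invr_gt0; lra.
have cic : c^-1 <= 1 by rewrite invf_le1//; lra.
have [Q dQ] := antiderivative cG suppG.
have suppG2 := support_derive dG1 (support_derive dG suppG).
have [M M0 GM] := bounded_of_support cG2 suppG2.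
have U1lin x : `|U1 x| <= (c + `|U1 0|) * (1 + `|x|).
  have := @lipschitz_of_derive U1 U2 c x 0 dU1; rewrite subr0 => H.
  have h1 : `|U1 x - U1 0| <= c * `|x|.
    apply: H => z; rewrite ger0_norm; first by case/andP: (U2c z).
    by case/andP: (U2c z) => h _; apply: le_trans h; exact: ltW.
  have h2 : `|U1 x| <= `|U1 x - U1 0| + `|U1 0|.
    by rewrite -{1}(subrK (U1 0) (U1 x)); exact: ler_normD.
  have : 0 <= `|U1 0| * `|x| by exact: mulr_ge0.
  have := c1; lra.
have Ulow x : U 0 + U1 0 * x + c^-1 / 2 * x ^+ 2 <= U x.
  pose f y := U (1 * y + 0) - c^-1 / 2 * (y * y).
  pose f1 y := U1 (1 * y + 0) - c^-1 * y.
  pose f2 y := U2 (1 * y + 0) - c^-1.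
  have d1 y : is_derive y (1 : R) f (f1 y).
    apply: (is_derive_eq (is_derive_sub (is_derive_comp1 (dU _) (is_derive_affine 1 0 y))
      (is_derive_mul (is_derive_cst (c^-1 / 2) y 1)
        (is_derive_mul (is_derive_id y 1) (is_derive_id y 1))))).
    by rewrite /f1 /cst; move: c^-1 (U1 _) => ? ?; field.
  have d2 y : is_derive y (1 : R) f1 (f2 y).
    apply: (is_derive_eq (is_derive_sub (is_derive_comp1 (dU1 _) (is_derive_affine 1 0 y))
      (is_derive_mul (is_derive_cst c^-1 y 1) (is_derive_id y 1)))).
    by rewrite /f2 /cst; move: c^-1 (U2 _) => ? ?; ring.
  have f20 y : 0 <= f2 y by rewrite /f2 subr_ge0; case/andP: (U2c (1 * y + 0)).
  have := @second_order_lower R f f1 f2 (`|x| + 1) x (fun z _ => d1 z) (fun z _ => d2 z)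
    (fun z _ => f20 z).
  have -> : - (`|x| + 1) < x < `|x| + 1.
    by have := ler_norm x; have := ler_norm (- x); rewrite normrN; lra.
  move=> /(_ isT); rewrite /f /f1 !(mulr0, add0r, subr0, addr0) mul1r; lra.
have Vlow (L x : R) : `|U1 0| <= L ->
   U 0 - c * L ^+ 2 + c^-1 / 4 * x ^+ 2 <= U 0 + U1 0 * x + c^-1 / 2 * x ^+ 2.
  move=> UL; have sq : U1 0 ^+ 2 <= L ^+ 2.
    by rewrite -(real_normK (num_real (U1 0))) lerXn2r ?nnegrE// (le_trans _ UL).
  have cc : c^-1 * c = 1 by rewrite mulVf// gt_eqF//; have := c1; lra.
  have s : 0 <= c^-1 * (x / 2 + c * U1 0) ^+ 2 by rewrite mulr_ge0 ?sqr_ge0// ltW.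
  have e : c^-1 * (x / 2 + c * U1 0) ^+ 2 = c^-1 / 4 * x ^+ 2 + (c^-1 * c) * (U1 0 * x) + (c^-1 * c) * (c * U1 0 ^+ 2) by field; have := c1; lra.
  rewrite e cc !mul1r in s.
  have : c * U1 0 ^+ 2 <= c * L ^+ 2 by rewrite ler_wpM2l//; have := c1; lra.
  lra.
pose W x := U x + (Q (1 * x + 2^-1) - Q (1 * x + (- 2^-1))).
pose W1 x := U1 x + (G (1 * x + 2^-1) - G (1 * x + (- 2^-1))).
pose W2 x := U2 x + (G1 (1 * x + 2^-1) - G1 (1 * x + (- 2^-1))).
have mvQ x : exists2 z, `|x - z| <= 1 & Q (1 * x + 2^-1) - Q (1 * x + (- 2^-1)) = G z.
  have [||| z /andP[z1 z2] ->] := @mean_value R Q G (x - 2) (x + 2) (1 * x + - 2^-1) (1 * x + 2^-1) (fun z _ => dQ z); try lra.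
  exists z; first by rewrite ler_norml; apply/andP; split; lra.
  by have -> : 1 * x + 2^-1 - (1 * x + - 2^-1) = 1 by [field]; rewrite mulr1.
have mvG x : exists z, G (1 * x + 2^-1) - G (1 * x + (- 2^-1)) = G1 z.
  have [||| z _ ->] := @mean_value R G G1 (x - 2) (x + 2) (1 * x + - 2^-1) (1 * x + 2^-1) (fun z _ => dG z); try lra.
  exists z.
  by have -> : 1 * x + 2^-1 - (1 * x + - 2^-1) = 1 by [field]; rewrite mulr1.
have G1diff x y : `|G1 x - G1 y| <= eps.
  apply: le_trans (ler_normB _ _) _; apply: le_trans ueps.
  by have := small_slope x; have := small_slope y; lra.
exists W, W1, W2, (c^-1 / 4), (c * `|U1 0| ^+ 2 - U 0), (c + `|U1 0| + u + M).
exists (c^-1 / 4), (c * `|U1 0| ^+ 2 - U 0), (c + `|U1 0| + u + u).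
split.
- split; first by rewrite divr_gt0.
  + by move=> x; exact: is_derive_add.
  + move=> x; split; first exact: is_derive_add.
    by apply: continuousD; [exact: cU2|exact: cG2].
  + by move=> x; have := Ulow x; have := Vlow `|U1 0| x (lexx _); have := G0 x; lra.
  + move=> x; split.
      apply: le_trans (ler_normD _ _) _; have := U1lin x; have := small_slope x.
      have : 0 <= u * `|x| by rewrite mulr_ge0.
      have : 0 <= M * `|x| by rewrite mulr_ge0.
      lra.
    apply: le_trans (ler_normD _ _) _; have := GM x.
    have /andP[l r] := U2c x; rewrite (ger0_norm (_ : 0 <= U2 x)); last by lra.
    by have := normr_ge0 (U1 0); lra.
- split; first by rewrite divr_gt0.
  + move=> x; apply: is_derive_add => //.
    apply: (is_derive_eq (is_derive_sub (is_derive_comp1 (dQ _) (is_derive_affine 1 2^-1 x))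
      (is_derive_comp1 (dQ _) (is_derive_affine 1 (- 2^-1) x)))); ring.
  + move=> x; split.
      apply: is_derive_add => //.
      apply: (is_derive_eq (is_derive_sub (is_derive_comp1 (dG _) (is_derive_affine 1 2^-1 x))
        (is_derive_comp1 (dG _) (is_derive_affine 1 (- 2^-1) x)))); ring.
    apply: continuousD; first exact: cU2.
    have cs (a : R) : {for x, continuous (fun x : R => G1 (1 * x + a))}.
      have d : is_derive x (1 : R) (fun x : R => G1 (1 * x + a)) (G2 (1 * x + a) * 1).
        exact: is_derive_comp1 (dG1 _) (is_derive_affine 1 a x).
      by apply: differentiable_continuous; apply/derivable1_diffP; have [] := d.
    by apply: continuousB; exact: cs.
  + move=> x; rewrite /W; have [z _ ->] := mvQ x.
    by have := Ulow x; have := Vlow `|U1 0| x (lexx _); have := G0 z; lra.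
  + move=> x; split.
      rewrite /W1; have [z ->] := mvG x.
      apply: le_trans (ler_normD _ _) _; have := U1lin x; have := small_slope z.
      have : 0 <= u * `|x| by rewrite mulr_ge0.
      lra.
    apply: le_trans (ler_normD _ _) _.
    have := ler_normB (G1 (1 * x + 2^-1)) (G1 (1 * x + - 2^-1)).
    have := small_slope (1 * x + 2^-1); have := small_slope (1 * x + - 2^-1).
    have /andP[l r] := U2c x; rewrite (ger0_norm (_ : 0 <= U2 x)); last by lra.
    by have := normr_ge0 (U1 0); lra.
- move=> x; have := G1diff (1 * x + 2^-1) (1 * x + - 2^-1).
  rewrite ler_norml => /andP[h1 h2]; have /andP[l r] := U2c x.
  by rewrite /W2; apply/andP; split; have := epsc; have := c1; lra.
move=> x; split.
- rewrite /W opprD addrACA subrr add0r; have [z xz ->] := mvQ x.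
  apply: le_trans (lipschitz_of_derive z x dG small_slope) _.
  rewrite distrC; apply: le_trans ueps.
  have : u * `|x - z| <= u * 1 by exact: ler_wpM2l.
  lra.
- by rewrite /W1 opprD addrACA subrr add0r; have [z ->] := mvG x.
- rewrite /W2 opprD addrACA subrr add0r; apply: le_trans (ler_normB _ _) _.
  by rewrite lerD2r.
Qed.

End mollification.

(** * Strong log-concavity of the single-spin integral *)

Section translated_concavity.
Context {R : realType} {I : finType}.
Variables (V V1 V2 : R -> R) (m dl : I -> R).

(** Moving the parameter amounts to moving the base point, so that statements at
parameter 0 hold at every parameter. *)
Lemma site_arg_translate x y t i :
  site_arg (fun i => m i + x * dl i) dl y t i = site_arg m dl (x + y) t i.
Proof. by rewrite /site_arg; ring. Qed.

Lemma site_energy_translate x t :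
  site_energy V m dl x t = site_energy V (fun i => m i + x * dl i) dl 0 t.
Proof.
by rewrite /site_energy; apply: eq_bigr => i _; rewrite site_arg_translate addr0.
Qed.

Lemma site_force_translate x t :
  site_force V1 m dl x t = site_force V1 (fun i => m i + x * dl i) dl 0 t.
Proof.
by rewrite /site_force; apply: eq_bigr => i _; rewrite site_arg_translate addr0.
Qed.

Lemma site_stiff_translate x t :
  site_stiff V2 m dl x t = site_stiff V2 (fun i => m i + x * dl i) dl 0 t.
Proof.
by rewrite /site_stiff; apply: eq_bigr => i _; rewrite site_arg_translate addr0.
Qed.

Lemma site_integrals_translate x :
  [/\ site_J V m dl x = site_J V (fun i => m i + x * dl i) dl 0,
      site_J1 V V1 m dl x = site_J1 V V1 (fun i => m i + x * dl i) dl 0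
    & site_J2 V V1 V2 m dl x = site_J2 V V1 V2 (fun i => m i + x * dl i) dl 0].
Proof.
split; apply: eq_Rintegral => t _; rewrite /site_weight site_energy_translate //.
  by rewrite site_force_translate.
by rewrite site_force_translate site_stiff_translate.
Qed.

End translated_concavity.

Section star.
Context {R : realType} {I : finType}.
Local Notation mu := (@lebesgue_measure R).
Local Notation N := (#|I|%:R : R).

(** The size of the mollification error allowed by [small_perturbation] for a potential
with second derivative between c^-1 / 2 and 2 c, and by [mollified_potential]. *)
Definition mollification_bound (c : R) : R :=
  Num.min (Num.min (2^-1 / N) (c^-1 / 2))
    (c^-1 / 4 / ((5 * N + 1) * (2 * c) + 3 * (2 * N + 1 + expR (N * (2 * c) / 2)))).

Lemma mollification_bound_gt0 (c : R) (i0 : I) : 1 < c -> 0 < mollification_bound c.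
Proof.
move=> c1; have N0 : 0 < N by rewrite ltr0n; apply/card_gt0P; exists i0.
have ci0 : 0 < c^-1 by rewrite invr_gt0; lra.
rewrite /mollification_bound !lt_min; apply/andP; split; first apply/andP; first split.
- by rewrite divr_gt0// invr_gt0.
- by rewrite divr_gt0.
rewrite divr_gt0 ?divr_gt0//.
have := expR_gt0 (N * (2 * c) / 2).
have : 0 < N * c by rewrite mulr_gt0//; lra.
move: (expR _) => E; lra.
Qed.

Lemma mollification_bound_small (c : R) (i0 : I) : 1 < c ->
  small_perturbation (I := I) (mollification_bound c) (c^-1 / 2) (2 * c).
Proof.
move=> c1; have N0 : 0 < N by rewrite ltr0n; apply/card_gt0P; exists i0.
split.
  rewrite mulrC -ler_pdivlMr//.
  by rewrite /mollification_bound ge_min; apply/orP; left; rewrite ge_min lexx.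
rewrite -ler_pdivlMr.
  rewrite /mollification_bound ge_min; apply/orP; right.
  by have -> : c^-1 / 2 / 2 = c^-1 / 4 by field; lra.
have := expR_gt0 (N * (2 * c) / 2).
have : 0 < N * c by rewrite mulr_gt0//; lra.
move: (expR _) => E; lra.
Qed.

Lemma mollification_bound_le (c : R) : mollification_bound c <= c^-1 / 2.
Proof.
rewrite /mollification_bound ge_min; apply/orP; left.
by rewrite ge_min lexx orbT.
Qed.

(** The bound on the second derivative of ln J, known at parameter 0, holds at every
parameter after moving the base point; it is then integrated twice along the line. *)
Lemma site_pair_unit (U U1 U2 G G1 G2 : R -> R) (c A u : R) (i0 : I) (m dl : I -> R) :
  (forall x, is_derive x (1 : R) U (U1 x)) -> (forall x, is_derive x (1 : R) U1 (U2 x)) ->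
  continuous U2 -> 1 < c -> (forall x, c^-1 <= U2 x <= c) ->
  (forall x, is_derive x (1 : R) G (G1 x)) -> (forall x, is_derive x (1 : R) G1 (G2 x)) ->
  continuous G2 -> (forall x, 0 <= G x) -> (forall x, A < `|x| -> G x = 0) ->
  has_integral (fun x => `|G2 x|) u -> 2 * u <= mollification_bound c ->
  \sum_i dl i = 0 ->
  exists J : R -> R,
    [/\ forall x, -2 < x < 2 -> 0 < J x,
        forall x, -2 < x < 2 -> has_integral (site_weight (fun x => U x + G x) m dl x) (J x)
      & J 2^-1 * J (- 2^-1) <=
          expR (- (c^-1 / 32 * \sum_i dl i ^+ 2)) * J 0 ^+ 2].
Proof.
move=> dU dU1 cU2 c1 U2c dG dG1 cG2 G0 suppG iG2 ueps dl0.
have [W [W1 [W2 [lam [b [K [lam' [b' [K' [hV hW W2c close]]]]]]]]]] :=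
  mollified_potential dU dU1 cU2 c1 U2c dG dG1 cG2 G0 suppG iG2 ueps
    (mollification_bound_le c).
have eps0 := mollification_bound_gt0 i0 c1.
have u0 : 0 <= u by apply: le_trans (small_slope dG dG1 cG2 suppG iG2 0).
have c20 : 0 < c^-1 / 2 by rewrite divr_gt0// invr_gt0; lra.
set V := (fun x => U x + G x) in hV *.
exists (site_J V m dl); split.
- by move=> x x2; exact: (site_J_gt0 hV i0 m dl x2).
- by move=> x x2; split; first exact: (integrable_site_weight hV i0 m dl x2).
have pair := pair_of_log_concave (fun x x2 => site_J_gt0 hV i0 m dl x2)
  (fun x x2 => is_derive_site_J hV i0 m dl x2)
  (fun x x2 => is_derive_site_J1 hV i0 m dl x2).
have -> : c^-1 / 32 * \sum_i dl i ^+ 2 = c^-1 / 8 * (\sum_i dl i ^+ 2) * 2^-1 ^+ 2.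
  by move: (\sum_i dl i ^+ 2) => D; field; lra.
apply: pair => [x x2|]; last lra.
have [-> -> ->] := @site_integrals_translate R I V (fun x => U1 x + G1 x) (fun x => U2 x + G2 x) m dl x.
have -> : c^-1 / 8 * \sum_i dl i ^+ 2 = c^-1 / 2 / 4 * \sum_i dl i ^+ 2.
  by move: (\sum_i dl i ^+ 2) => D; field; lra.
apply: (@site_variance_perturbed R I V _ _ lam b K W W1 W2 lam' b' K' hV hW i0
  _ dl dl0 (mollification_bound c) (c^-1 / 2) (2 * c) u (fun x => `|G2 x|)) => //.
- by move=> y; have [] := close y.
- by move=> y; have [] := close y.
- by move=> y; have [] := close y.
- move=> y; apply: (@continuous_comp _ _ _ G2 (fun y : R => `|y|)); first exact: cG2.
  exact: norm_continuous.
- lra.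
- exact: mollification_bound_small.
Qed.

Definition site_integral (V : R -> R) (beta : R) (a : I -> R) : \bar R :=
  (\int[mu]_t (expR (- (beta * \sum_i V (t - a i))))%:E)%E.

(** Strong log-concavity of the single-spin integral transversally to the constants. The
scaling t = sqrt beta s reduces to beta = 1: it leaves the second derivatives of the
potential bounded by the same constants and multiplies the L^1 norm of that of G by
sqrt beta. Subtracting the mean av is a translation of the integrated spin. *)
Lemma site_pair (U U1 U2 G G1 G2 : R -> R) (c A u beta : R) (i0 : I) (a b : I -> R) :
  (forall x, is_derive x (1 : R) U (U1 x)) -> (forall x, is_derive x (1 : R) U1 (U2 x)) ->
  continuous U2 -> 1 < c -> (forall x, c^-1 <= U2 x <= c) ->
  (forall x, is_derive x (1 : R) G (G1 x)) -> (forall x, is_derive x (1 : R) G1 (G2 x)) ->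
  continuous G2 -> (forall x, 0 <= G x) -> (forall x, A < `|x| -> G x = 0) ->
  has_integral (fun x => `|G2 x|) u -> 0 < beta ->
  Num.sqrt beta * u <= mollification_bound c / 2 ->
  let V x := U x + G x in
  let av := (\sum_i (a i - b i)) / N in
  exists Ja Jb Jm : R, [/\ 0 < Ja, 0 < Jb, 0 < Jm,
    [/\ site_integral V beta a = Ja%:E, site_integral V beta b = Jb%:E
      & site_integral V beta (fun i => (a i + b i) / 2) = Jm%:E]
    & Ja * Jb <= expR (- (c^-1 / 32 * beta * \sum_i (a i - b i - av) ^+ 2)) * Jm ^+ 2].
Proof.
move=> dU dU1 cU2 c1 U2c dG dG1 cG2 G0 suppG iG2 beta0 small V av.
have N0 : 0 < N by rewrite ltr0n; apply/card_gt0P; exists i0.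
pose r := Num.sqrt beta.
have r0 : 0 < r by rewrite sqrtr_gt0.
have rn : r != 0 by rewrite gt_eqF.
have rr : r * r = beta by rewrite -expr2 sqr_sqrtr// ltW.
pose sc (f : R -> R) x := (r * r) * f (r^-1 * x + 0).
pose sc1 (f : R -> R) x := r * f (r^-1 * x + 0).
pose sc2 (f : R -> R) x := f (r^-1 * x + 0).
have dsc (f f1 : R -> R) : (forall x, is_derive x (1 : R) f (f1 x)) ->
    forall x, is_derive x (1 : R) (sc f) (sc1 f1 x).
  move=> df x; apply: (is_derive_eq (is_derive_mul (is_derive_cst (r * r) x 1)
    (is_derive_comp1 (df _) (is_derive_affine r^-1 0 x)))).
  by rewrite mul0r add0r /cst /sc1; field.
have dsc1 (f f1 : R -> R) : (forall x, is_derive x (1 : R) f (f1 x)) ->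
    forall x, is_derive x (1 : R) (sc1 f) (sc2 f1 x).
  move=> df x; apply: (is_derive_eq (is_derive_mul (is_derive_cst r x 1)
    (is_derive_comp1 (df _) (is_derive_affine r^-1 0 x)))).
  by rewrite mul0r add0r /cst /sc2; field.
have csc2 (f : R -> R) : continuous f -> continuous (sc2 f).
  move=> cf x; apply: (@continuous_comp _ _ _ (fun x => r^-1 * x + 0) f); last exact: cf.
  apply: differentiable_continuous; apply/derivable1_diffP.
  by have [] := is_derive_affine r^-1 0 x.
have supp x : A * r < `|x| -> sc G x = 0.
  move=> Ax; rewrite /sc suppG ?mulr0// addr0 normrM normfV (gtr0_norm r0).
  by rewrite mulrC ltr_pdivlMr.
have isc : has_integral (fun x => `|sc2 G2 x|) (r * u).
  have cabs : continuous (fun x => `|sc2 G2 x|).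
    move=> x; apply: (@continuous_comp _ _ _ (sc2 G2) (fun y : R => `|y|)).
      exact: csc2.
    exact: norm_continuous.
  have mabs : measurable_fun [set: R] (fun x => (`|sc2 G2 x|)%:E).
    by apply/measurable_EFinP; exact: continuous_measurable_fun.
  have e : (\int[mu]_x (`|sc2 G2 x|)%:E = (r * u)%:E)%E.
    rewrite (@ge0_integral_affine R r 0 _ r0 mabs); last by move=> t; rewrite lee_fin.
    rewrite EFinM -(has_integralE iG2); congr (_ * _)%E; apply: eq_integral => t _.
    by rewrite /sc2 !addr0 mulKf.
  split; last by rewrite /Rintegral e.
  apply/integrableP; split=> //.
  by under eq_integral do rewrite /= normr_id; rewrite e ltry.
pose m i := r * ((a i + b i) / 2).
pose dl i := r * (a i - b i - av).
have dl0 : \sum_i dl i = 0.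
  rewrite /dl -mulr_sumr sumrB sumr_const -mulr_natl /av.
  by rewrite mulrCA divff ?gt_eqF// mulr1 subrr mulr0.
have [|J [Jpos hJ pair]] := @site_pair_unit (sc U) (sc1 U1) (sc2 U2) (sc G) (sc1 G1) (sc2 G2)
  c (A * r) (r * u) i0 m dl (dsc _ _ dU) (dsc1 _ _ dU1) (csc2 _ cU2) c1
  (fun x => U2c _) (dsc _ _ dG) (dsc1 _ _ dG1) (csc2 _ cG2)
  (fun x => ltac:(by rewrite /sc mulr_ge0// mulr_ge0// ltW)) supp isc _ dl0.
  by rewrite -/r in small; lra.
have rep x y (a' : I -> R) : -2 < x < 2 -> (forall i, m i + x * dl i - y = r * a' i) ->
    site_integral V beta a' = (r^-1 * J x)%:E.
  move=> x2 ea; have iJ := hJ x x2.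
  have mw : measurable_fun [set: R] (fun t => (site_weight (fun x => sc U x + sc G x) m dl x t)%:E).
    by have [/integrableP[]] := iJ.
  have := has_integralE iJ.
  rewrite (@ge0_integral_affine R r y _ r0 mw); last by move=> t; rewrite lee_fin expR_ge0.
  have -> : (\int[mu]_t (site_weight (fun x => sc U x + sc G x) m dl x (r * t + y))%:E =
     site_integral V beta a')%E.
    apply: eq_integral => t _; congr (EFin (expR (- _))).
    rewrite /site_energy mulr_sumr; apply: eq_bigr => i _.
    rewrite /sc -mulrDr rr /V.
    have -> // : r^-1 * site_arg m dl x (r * t + y) i + 0 = t - a' i.
    have -> : site_arg m dl x (r * t + y) i = r * (t - a' i).
      by rewrite mulrBr -ea /site_arg; ring.
    by rewrite addr0 mulKf.
  move=> e; rewrite EFinM -e muleA -EFinM mulVf// mul1e//.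
have h1 : -2 < (2^-1 : R) < 2 by apply/andP; split; lra.
have h2 : -2 < (- 2^-1 : R) < 2 by apply/andP; split; lra.
have h0 : -2 < (0 : R) < 2 by lra.
have rJ x : -2 < x < 2 -> 0 < r^-1 * J x by move=> x2; rewrite mulr_gt0 ?invr_gt0 ?Jpos.
(* a, b and their midpoint sit at parameters 1/2, -1/2 and 0 of the line through m,
   up to the translations absorbed by rep *)
exists (r^-1 * J 2^-1), (r^-1 * J (- 2^-1)), (r^-1 * J 0); split.
- exact: rJ.
- exact: rJ.
- exact: rJ.
- split.
  + by apply: (rep _ (- (2^-1 * r * av))) => // i; rewrite /m /dl; field.
  + by apply: (rep _ (2^-1 * r * av)) => // i; rewrite /m /dl; field.
  + by apply: (rep _ 0) => // i; rewrite /m /dl; ring.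
have -> : c^-1 / 32 * beta * \sum_i (a i - b i - av) ^+ 2 = c^-1 / 32 * \sum_i dl i ^+ 2.
  rewrite -mulrA; congr (_ * _); rewrite mulr_sumr; apply: eq_bigr => i _.
  by rewrite /dl exprMn [r ^+ 2]expr2 rr.
have -> : r^-1 * J 2^-1 * (r^-1 * J (- 2^-1)) = (r^-1) ^+ 2 * (J 2^-1 * J (- 2^-1)) by ring.
rewrite [X in _ <= _ * X]exprMn [X in _ <= X]mulrCA.
by rewrite ler_wpM2l// sqr_ge0.
Qed.

End star.

(** * The lattice and its odd sites *)

Lemma int_unit_step (a b : int) : `|a - b| = 1 -> b = a + (if a < b then 1 else -1).
Proof. by case: ltP => ab h; lia. Qed.

Lemma int_even_succ (s e : int) : `|e| = 1 -> (2 %| s + e)%Z = ~~ (2 %| s)%Z.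
Proof. by rewrite !dvdzE/= !dvdn2 => e1; lia. Qed.

Section lattice.
Context {d : nat}.
Implicit Types (x y : Zd d) (p : 'I_d * bool).

Definition unit_step p : Zd d :=
  [ffun j => if j == p.1 then (if p.2 then 1 else -1 : int) else 0].

Definition nb y p : Zd d := [ffun j => y j + unit_step p j].

Lemma nbK y i b : nb (nb y (i, b)) (i, ~~ b) = y.
Proof.
apply/ffunP => j; rewrite !ffunE /=; case: eqP => _; last by rewrite !addr0.
by case: b; rewrite /= ?addrK ?subrK.
Qed.

Lemma nb_inj y : injective (nb y).
Proof.
move=> [i b] [j e] /ffunP /(_ i); rewrite !ffunE/= eqxx => /addrI.
by case: eqP => [->|_]; [case: b; case: e|case: b].
Qed.

Lemma adj_nb y p : adj y (nb y p).
Proof.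
rewrite /adj (bigD1 p.1)//= big1 => [|j jp]; rewrite !ffunE ?eqxx.
  by case: p => i []; rewrite /= opprD addNKr ?normrN ?normr1.
by rewrite (negbTE jp) addr0 subrr normr0.
Qed.

Lemma adjP x y : reflect (exists p, y = nb x p) (adj x y).
Proof.
apply: (iffP idP) => [|[p ->]]; last exact: adj_nb.
rewrite /adj => /eqP s1.
have [i xyi] : exists i, x i != y i.
  apply: contrapT => h; move: s1; rewrite big1// => i _.
  apply/eqP; rewrite normr_eq0 subr_eq0; apply/negP => /negP xy; apply: h.
  by exists i.
have xi1 : 1 <= `|x i - y i| by rewrite -gtz0_ge1 normr_gt0 subr_eq0.
move: s1; rewrite (bigD1 i)//= => s1.
have r0 : 0 <= \sum_(j | j != i) `|x j - y j| by exact: sumr_ge0.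
have s0 : \sum_(j | j != i) `|x j - y j| = 0.
  apply/eqP; rewrite eq_le r0 andbT -(lerD2l `|x i - y i|) s1 addr0.
  exact: xi1.
have /eqP := s0.
rewrite psumr_eq0// => /allP e0.
exists (i, x i < y i); apply/ffunP => j; rewrite !ffunE/=.
case: eqP => [->|/eqP ji].
  by apply: int_unit_step; rewrite s0 addr0 in s1.
have := e0 j (mem_index_enum j); rewrite ji implyTb normr_eq0 subr_eq0 => /eqP ->.
by rewrite addr0.
Qed.

Lemma adjC x y : adj x y = adj y x.
Proof. by rewrite /adj; under eq_bigr do rewrite distrC. Qed.

Lemma even_nb y p : even_site (nb y p) = ~~ even_site y.
Proof.
have e1 : \sum_i unit_step p i = if p.2 then 1 else -1.
  rewrite (bigD1 p.1)//= big1; first by rewrite ffunE eqxx addr0.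
  by move=> j jp; rewrite ffunE (negbTE jp).
have e : \sum_i nb y p i = \sum_i y i + (if p.2 then 1 else -1).
  rewrite -e1 -big_split; apply: eq_bigr => i _; exact: ffunE.
rewrite /even_site e.
by rewrite int_even_succ//; case: p.2; rewrite ?normrN normr1.
Qed.

Lemma even_adj x y : adj x y -> even_site y = ~~ even_site x.
Proof. by move=> /adjP[p ->]; exact: even_nb. Qed.

Variables (R : realType) (V : R -> R) (L : {fset Zd d}).
Hypothesis Veven : forall t : R, V (- t) = V t.
Hypothesis FL : Fstar L.

Definition odd_sites := [seq y <- enum_fset L | ~~ even_site y].
Definition even_sites := [seq y <- enum_fset L | even_site y].

Lemma mem_odd_sites y : (y \in odd_sites) = (y \in L) && ~~ even_site y.
Proof. by rewrite mem_filter andbC. Qed.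

Lemma mem_even_sites y : (y \in even_sites) = (y \in L) && even_site y.
Proof. by rewrite mem_filter andbC. Qed.

Lemma perm_sites : perm_eq (enum_fset L) (even_sites ++ odd_sites).
Proof. by rewrite perm_sym; exact/permPl/perm_filterC. Qed.

(** An even endpoint in the domain forces its neighbours into the domain. *)
Lemma odd_endpoint x y : edge_meets L x y -> ~~ even_site x -> x \in L.
Proof.
case/andP => xy /orP[//|yL] xo; apply: (FL yL); last by rewrite adjC.
by rewrite (even_adj xy) xo.
Qed.

(** The oriented edges meeting L are the pairs (y, nb y p) and (nb y p, y) with y an odd
site of L; since V is even the two families contribute equally, which cancels the
factor 1/2. *)
Lemma energy_odd (phi : Zd d -> R) :
  energy V L phi = \sum_(y <- odd_sites) \sum_p V (phi y - phi (nb y p)).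
Proof.
pose P : seq ('I_d * bool) := index_enum ('I_d * bool)%type.
pose r1 := [seq (y, nb y p) | y <- odd_sites, p <- P].
pose r2 := [seq (nb y p, y) | y <- odd_sites, p <- P].
have u0 : uniq odd_sites by apply: filter_uniq; exact: fset_uniq.
have uP : uniq P by exact: index_enum_uniq.
have u1 : uniq r1.
  apply: allpairs_uniq => // -[y p] [y' p'] _ _ /= [<- e]; congr (_, _).
  by apply: (@nb_inj y); exact: e.
have u2 : uniq r2.
  apply: allpairs_uniq => // -[y p] [y' p'] _ _ /= [e ye].
  by move: e; rewrite -ye => /nb_inj ->.
have m1 e : e \in r1 -> ~~ even_site e.1.
  by case/allpairsP => -[y p] [/= ys _ ->]; move: ys; rewrite mem_odd_sites => /andP[].
have m2 e : e \in r2 -> even_site e.1.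
  case/allpairsP => -[y p] [/= ys _ ->]; move: ys; rewrite mem_odd_sites => /andP[_].
  by rewrite even_nb.
have u12 : uniq (r1 ++ r2).
  rewrite cat_uniq u1 u2 andbT/=; apply/hasPn => e /m2 e2; apply/negP => /m1.
  by rewrite e2.
have E : [set e : Zd d * Zd d | edge_meets L e.1 e.2] = [set` (r1 ++ r2)].
  apply/seteqP; split => -[x y] /=.
    move=> exy; have /andP[xy _] := exy; rewrite mem_cat.
    have [xe|xo] := boolP (even_site x).
      apply/orP; right.
      have yo : ~~ even_site y by rewrite (even_adj xy) xe.
      have yL : y \in L.
        by apply: (@odd_endpoint y x) => //; rewrite /edge_meets adjC orbC.
      have /adjP[p xp] : adj y x by rewrite adjC.
      apply/allpairsP; exists (y, p); split=> /=; rewrite ?xp//.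
        by rewrite mem_odd_sites yL.
      exact: mem_index_enum.
    apply/orP; left; have xL := odd_endpoint exy xo.
    have /adjP[p yp] := xy.
    apply/allpairsP; exists (x, p); split=> /=; rewrite ?yp//.
      by rewrite mem_odd_sites xL.
    exact: mem_index_enum.
  rewrite mem_cat => /orP[] /allpairsP[[z p] [/= zs _ [-> ->]]];
    move: zs; rewrite mem_odd_sites => /andP[zL _]; rewrite /edge_meets zL ?orbT andbT.
    exact: adj_nb.
  by rewrite adjC adj_nb.
rewrite /energy E -fsbig_seq// big_cat/= !big_allpairs_dep/=.
have -> : \sum_(y <- odd_sites) \sum_(p <- P) V (phi (nb y p) - phi y) =
          \sum_(y <- odd_sites) \sum_(p <- P) V (phi y - phi (nb y p)).
  by apply: eq_bigr => y _; apply: eq_bigr => p _; rewrite -Veven opprB.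
by move: (\sum_(y <- odd_sites) _) => s; field.
Qed.

End lattice.

(** * Exponential moments of sums of spins *)

Section exponential_moment.
Context {R : realType} {d : nat}.
Variables (V : R -> R) (beta kap : R) (L : {fset Zd d}).
Local Notation P := ('I_d * bool)%type.
Local Notation N := (#|{: P}|%:R : R).
Hypothesis Veven : forall t : R, V (- t) = V t.
Hypothesis FL : Fstar L.
Hypothesis cV : continuous V.
Hypothesis kap0 : 0 < kap.

Definition site_mean (f : P -> R) := (\sum_p f p) / N.

Hypothesis star : forall a b : P -> R, exists Ja Jb Jm : R,
  [/\ 0 < Ja, 0 < Jb, 0 < Jm,
    [/\ site_integral V beta a = Ja%:E, site_integral V beta b = Jb%:E
      & site_integral V beta (fun i => (a i + b i) / 2) = Jm%:E]
    & Ja * Jb <= expR (- (kap * \sum_i (a i - b i - site_mean (fun i => a i - b i)) ^+ 2))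
        * Jm ^+ 2].

Variables (S : seq (Zd d)) (B : R).
Hypothesis B0 : 0 <= B.
Hypothesis Seven : forall x, x \in S -> even_site x.
Hypothesis energy_bound : forall dlt : Zd d -> R, (forall x, x \notin L -> dlt x = 0) ->
  (\sum_(x <- S) dlt x) ^+ 2 <=
    B * \sum_(y <- odd_sites L) \sum_p (dlt (nb y p) - dlt y) ^+ 2.

Local Notation Lo := (odd_sites L).
Local Notation Le := (even_sites L).
Local Notation obs phi := (\sum_(x <- S) phi x).

Definition site_factor (y : Zd d) (phi : Zd d -> R) : R :=
  expR (- (beta * \sum_p V (phi y - phi (nb y p)))).

Definition site_value (y : Zd d) (phi : Zd d -> R) : R :=
  fine (site_integral V beta (fun p => phi (nb y p))).

Lemma site_valueE y phi :
  site_integral V beta (fun p => phi (nb y p)) = (site_value y phi)%:E.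
Proof.
have [Ja [_ [_ [_ _ _ [e _ _] _]]]] := star (fun p => phi (nb y p)) (fun p => phi (nb y p)).
by rewrite /site_value e.
Qed.

Lemma site_value_gt0 y phi : 0 < site_value y phi.
Proof.
have [Ja [_ [_ [J0 _ _ [e _ _] _]]]] := star (fun p => phi (nb y p)) (fun p => phi (nb y p)).
by rewrite /site_value e.
Qed.

Lemma site_value_pair y phi psi : site_value y phi * site_value y psi <=
  expR (- (kap * \sum_p (phi (nb y p) - psi (nb y p) -
      site_mean (fun p => phi (nb y p) - psi (nb y p))) ^+ 2))
  * site_value y (mid phi psi) ^+ 2.
Proof.
have [Ja [Jb [Jm [_ _ _ [ea eb em] h]]]] := star (fun p => phi (nb y p)) (fun p => psi (nb y p)).
by rewrite /site_value ea eb em.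
Qed.

Lemma measurable_obs (T : seq (Zd d)) :
  measurable_fun [set: Omega R d] (fun phi : Omega R d => \sum_(x <- T) phi x : R).
Proof.
elim: T => [|x T IH].
  by under eq_fun do rewrite big_nil; exact: measurable_cst.
under eq_fun do rewrite big_cons.
by apply: measurable_realfun.measurable_funD => //; exact: measurable_coord.
Qed.

Lemma measurable_site_factor y : cfg_measurable (EFin \o site_factor y).
Proof.
apply/measurable_EFinP; apply: measurableT_comp; first exact: measurable_expR.
apply: measurableT_comp; first exact: oppr_measurable.
apply: measurable_funM => //.
elim: (index_enum _) => [|p r IH].
  by under eq_fun do rewrite big_nil; exact: measurable_cst.
under eq_fun do rewrite big_cons.
apply: measurable_realfun.measurable_funD => //.
apply: measurableT_comp; first exact: continuous_measurable_fun.
by apply: measurable_realfun.measurable_funB; exact: measurable_coord.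
Qed.

Lemma gibbs_factor phi :
  expR (- (beta * energy V L phi)) = \prod_(y <- Lo) site_factor y phi.
Proof.
rewrite (energy_odd Veven FL) -expR_sum; congr expR.
by rewrite mulr_sumr -sumrN.
Qed.

Lemma nb_notin_odd y p : y \in Lo -> nb y p \notin Lo.
Proof.
by rewrite !mem_odd_sites => /andP[_ yo]; rewrite even_nb yo andbF.
Qed.

(** The odd sites are pairwise non-adjacent, so that their integrals decouple. *)
Lemma integrate_odd (F : (Zd d -> R) -> R) phi : (forall psi, 0 <= F psi) ->
  measurable_fun [set: Omega R d] (F : Omega R d -> R) ->
  (forall psi psi', agree_off Lo psi psi' -> F psi = F psi') ->
  leb_int Lo (fun psi => (F psi * expR (- (beta * energy V L psi)))%:E) phi =
    (F phi * \prod_(y <- Lo) site_value y phi)%:E.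
Proof.
move=> F0 mF Fo.
under leb_int_ext => psi do rewrite gibbs_factor.
rewrite leb_int_prod//.
- rewrite EFinM; congr (_ * _)%E; rewrite -prodEFin; apply: eq_bigr => y _.
  rewrite -site_valueE; apply: eq_integral => t _; congr (EFin (expR (- (_ * _)))).
  apply: eq_bigr => p _; rewrite /upd eqxx; case: eqP => // e.
  by have := even_nb y p; rewrite e; case: even_site.
- by apply: filter_uniq; exact: fset_uniq.
- by move=> y psi; exact: expR_ge0.
- exact: measurable_site_factor.
- exact/measurable_EFinP.
- move=> y psi psi' yL yy ag; congr (expR (- (_ * _))); apply: eq_bigr => p _.
  by rewrite yy (ag (nb y p))// nb_notin_odd.
Qed.

Lemma odd_disjoint x : x \in S -> x \notin Lo.
Proof. by move=> /Seven xe; rewrite mem_odd_sites xe andbF. Qed.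

Definition partition_with (c : R) : \bar R :=
  leb_int (enum_fset L) (fun psi =>
    (expR (c * obs psi) * expR (- (beta * energy V L psi)))%:E) (fun=> 0).

Lemma measurable_weight c : measurable_fun [set: Omega R d]
  (fun psi : Omega R d => expR (c * obs psi) : R).
Proof.
apply: measurableT_comp; first exact: measurable_expR.
by apply: measurable_funM => //; exact: measurable_obs.
Qed.

Lemma measurable_gibbs : measurable_fun [set: Omega R d]
  (fun psi : Omega R d => expR (- (beta * energy V L psi)) : R).
Proof.
under eq_fun do rewrite gibbs_factor.
elim: Lo => [|y r IH].
  by under eq_fun do rewrite big_nil; exact: measurable_cst.
under eq_fun do rewrite big_cons.
by apply: measurable_funM => //; have /measurable_EFinP := measurable_site_factor y.
Qed.

Lemma measurable_total c : cfg_measurable (fun psi =>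
    (expR (c * obs psi) * expR (- (beta * energy V L psi)))%:E).
Proof.
apply/measurable_EFinP; apply: measurable_funM; first exact: measurable_weight.
exact: measurable_gibbs.
Qed.

Let total0 c psi : (0 <= (expR (c * obs psi) * expR (- (beta * energy V L psi)))%:E)%E.
Proof. by rewrite lee_fin mulr_ge0 ?expR_ge0. Qed.

Definition reduced (c : R) (psi : Zd d -> R) : \bar R :=
  (expR (c * obs psi) * \prod_(y <- Lo) site_value y psi)%:E.

Lemma reducedE c : reduced c = leb_int Lo (fun psi =>
    (expR (c * obs psi) * expR (- (beta * energy V L psi)))%:E).
Proof.
apply/funext => phi; rewrite integrate_odd//.
- exact: measurable_weight.
- move=> psi psi' ag; congr (expR (_ * _)); apply: eq_big_seq => x xS.
  exact/ag/odd_disjoint.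
Qed.

Lemma partition_reduced c : partition_with c = leb_int Le (reduced c) (fun=> 0).
Proof.
rewrite /partition_with (leb_int_perm _ (total0 c) (measurable_total c) (perm_sites L)).
by rewrite leb_int_cat reducedE.
Qed.

Lemma partition_opp c : partition_with (- c) = partition_with c.
Proof.
have e := leb_int_opp (enum_fset L) (fun=> 0) (total0 c) (measurable_total c).
have e0 : (fun x : Zd d => - (0 : R)) = (fun=> 0) by apply/funext => x; rewrite oppr0.
rewrite e0 in e; rewrite [RHS]/partition_with -e /partition_with.
apply: leb_int_ext => psi; congr ((expR _ * expR (- (_ * _)))%:E).
  by rewrite sumrN mulrN mulNr.
rewrite !(energy_odd Veven FL); apply: eq_bigr => y _; apply: eq_bigr => p _.
by rewrite -opprD Veven.
Qed.

(** The hypothesis of Prekopa-Leindler for the weights of the even spins. The gain of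
[site_value_pair] is the Dirichlet energy of the difference phi - psi, extended to odd
sites by the mean over neighbours; the loss is the exponential of the sum of
phi - psi over S, whose square is at most B times this energy. The
arithmetic-geometric inequality compares the two. *)
Lemma reduced_pair phi psi : agree_off Le phi (fun=> 0) -> agree_off Le psi (fun=> 0) ->
  (reduced 1 phi * reduced (-1) psi <=
    (expR (B / (8 * kap)))%:E * reduced 0 (mid phi psi) *
    ((expR (B / (8 * kap)))%:E * reduced 0 (mid phi psi)))%E.
Proof.
move=> aphi apsi; rewrite /reduced -!EFinM lee_fin.
pose av y := site_mean (fun p => phi (nb y p) - psi (nb y p)).
(* at odd sites, the value that minimizes the energy given the even ones *)
pose dlt x := if even_site x then phi x - psi x else if x \in L then av x else 0.
pose Dy y := \sum_p (phi (nb y p) - psi (nb y p) - av y) ^+ 2.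
pose D := \sum_(y <- Lo) Dy y.
have EB : (\sum_(x <- S) (phi x - psi x)) ^+ 2 <= B * D.
  have := energy_bound (dlt := dlt).
  have -> : \sum_(x <- S) dlt x = \sum_(x <- S) (phi x - psi x).
    by apply: eq_big_seq => x xS; rewrite /dlt Seven.
  have -> : \sum_(y <- Lo) \sum_p (dlt (nb y p) - dlt y) ^+ 2 = D.
    apply: eq_big_seq => y; rewrite mem_odd_sites => /andP[yL yo].
    by apply: eq_bigr => p _; rewrite /dlt even_nb yo (negbTE yo) yL.
  apply => x xL; rewrite /dlt (negbTE xL); case: ifP => // _.
  by rewrite aphi ?apsi ?subrr// mem_even_sites (negbTE xL).
have prod_le : (\prod_(y <- Lo) site_value y phi) * (\prod_(y <- Lo) site_value y psi) <=
   expR (- (kap * D)) * (\prod_(y <- Lo) site_value y (mid phi psi)) ^+ 2.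
  rewrite -big_split/= /D mulr_sumr -sumrN expR_sum -prodrXl -big_split/=.
  apply: ler_prod => y _; rewrite mulr_ge0 ?(ltW (site_value_gt0 _ _))//=.
  exact: site_value_pair.
have D0 : 0 <= D by apply: sumr_ge0 => y _; apply: sumr_ge0 => p _; exact: sqr_ge0.
have Y0 : 0 <= (\prod_(y <- Lo) site_value y (mid phi psi)) ^+ 2 by exact: sqr_ge0.
rewrite mul0r expR0 mul1r mul1r mulN1r.
rewrite [X in X <= _]mulrACA -expRD [X in _ <= X]mulrACA -expRD -expr2.
apply: le_trans (_ : expR (obs phi + - obs psi) * (expR (- (kap * D)) *
   (\prod_(y <- Lo) site_value y (mid phi psi)) ^+ 2) <= _).
  by rewrite ler_wpM2l ?expR_ge0.
rewrite mulrA ler_wpM2r// -expRD ler_expR.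
rewrite -sumrB; clear prod_le; clearbody D; move: EB D0; move: (\sum_(x <- S) (phi x - psi x)) D => s D EB D0.
have k0 := kap0.
have -> : B / (8 * kap) + B / (8 * kap) = B / (4 * kap) by field; rewrite gt_eqF.
have q : (s ^+ 2 <= (B / (4 * kap) + kap * D) ^+ 2).
  apply: le_trans EB _.
  have -> : B * D = 4 * (B / (4 * kap)) * (kap * D) by field; rewrite gt_eqF.
  by have := sqr_ge0 (B / (4 * kap) - kap * D); lra.
have X0 : 0 <= B / (4 * kap) + kap * D.
  by apply: addr_ge0; [rewrite divr_ge0 ?B0// mulr_ge0// ltW|rewrite mulr_ge0// ltW].
suff : s <= B / (4 * kap) + kap * D by lra.
rewrite leNgt; apply/negP => sX; move: q; apply/negP; rewrite -ltNge.
by rewrite ltr_pXn2r ?nnegrE// (le_trans X0 (ltW sX)).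
Qed.

(** By symmetry under a global change of sign the tilts 1 and -1 give the same
partition function, so that the product in Prekopa-Leindler is a square. *)
Lemma partition_exponential (Z : R) : partition_with 0 = Z%:E -> 0 < Z ->
  (partition_with 1 <= (expR (B / (8 * kap)) * Z)%:E)%E.
Proof.
move=> Z0 Zpos.
have r0 c psi : (0 <= reduced c psi)%E by rewrite reducedE; exact: leb_int_ge0.
have mr c : cfg_measurable (reduced c).
  by rewrite reducedE; apply: measurable_leb_int; [exact: total0|exact: measurable_total].
have e0 : (0 <= expR (B / (8 * kap)))%R by exact: expR_ge0.
have m0 : measurable_fun [set: Omega R d] (reduced 0 : Omega R d -> \bar R) := mr 0.
have mM : measurable_fun [set: Omega R d]
    (fun psi : Omega R d => (expR (B / (8 * kap)))%:E * reduced 0 psi)%E.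
  by apply: emeasurable_funM => //; exact: measurable_cst.
have := @prekopa_leindler_cfg R d Le (reduced 1) (reduced (- 1))
  (fun psi => (expR (B / (8 * kap)))%:E * reduced 0 psi)%E (fun=> 0) (fun=> 0).
have -> : mid (fun=> 0 : R) (fun=> 0) = (fun=> 0) :> (Zd d -> R).
  by apply/funext => x; rewrite /mid addr0 mul0r.
rewrite leb_intZl// -!partition_reduced partition_opp Z0 => H.
have : (partition_with 1 * partition_with 1 <=
   (expR (B / (8 * kap)) * Z)%:E * (expR (B / (8 * kap)) * Z)%:E)%E.
  rewrite [(_ * Z)%:E]EFinM; apply: H => //.
    by move=> psi; apply: mule_ge0; [rewrite lee_fin|exact: r0].
  by move=> phi psi a b; exact: reduced_pair.
have : (0 <= partition_with 1)%E by apply: leb_int_ge0 => psi; exact: total0.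
case: (partition_with 1) => [z| |]//.
  rewrite -EFinM !lee_fin => z0 h.
  rewrite leNgt; apply/negP => lt; move: h; apply/negP; rewrite -ltNge.
  by apply: ltr_pM => //; rewrite mulr_ge0// ltW.
Qed.

(** Chernoff's bound. *)
Lemma gibbs_tail (mu : probability (Omega R d) R) (h : R) : is_gibbs0 V beta L mu ->
  (mu [set phi : Omega R d | (h <= obs phi)%R] <= (expR (B / (8 * kap) - h))%:E)%E.
Proof.
move=> [Z Zpos muE]; pose A := [set phi : Omega R d | h <= obs phi].
have mA : measurable A.
  have := measurable_obs S measurableT (@measurable_itv R (Interval (BLeft h) (BInfty _ false))).
  rewrite setTI; congr measurable; apply/seteqP; split=> phi /=;
    by rewrite in_itv/= andbT.
have ZV : (Z%:E * (Z^-1)%:E = 1)%E by rewrite -EFinM divff// gt_eqF.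
have Z0 : partition_with 0 = Z%:E.
  have := muE setT measurableT; rewrite probability_setT => e.
  rewrite -[RHS]mule1 e muleA ZV mul1e; apply: leb_int_ext => psi.
  by rewrite indicT mul0r expR0.
rewrite -/A muE//.
have mI : measurable_fun [set: Omega R d] (\1_A : Omega R d -> R).
  exact: measurable_indic.
have le1 : (leb_int L (fun phi => (\1_A phi * expR (- (beta * energy V L phi)))%:E) (fun=> 0%R)
    <= (expR (- h))%:E * partition_with 1)%E.
  rewrite -leb_intZl ?expR_ge0//; last exact: measurable_total.
  apply: leb_int_le => [psi|||psi].
  - by rewrite lee_fin mulr_ge0 ?expR_ge0// indicE.
  - apply/measurable_EFinP; apply: measurable_funM; first exact: mI.
    exact: measurable_gibbs.
  - apply: emeasurable_funM; first exact: measurable_cst.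
    exact: measurable_total.
  rewrite -EFinM lee_fin [X in _ <= X]mulrA ler_wpM2r ?expR_ge0// indicE -expRD.
  have [|_] := boolP (psi \in A); last exact: expR_ge0.
  rewrite inE /A/= => hs.
  apply: le_trans (expR_ge1Dx _); rewrite lerDl mul1r addrC subr_ge0; exact: hs.
apply: (@le_trans _ _ ((Z^-1)%:E * ((expR (- h))%:E * (expR (B / (8 * kap)) * Z)%:E))%E).
  rewrite lee_wpmul2l ?lee_fin ?invr_ge0 ?(ltW Zpos)//.
  apply: le_trans le1 _; rewrite lee_wpmul2l ?lee_fin ?expR_ge0//.
  exact: partition_exponential.
rewrite -!EFinM lee_fin expRD.
by rewrite le_eqVlt; apply/orP; left; apply/eqP; field; rewrite gt_eqF.
Qed.

End exponential_moment.

(** * Averages over boxes of doubling sizes *)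

Section averaging_boxes.
Context {R : realType} {d : nat}.
Hypothesis d_ge3 : (3 <= d)%N.
Implicit Types (x u v w b : Zd d) (f : Zd d -> R) (S : seq (Zd d)).

Definition axis_step (i : 'I_d) (n : nat) : Zd d := [ffun j => if j == i then n%:Z else 0].

(** Three directions taken in turn: three dimensions already make the sums over scales
converge. *)
Definition box_dir (m : nat) : 'I_d := widen_ord d_ge3 (inord (m %% 3)).

Definition box_shift (m : nat) : Zd d := axis_step (box_dir m) (2 ^ (m %/ 3)).

(** A box with at most 2^ceil(m / 3) points along each of three axes, as a list of
displacements; each step doubles it along one of them. *)
Fixpoint box (m : nat) : seq (Zd d) :=
  if m is m'.+1 then box m' ++ [seq b + box_shift m' | b <- box m'] else [:: 0].

Definition box_avg (m : nat) f x : R := (2 ^+ m)^-1 * \sum_(b <- box m) f (x + b).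

Lemma box_avg0 f x : box_avg 0 f x = f x.
Proof. by rewrite /box_avg /= big_seq1 expr0 invr1 mul1r addr0. Qed.

Lemma box_avgS m f x :
  box_avg m.+1 f x = (box_avg m f x + box_avg m f (x + box_shift m)) / 2.
Proof.
rewrite /box_avg /= big_cat big_map -mulrDr exprSr invfM mulrAC; congr (_ * (_ + _) / _).
by apply: eq_bigr => b _; rewrite addrA addrAC.
Qed.

Lemma val_box_dir m : box_dir m = (m %% 3)%N :> nat.
Proof. by rewrite /= inordK// ltn_mod. Qed.

Lemma mem_box m b : b \in box m -> forall j : 'I_d,
  0 <= b j < (2 ^ ((m + 2 - j) %/ 3))%N%:Z.
Proof.
elim: m b => [|m IH] b /=.
  rewrite inE => /eqP -> j; rewrite ffunE lexx/=.
  by rewrite ltz_nat expn_gt0.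
have mono (j : 'I_d) : ((2 ^ ((m + 2 - j) %/ 3)) <= (2 ^ ((m.+1 + 2 - j) %/ 3)))%N.
  by rewrite leq_exp2l// leq_div2r//; lia.
rewrite mem_cat => /orP[/IH h j|/mapP[b' /IH h ->] j].
  have /andP[-> lt] := h j; apply: (lt_le_trans lt).
  by rewrite lez_nat mono.
have := h j; rewrite /box_shift !ffunE.
have [->|_] := eqVneq j; last first.
  by rewrite addr0 => /andP[-> lt]; apply: (lt_le_trans lt); rewrite lez_nat mono.
rewrite val_box_dir.
have -> : ((m + 2 - m %% 3) %/ 3 = m %/ 3)%N by lia.
have -> : ((m.+1 + 2 - m %% 3) %/ 3 = (m %/ 3).+1)%N by lia.
by rewrite expnS; move: (2 ^ _)%N (b' _) => q z; lia.
Qed.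

Lemma box_uniq m : uniq (box m).
Proof.
elim: m => //= m IH; rewrite cat_uniq map_inj_uniq/=; last exact: addIr.
rewrite IH andbT; apply/hasPn => _ /mapP[b bm ->]; apply/negP => /= b'm.
have := mem_box b'm (box_dir m); have := mem_box bm (box_dir m).
rewrite val_box_dir !ffunE eqxx.
have -> : ((m + 2 - m %% 3) %/ 3 = m %/ 3)%N by lia.
move: (2 ^ _)%N (b _) => q z; lia.
Qed.

Lemma box_avg_jensen m f x : box_avg m f x ^+ 2 <= box_avg m (fun u => f u ^+ 2) x.
Proof.
elim: m x => [|m IH] x; first by rewrite !box_avg0.
rewrite !box_avgS; have := IH x; have := IH (x + box_shift m).
move: (box_avg m f x) (box_avg m f _) => a b; move: (box_avg m _ _) (box_avg m _ _) => B A.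
by have := sqr_ge0 (a - b); nra.
Qed.

Lemma sum_undup_le (T : eqType) (l : seq T) (F : T -> R) (N : nat) :
  (forall t, 0 <= F t) -> (forall t, (count_mem t l <= N)%N) ->
  \sum_(t <- l) F t <= N%:R * \sum_(t <- undup l) F t.
Proof.
move=> F0 cN; rewrite -big_undup_iterop_count mulr_sumr; apply: ler_sum => t _.
rewrite -[X in X <= _]/(F t *+ _) -[X in X <= _]mulr_natl ler_wpM2r//.
by rewrite ler_nat.
Qed.

Lemma count_translates S v w m :
  count_mem w [seq x + v + b | x <- S, b <- box m] =
  count (fun x => w - v - x \in box m) S.
Proof.
elim: S => //= x S IH; rewrite count_cat -/(allpairs_dep _ _ _) IH; congr (_ + _)%N.
rewrite count_map -(count_uniq_mem _ (box_uniq m)); apply: eq_count => b /=.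
apply/eqP/eqP => [<-|->]; first by rewrite [x + v + b]addrC addrA !addrK.
by rewrite -[w - v - x]addrA -opprD [v + x]addrC subrKC.
Qed.

(** Every site is counted at most N times, N bounding the number of points of S whose
translated box contains it. *)
Lemma box_avg_sum S (G : Zd d -> R) v m (N : nat) (D : R) : (forall u, 0 <= G u) ->
  (forall W, uniq W -> \sum_(u <- W) G u <= D) ->
  (forall w, (count (fun x => (w - x)%R \in box m) S <= N)%N) ->
  \sum_(x <- S) box_avg m G (x + v) <= (2 ^+ m)^-1 * (N%:R * D).
Proof.
move=> G0 GD SN; rewrite -mulr_sumr ler_wpM2l ?invr_ge0 ?exprn_ge0//.
have -> : \sum_(x <- S) \sum_(b <- box m) G (x + v + b) =
    \sum_(w <- [seq x + v + b | x <- S, b <- box m]) G w by rewrite big_allpairs_dep.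
apply: le_trans (sum_undup_le (N := N) G0 _) _; first by move=> w; rewrite count_translates.
by rewrite ler_wpM2l// GD// undup_uniq.
Qed.

Definition grad (i : 'I_d) f u := f (u + axis_step i 1) - f u.

(** A box average commutes with translations, hence with discrete gradients. *)
Lemma box_avg_grad m i f x M :
  box_avg m f (x + axis_step i M) - box_avg m f x =
  \sum_(t < M) box_avg m (grad i f) (x + axis_step i t).
Proof.
elim: M => [|M IH].
  have -> : axis_step i 0 = 0 by apply/ffunP => j; rewrite !ffunE; case: eqP.
  by rewrite big_ord0 addr0 subrr.
rewrite big_ord_recr/= -IH.
have -> : axis_step i M.+1 = axis_step i M + axis_step i 1.
  by apply/ffunP => j; rewrite !ffunE; case: eqP => // _; lia.
rewrite addrA; move: (x + axis_step i M) => y.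
have -> : box_avg m (grad i f) y = box_avg m f (y + axis_step i 1) - box_avg m f y.
  rewrite /box_avg -mulrBr -sumrB; congr (_ * _); apply: eq_bigr => b _.
  by rewrite /grad addrAC.
ring.
Qed.

(** The difference of two consecutive averages is half the increment of an average along
M = 2^(m / 3) unit steps; Cauchy-Schwarz over the steps, then Jensen inside the boxes,
bounds its square by averages of squared gradients. *)
Lemma box_level S f m (N : nat) (D : R) :
  (forall W, uniq W -> \sum_(u <- W) grad (box_dir m) f u ^+ 2 <= D) ->
  (forall w, (count (fun x => (w - x)%R \in box m) S <= N)%N) ->
  \sum_(x <- S) (box_avg m f x - box_avg m.+1 f x) ^+ 2 <=
    ((2 ^ (m %/ 3))%:R ^+ 2) / 4 * ((2 ^+ m)^-1 * (N%:R * D)).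
Proof.
move=> GD SN; set M := (2 ^ (m %/ 3))%N.
pose G u := grad (box_dir m) f u ^+ 2.
have G0 u : 0 <= G u by exact: sqr_ge0.
apply: (@le_trans _ _ (\sum_(x <- S) M%:R / 4 *
    \sum_(t < M) box_avg m G (x + axis_step (box_dir m) t))).
  apply: ler_sum => x _; rewrite box_avgS.
  have -> : box_avg m f x - (box_avg m f x + box_avg m f (x + box_shift m)) / 2 =
    - ((box_avg m f (x + box_shift m) - box_avg m f x) / 2) by field.
  rewrite sqrrN expr_div_n box_avg_grad -/M.
  apply: (@le_trans _ _ (M%:R / 4 * \sum_(t < M) box_avg m (grad (box_dir m) f)
      (x + axis_step (box_dir m) t) ^+ 2)).
    have := @sum_sqr_le_card R 'I_M
      (fun t => box_avg m (grad (box_dir m) f) (x + axis_step (box_dir m) t)).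
    by rewrite card_ord; lra.
  by rewrite ler_wpM2l//; apply: ler_sum => t _; exact: box_avg_jensen.
rewrite -mulr_sumr exchange_big/=; set Y := _^-1 * _.
have -> : M%:R ^+ 2 / 4 * Y = M%:R / 4 * (M%:R * Y) by field.
rewrite ler_wpM2l//; apply: (@le_trans _ _ (\sum_(t < M) Y)).
  by apply: ler_sum => t _; exact: box_avg_sum.
by rewrite sumr_const card_ord -[X in X <= _]mulr_natl.
Qed.

End averaging_boxes.

(** * Sparse sets *)

Section sparse_sets.
Context {R : realType} {d : nat}.
Hypothesis d_ge3 : (3 <= d)%N.
Implicit Types (x y w : Zd d) (S W : seq (Zd d)) (f : Zd d -> R).

Definition sup_dist x y : nat := \max_i `|x i - y i|%N.

(** The number of points grows at most like the cube root of the diameter. Points are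
selected by a predicate, so that repetitions in the list count. *)
Definition sparse S := forall (P : pred (Zd d)) (j : nat),
  (forall x y, x \in S -> y \in S -> P x -> P y -> ((sup_dist x y).+1 < 8 ^ j)%N) ->
  (count P S <= 2 ^ j)%N.

Lemma sparse_box S m w : sparse S ->
  (count (fun x => (w - x)%R \in box d_ge3 m) S <= 2 ^ ((m %/ 3 + 4) %/ 3))%N.
Proof.
move=> sp; apply: sp => x y _ _ xb yb.
set k := (m %/ 3)%N.
have le i : (`|x i - y i|%N <= (2 ^ k.+1).-1)%N.
  have h : ((2 ^ ((m + 2 - i) %/ 3)) <= 2 ^ k.+1)%N.
    by rewrite leq_exp2l// /k; lia.
  have := mem_box xb i; have := mem_box yb i; rewrite !ffunE.
  move: (2 ^ _)%N (2 ^ _)%N h (w i) (x i) (y i) => p q h a b e; lia.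
have h8 : (2 ^ k.+2 <= 8 ^ ((k + 4) %/ 3))%N.
  by rewrite -[8%N]/(2 ^ 3)%N -expnM leq_exp2l//; lia.
have dx : (sup_dist x y <= (2 ^ k.+1).-1)%N by apply/bigmax_leqP => i _; exact: le.
have p0 : (0 < 2 ^ k)%N by rewrite expn_gt0.
by move: h8 dx; rewrite !expnS; move: (2 ^ k)%N p0 (8 ^ _)%N (sup_dist x y) => p p0 q e; lia.
Qed.

(** Any rate below 2 for the number of overlapping boxes at scale 2^k is enough. The
cube root of 2 is less than 3/2. *)
Lemma overlap_growth k : (2 ^ ((k + 4) %/ 3))%:R <= 4 * (3 / 2) ^+ k :> R.
Proof.
have [n] := ubnP k; elim: n k => // n IH [|[|[|k]]] kn.
- by rewrite expr0; lra.
- by rewrite expr1; lra.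
- by rewrite expr2; lra.
have -> : ((k.+3 + 4) %/ 3 = ((k + 4) %/ 3).+1)%N by lia.
rewrite expnS natrM !exprS.
have := IH k; have : 0 <= (3 / 2) ^+ k :> R by rewrite exprn_ge0//; lra.
move: ((3 / 2) ^+ k) ((2 ^ _)%:R) => a b a0 h.
have : b <= 4 * a by apply: h; lia.
lra.
Qed.

(** With k = m / 3 the squared step length contributes 4^k, the volume of the box 8^-k and
the overlap at most 4 (3/2)^k; the product decays like (3/4)^k, and 3/4 <= (7/8)^2. *)
Lemma box_level_sparse S f m (D : R) : sparse S ->
  (forall i W, uniq W -> \sum_(u <- W) grad i f u ^+ 2 <= D) ->
  (\sum_(x <- S) (box_avg d_ge3 m f x - box_avg d_ge3 m.+1 f x)) ^+ 2 <=
     (size S)%:R * D * ((7 / 8) ^+ (m %/ 3)) ^+ 2.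
Proof.
move=> sp GD; set k := (m %/ 3)%N.
have D0 : 0 <= D.
  by have := GD (box_dir d_ge3 0) [::] isT; rewrite big_nil.
have := @cauchy_schwarz_sum R _ S (fun=> 1) (fun x => box_avg d_ge3 m f x - box_avg d_ge3 m.+1 f x).
under eq_bigr do rewrite mul1r.
move=> /le_trans; apply.
have -> : \sum_(x <- S) (1 : R) ^+ 2 = (size S)%:R.
  by rewrite expr1n big_const_seq count_predT iter_addr_0.
rewrite -mulrA ler_wpM2l//.
apply: le_trans (box_level (GD _) (fun w => sparse_box m w sp)) _; rewrite -/k.
have p0 : 0 < 2 ^+ k :> R by rewrite exprn_gt0.
have h1 : (2 ^+ m)^-1 <= ((2 ^+ k) ^+ 3)^-1 :> R.
  rewrite lef_pV2 ?posrE ?exprn_gt0// -exprM ler_eXn2l ?ltr1n//.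
  by rewrite /k; lia.
have h2 := overlap_growth k.
have e3 : (3 / 2) ^+ k = 3 ^+ k / 2 ^+ k :> R by rewrite expr_div_n.
have h3 : ((3 / 2) ^+ k / 2 ^+ k) <= ((7 / 8) ^+ k) ^+ 2 :> R.
  rewrite -expr_div_n -exprM mulnC exprM lerXn2r ?nnegrE//; lra.
have N0 : 0 <= (2 ^ ((k + 4) %/ 3))%:R :> R by exact: ler0n.
rewrite natrX; move: h1 h2 h3 p0 N0 {e3}.
move: ((3 / 2) ^+ k) ((2 ^ _)%:R) (((7 / 8) ^+ k) ^+ 2) ((2 ^+ m)^-1) => a N b q.
move: (2 ^+ k) => M h1 h2 h3 M0 N0.
have q1 : M ^+ 2 / 4 * q <= (4 * M)^-1.
  apply: (@le_trans _ _ (M ^+ 2 / 4 * (M ^+ 3)^-1)).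
    by rewrite ler_wpM2l// divr_ge0// sqr_ge0.
  by rewrite le_eqVlt; apply/orP; left; apply/eqP; field; rewrite gt_eqF.
have -> : M ^+ 2 / 4 * (q * (N * D)) = D * (M ^+ 2 / 4 * q * N) by ring.
rewrite ler_wpM2l//; apply: le_trans h3.
apply: (@le_trans _ _ ((4 * M)^-1 * (4 * a))).
  apply: (@le_trans _ _ ((4 * M)^-1 * N)).
    by rewrite ler_wpM2r.
  by rewrite ler_wpM2l// invr_ge0 mulr_ge0// ltW.
by rewrite le_eqVlt; apply/orP; left; apply/eqP; field; rewrite gt_eqF.
Qed.

(** Each exponent is shared by three levels, and 24 = 3 / (1 - 7 / 8). *)
Lemma geometric_levels K :
  \sum_(m < 3 * K) (7 / 8) ^+ (m %/ 3) <= 24 * (1 - (7 / 8) ^+ K) :> R.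
Proof.
elim: K => [|K IH]; first by rewrite big_ord0 expr0 subrr mulr0.
have -> : (3 * K.+1 = (3 * K).+3)%N by lia.
rewrite !big_ord_recr/=.
have -> : (((3 * K) %/ 3) = K)%N by lia.
have -> : (((3 * K).+1 %/ 3) = K)%N by lia.
have -> : (((3 * K).+2 %/ 3) = K)%N by lia.
by move: IH; rewrite exprS; move: (\sum_(m < 3 * K) _) ((7 / 8) ^+ K) => s r; lra.
Qed.

(** The sum of f over S telescopes along box averages. The levels contribute a geometric
series, of total at most 24 sqrt (#S D), and the averages over large boxes vanish
since f is summable. *)
Lemma sparse_energy_bound S f (D M : R) : sparse S ->
  (forall i W, uniq W -> \sum_(u <- W) grad i f u ^+ 2 <= D) ->
  (forall W, uniq W -> \sum_(u <- W) `|f u| <= M) ->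
  (\sum_(x <- S) f x) ^+ 2 <= 576 * (size S)%:R * D.
Proof.
move=> sp GD fM.
have D0 : 0 <= D.
  by have := GD (box_dir d_ge3 0) [::] isT; rewrite big_nil.
have M0 : 0 <= M by have := fM [::] isT; rewrite big_nil.
pose E := (size S)%:R * D.
have E0 : 0 <= E by rewrite mulr_ge0.
pose T m := \sum_(x <- S) (box_avg d_ge3 m f x - box_avg d_ge3 m.+1 f x).
have Tm m : `|T m| <= Num.sqrt E * (7 / 8) ^+ (m %/ 3).
  have r0 : 0 <= (7 / 8 : R) by lra.
  rewrite -(@ler_pXn2r _ 2)// ?nnegrE ?mulr_ge0 ?sqrtr_ge0 ?exprn_ge0//.
  rewrite exprMn sqr_sqrtr// -normrX ger0_norm ?sqr_ge0//.
  exact: box_level_sparse.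
have tele K : \sum_(x <- S) f x = \sum_(m < K) T m + \sum_(x <- S) box_avg d_ge3 K f x.
  elim: K => [|K IH].
    by rewrite big_ord0 add0r; apply: eq_bigr => x _; rewrite box_avg0.
  rewrite big_ord_recr/= IH -addrA /T sumrB subrK //.
have small K x : `|box_avg d_ge3 K f x| <= (2 ^+ K)^-1 * M.
  rewrite /box_avg normrM ger0_norm ?invr_ge0 ?exprn_ge0// ler_wpM2l ?invr_ge0 ?exprn_ge0//.
  apply: le_trans (ler_norm_sum _ _ _) _.
  have := fM [seq x + b | b <- box d_ge3 K]; rewrite big_map; apply.
  by rewrite map_inj_uniq ?box_uniq//; exact: addrI.
have main K : `|\sum_(x <- S) f x| <= 24 * Num.sqrt E + (size S)%:R * M * (2 ^+ (3 * K))^-1.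
  rewrite (tele (3 * K)%N) (le_trans (ler_normD _ _))// lerD//.
    apply: le_trans (ler_norm_sum _ _ _) _.
    apply: (@le_trans _ _ (\sum_(m < 3 * K) Num.sqrt E * (7 / 8) ^+ (m %/ 3))).
      by apply: ler_sum => m _; exact: Tm.
    rewrite -mulr_sumr mulrC ler_wpM2r ?sqrtr_ge0//.
    apply: le_trans (geometric_levels K) _.
    have : 0 <= (7 / 8 : R) ^+ K by rewrite exprn_ge0//; lra.
    by move: (_ ^+ K) => r; lra.
  apply: le_trans (ler_norm_sum _ _ _) _.
  apply: (@le_trans _ _ (\sum_(x <- S) (2 ^+ (3 * K))^-1 * M)).
    by apply: ler_sum => x _; exact: small.
  by rewrite big_const_seq count_predT iter_addr_0 -mulr_natl; move: (_^-1) => q; lra.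
have lim : `|\sum_(x <- S) f x| <= 24 * Num.sqrt E.
  apply/ler_addgt0Pr => e e0.
  pose Q := (size S)%:R * M.
  have Q0 : 0 <= Q by rewrite mulr_ge0.
  have [K] : exists K : nat, Q / e < K%:R.
    by exists (Num.bound (Q / e)); rewrite archi_boundP// divr_ge0// ltW.
  move=> QK; apply: le_trans (main K) _; rewrite lerD2l -/Q.
  rewrite ler_pdivrMr ?exprn_gt0//.
  rewrite ltr_pdivrMr// in QK; apply/ltW/(lt_le_trans QK).
  rewrite mulrC ler_pM2l// -natrX ler_nat.
  apply: (leq_trans (ltnW (ltn_expl K (isT : (1 < 2)%N)))).
  by rewrite leq_exp2l//; lia.
have -> : 576 * (size S)%:R * D = (24 * Num.sqrt E) ^+ 2.
  by rewrite exprMn sqr_sqrtr// /E; ring.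
rewrite -[X in X <= _]ger0_norm ?sqr_ge0// normrX ler_pXn2r// nnegrE.
by rewrite mulr_ge0// sqrtr_ge0.
Qed.

End sparse_sets.

(** * Dirichlet energy of a domain *)

Lemma sum_uniq_le (R : realType) (T : eqType) (W r : seq T) (F : T -> R) :
  uniq W -> uniq r -> (forall t, 0 <= F t) -> (forall t, t \in W -> t \notin r -> F t = 0) ->
  \sum_(t <- W) F t <= \sum_(t <- r) F t.
Proof.
move=> uW ur F0 Wr; rewrite (bigID (mem r))/= [X in _ + X]big_seq_cond.
rewrite [X in _ + X]big1 ?addr0; last by move=> t /andP[]; exact: Wr.
have p : perm_eq [seq t <- W | t \in r] [seq t <- r | t \in W].
  by apply: uniq_perm; rewrite ?filter_uniq// => t; rewrite !mem_filter andbC.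
rewrite -big_filter (perm_big _ p) big_filter [X in _ <= X](bigID (mem W))/= lerDl.
by apply: sumr_ge0 => t _.
Qed.

Section dirichlet_energy.
Context {R : realType} {d : nat}.
Hypothesis d_ge3 : (3 <= d)%N.
Variables (L : {fset Zd d}) (f : Zd d -> R).
Hypothesis FL : Fstar L.
Hypothesis f0 : forall x, x \notin L -> f x = 0.

(** Each unit step in direction i is an edge, determined by its odd endpoint and the
direction taken from there; edges whose odd endpoint is outside the domain carry no
gradient. *)
Lemma sum_grad_le (i : 'I_d) (W : seq (Zd d)) : uniq W ->
  \sum_(u <- W) grad i f u ^+ 2 <=
  \sum_(y <- odd_sites L) \sum_p (f (nb y p) - f y) ^+ 2.
Proof.
move=> uW.
(* the odd endpoint of the edge from u to u + e_i, and the direction from there *)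
pose h (u : Zd d) : Zd d * ('I_d * bool) :=
  if even_site u then (nb u (i, true), (i, false)) else (u, (i, true)).
pose G (e : Zd d * ('I_d * bool)) := (f (nb e.1 e.2) - f e.1) ^+ 2.
have step u : u + axis_step i 1 = nb u (i, true).
  by apply/ffunP => j; rewrite !ffunE.
have Gh u : grad i f u ^+ 2 = G (h u).
  rewrite /grad step /G /h; case: ifP => //= _.
  by rewrite (nbK u i true) -sqrrN opprB.
have hI : injective h.
  move=> u v; rewrite /h; case: ifP => ue; case: ifP => ve // [] //.
  by move=> e; rewrite -(nbK u i true) e nbK.
pose P : seq ('I_d * bool) := index_enum ('I_d * bool)%type.
pose r := [seq (y, p) | y <- odd_sites L, p <- P].
have -> : \sum_(y <- odd_sites L) \sum_p (f (nb y p) - f y) ^+ 2 = \sum_(e <- r) G e.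
  by rewrite /r big_allpairs_dep.
under eq_bigr do rewrite Gh.
have -> : \sum_(u <- W) G (h u) = \sum_(e <- [seq h u | u <- W]) G e by rewrite big_map.
apply: sum_uniq_le.
- by rewrite map_inj_uniq.
- apply: allpairs_uniq; first by apply: filter_uniq; exact: fset_uniq.
    exact: index_enum_uniq.
  by move=> [y p] [y' p'] _ _ [-> ->].
- by move=> e; exact: sqr_ge0.
move=> e /mapP[u _ ->] ur.
have ho : ~~ even_site (h u).1.
  by rewrite /h; case: ifP => /= [ue|->//]; rewrite even_nb ue.
have hL : (h u).1 \notin L.
  apply/negP => hL; move/negP: ur; apply; apply/allpairsP; exists (h u); split.
  - by rewrite mem_odd_sites hL.
  - exact: mem_index_enum.
  - by case: (h u).
rewrite /G f0; last first.
  apply/negP => nL; move/negP: hL; apply; apply: (FL nL); last by rewrite adjC adj_nb.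
  by rewrite even_nb.
by rewrite f0// subrr expr0n.
Qed.

Lemma sum_support_le (W : seq (Zd d)) : uniq W ->
  \sum_(u <- W) `|f u| <= \sum_(u <- enum_fset L) `|f u|.
Proof.
move=> uW; apply: sum_uniq_le => //; first exact: fset_uniq.
by move=> t _ tL; rewrite f0// normr0.
Qed.

(** A bound on the capacity of S proportional to its number of points, uniform in the
domain: this is where the transience of the walk enters. *)
Lemma sparse_dirichlet_bound (S : seq (Zd d)) : sparse S ->
  (\sum_(x <- S) f x) ^+ 2 <= 576 * (size S)%:R *
    \sum_(y <- odd_sites L) \sum_p (f (nb y p) - f y) ^+ 2.
Proof.
move=> sp; apply: (sparse_energy_bound d_ge3 sp (M := \sum_(u <- enum_fset L) `|f u|)).
  by move=> i W; exact: sum_grad_le.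
exact: sum_support_le.
Qed.

End dirichlet_energy.

(** * Sparse trees along lattice paths *)

(** One unit step towards v, as the path of [l1_path] takes it. *)
Lemma int_step_closer (u v : int) : u != v ->
  absz (u - v)%R = (absz (u + (if u < v then 1 else -1) - v)%R).+1.
Proof. by case: (ltP u v) => uv ne; lia. Qed.

Section embedded_trees.
Context {d : nat}.
Implicit Types (x y z : Zd d) (p s : seq (Zd d)).

Lemma sup_dist_le x y r : reflect (forall i, (`|x i - y i| <= r)%N) (sup_dist x y <= r)%N.
Proof.
rewrite /sup_dist; apply: (iffP idP) => [/bigmax_leqP h i|h]; first exact: h.
by apply/bigmax_leqP => i _; exact: h.
Qed.

Lemma le_sup_dist x y i : (`|x i - y i| <= sup_dist x y)%N.
Proof. exact: (@leq_bigmax _ (fun i => `|x i - y i|%N)). Qed.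

Lemma sup_dist_triangle y x z : (sup_dist x z <= sup_dist x y + sup_dist y z)%N.
Proof.
apply/sup_dist_le => i; have := le_sup_dist x y i; have := le_sup_dist y z i.
move: (sup_dist x y) (sup_dist y z) (x i) (y i) (z i) => a b u v w; lia.
Qed.

Lemma sup_distC x y : sup_dist x y = sup_dist y x.
Proof. by apply: eq_bigr => i _; move: (x i) (y i) => u v; lia. Qed.

Lemma sup_distxx x : sup_dist x x = 0%N.
Proof. by apply/eqP; rewrite -leqn0; apply/sup_dist_le => i; rewrite subrr. Qed.

Lemma sup_dist_adj x y : adj x y -> (sup_dist x y <= 1)%N.
Proof.
move=> /adjP[[i b] ->]; apply/sup_dist_le => j; rewrite !ffunE/=.
by case: eqP => _; case: b; move: (x j) => u; lia.
Qed.

Definition ball_sites x (r : nat) : seq (Zd d) :=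
  [seq [ffun j => x j + (f j)%:Z - r%:Z] | f : {ffun 'I_d -> 'I_(2 * r).+1}].

Lemma size_ball x r : size (ball_sites x r) = ((2 * r).+1 ^ d)%N.
Proof. by rewrite size_map -cardE card_ffun !card_ord. Qed.

Lemma mem_ball x y r : (sup_dist x y <= r)%N -> y \in ball_sites x r.
Proof.
move=> /sup_dist_le h; apply/mapP.
exists [ffun j => inord (absz (y j - x j + r%:Z)%R)]; first by rewrite mem_enum.
apply/ffunP => j; rewrite !ffunE inordK; have := h j; move: (x j) (y j) => u v; lia.
Qed.

(** A tree of scale n + 1 at x joins one of scale n at x with one of scale n at an even
point x' at distance 3 8^n, up to 1, from x. The margin of 1 leaves room for the parity
of x'. *)
Fixpoint trees (n : nat) x : seq (seq (Zd d)) :=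
  if n is n'.+1 then
    [seq s1 ++ s2 | s1 <- trees n' x, s2 <- flatten [seq trees n' x' |
       x' <- [seq x' <- ball_sites x (3 * 8 ^ n').+1 |
                even_site x' && (3 * 8 ^ n' <= (sup_dist x x').+1)%N]]]
  else [:: [:: x]].

Lemma treesSP n x s : s \in trees n.+1 x -> exists s1 s2 x',
  [/\ s = s1 ++ s2, s1 \in trees n x, s2 \in trees n x', even_site x' &
    (3 * 8 ^ n <= (sup_dist x x').+1)%N /\ (sup_dist x x' <= (3 * 8 ^ n).+1)%N].
Proof.
case/allpairsP => -[s1 s2] /= [s1x /flatten_mapP[x']].
rewrite mem_filter => /andP[/andP[x'e far] xb] s2x' ->.
exists s1, s2, x'; split=> //; split=> //.
case/mapP: xb => f _ ->; apply/sup_dist_le => j; rewrite !ffunE.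
have := ltn_ord (f j); move: (nat_of_ord (f j)) (x j) => a u; lia.
Qed.

Lemma treesS n x x' s1 s2 : s1 \in trees n x -> s2 \in trees n x' -> even_site x' ->
  (3 * 8 ^ n <= (sup_dist x x').+1)%N -> (sup_dist x x' <= (3 * 8 ^ n).+1)%N ->
  s1 ++ s2 \in trees n.+1 x.
Proof.
move=> s1x s2x' e far near; apply/allpairsP; exists (s1, s2); split=> //=.
apply/flatten_mapP; exists x' => //; rewrite mem_filter e far/=; exact: mem_ball.
Qed.

Lemma size_tree n x s : s \in trees n x -> size s = (2 ^ n)%N.
Proof.
elim: n x s => [|n IH] x s; first by rewrite inE => /eqP ->.
move=> /treesSP[s1 [s2 [x' [-> /IH e1 /IH e2 _ _]]]].
by rewrite size_cat e1 e2 expnS mul2n addnn.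
Qed.

Lemma even_tree n x s : even_site x -> s \in trees n x -> forall z, z \in s -> even_site z.
Proof.
elim: n x s => [|n IH] x s xe; first by rewrite inE => /eqP -> z; rewrite inE => /eqP ->.
move=> /treesSP[s1 [s2 [x' [-> s1x s2x x'e _]]]] z; rewrite mem_cat => /orP[].
  exact: IH s1x z.
exact: IH s2x z.
Qed.

Lemma tree_radius n x s : s \in trees n x -> forall z, z \in s -> (sup_dist x z < 8 ^ n)%N.
Proof.
elim: n x s => [|n IH] x s.
  by rewrite inE => /eqP -> z; rewrite inE => /eqP ->; rewrite sup_distxx.
move=> /treesSP[s1 [s2 [x' [-> s1x s2x x'e [_ near]]]]] z; rewrite mem_cat expnS.
have p0 : (0 < 8 ^ n)%N by rewrite expn_gt0.
case/orP => [/(IH _ _ s1x)|/(IH _ _ s2x)].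
  by move: (8 ^ n)%N (sup_dist x z) p0 => q a p0; lia.
have := sup_dist_triangle x' x z.
by move: (8 ^ n)%N (sup_dist x z) (sup_dist x x') (sup_dist x' z) p0 near => q a b e p0 near; lia.
Qed.

(** The two halves of a tree of scale n + 1 are separated by more than 8^n, so that points
within distance 8^j, with j <= n, belong to one half. *)
Lemma sparse_tree n x s : s \in trees n x -> sparse s.
Proof.
elim: n x s => [|n IH] x s sx P j close.
  move: sx; rewrite inE => /eqP ->; rewrite /= addn0.
  by apply: leq_trans (leq_b1 _) _; rewrite expn_gt0.
have sz := size_tree sx.
case/treesSP: sx => s1 [s2 [x' [e s1x s2x x'e [far _]]]].
have cl1 : forall y z, y \in s1 -> z \in s1 -> P y -> P z -> ((sup_dist y z).+1 < 8 ^ j)%N.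
  by move=> y z y1 z1; apply: close; rewrite e mem_cat ?y1 ?z1.
have cl2 : forall y z, y \in s2 -> z \in s2 -> P y -> P z -> ((sup_dist y z).+1 < 8 ^ j)%N.
  by move=> y z y1 z1; apply: close; rewrite e mem_cat ?y1 ?z1 orbT.
have [/hasP[z1 z1s Pz1]|h1] := boolP (has P s1); last first.
  move: h1; rewrite has_count -leqNgt leqn0 => /eqP h1.
  by rewrite e count_cat h1 add0n; apply: (IH _ _ s2x).
have [/hasP[z2 z2s Pz2]|h2] := boolP (has P s2); last first.
  move: h2; rewrite has_count -leqNgt leqn0 => /eqP h2.
  by rewrite e count_cat h2 addn0; apply: (IH _ _ s1x).
have z12 : ((sup_dist z1 z2).+1 < 8 ^ j)%N.
  by apply: close; rewrite // e mem_cat ?z1s ?z2s ?orbT.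
have nj : (n < j)%N.
  rewrite -(ltn_exp2l _ _ (isT : (1 < 8)%N)); apply: leq_ltn_trans z12.
  have := tree_radius s1x z1s; have := tree_radius s2x z2s.
  have := sup_dist_triangle z1 x x'; have := sup_dist_triangle z2 z1 x'.
  rewrite (sup_distC z2 x'); move: far.
  by move: (8 ^ n)%N (sup_dist _ _) (sup_dist _ _) (sup_dist _ _) (sup_dist _ _) (sup_dist _ _); lia.
by apply: leq_trans (count_size _ _) _; rewrite sz leq_exp2l.
Qed.

Lemma size_flatten_le (T U : eqType) (F : T -> seq U) (l : seq T) (C E : nat) :
  (forall x : T, (C * size (F x) <= E)%N) ->
  (C * size (flatten [seq F x | x : T <- l]) <= size l * E)%N.
Proof.
move=> FE; elim: l => [|x l IH] /=; first by rewrite muln0.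
by rewrite size_cat mulnDr mulSn leq_add.
Qed.

(** The number N_n of trees satisfies N_(n+1) <= (9 8^n)^d N_n^2. The prefactor
9^d 8^(d (n + 1)) turns this into the exact squaring of a bound. *)
Lemma trees_count n x :
  (9 ^ d * (8 ^ d) ^ n.+1 * size (trees n x) <= (72 ^ d) ^ (2 ^ n))%N.
Proof.
elim: n x => [|n IH] x; first by rewrite expn1 muln1 -expnMn expn0 expn1.
pose l := [seq x' <- ball_sites x (3 * 8 ^ n).+1 |
    even_site x' && (3 * 8 ^ n <= (sup_dist x x').+1)%N].
pose f := flatten [seq trees n x' | x' <- l].
have e : size (trees n.+1 x) = (size (trees n x) * size f)%N.
  exact: size_allpairs.
rewrite {}e.
have ball_le : (size l <= 9 ^ d * (8 ^ d) ^ n)%N.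
  rewrite size_filter; apply: leq_trans (count_size _ _) _; rewrite size_ball.
  rewrite expnAC -expnMn; have [->//|d0] := posnP d.
  rewrite leq_exp2r//; have : (0 < 8 ^ n)%N by rewrite expn_gt0.
  by move: (8 ^ n)%N => q; lia.
have := size_flatten_le l IH.
rewrite -/f => /leq_trans /(_ (leq_mul ball_le (leqnn _))).
have C0 : (0 < 9 ^ d * (8 ^ d) ^ n)%N by rewrite muln_gt0 !expn_gt0.
rewrite [((8 ^ d) ^ n.+1)%N]expnSr mulnA -mulnA leq_pmul2l// => fE.
rewrite [((8 ^ d) ^ n.+2)%N]expnSr.
have -> : ((72 ^ d) ^ (2 ^ n.+1) = (72 ^ d) ^ (2 ^ n) * (72 ^ d) ^ (2 ^ n))%N.
  by rewrite expnS mul2n -addnn expnD.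
apply: leq_trans (leq_mul (IH x) fE).
by rewrite leq_eqVlt; apply/orP; left; apply/eqP; ring.
Qed.

(** Distances change by at most 1 along a path. *)
Lemma path_reach r p x y : path (@adj d) y p -> (sup_dist x y <= r)%N ->
  (r <= sup_dist x (last y p))%N ->
  exists p1 p2, p = p1 ++ p2 /\ sup_dist x (last y p1) = r.
Proof.
elim: p y => [|z p IH] y /= pth yr rl.
  by exists [::], [::]; split=> //; apply/eqP; rewrite eqn_leq yr.
have [e|ne] := eqVneq (sup_dist x y) r; first by exists [::], (z :: p).
case/andP: pth => yz pth.
have zr : (sup_dist x z <= r)%N.
  have := sup_dist_triangle y x z; have := sup_dist_adj yz.
  by move: (sup_dist x y) (sup_dist x z) (sup_dist y z) ne yr => a b c; lia.
have [p1 [p2 [-> e]]] := IH z pth zr rl.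
by exists (z :: p1), p2.
Qed.

(** The path passes at distance 3 8^n from x. There, or one step later, it visits an even
point x', from which it still has to travel a distance at least 8^n; both x and x' are
therefore roots of trees of scale n along the path. *)
Lemma path_contains_tree n x p : even_site x -> path (@adj d) x p ->
  (8 ^ n <= sup_dist x (last x p))%N ->
  exists2 s, s \in trees n x & {subset s <= x :: p}.
Proof.
elim: n x p => [|n IH] x p xe pth far.
  by exists [:: x]; rewrite ?mem_head// => z; rewrite inE => /eqP ->; exact: mem_head.
have p0 : (0 < 8 ^ n)%N by rewrite expn_gt0.
rewrite expnS in far.
have [|s1 s1x s1p] := IH x p xe pth.
  by apply: leq_trans far; rewrite leq_pmull.
have [||p1 [p2 [pe re]]] := @path_reach (3 * 8 ^ n) p x x pth.
- by rewrite sup_distxx.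
- by apply: leq_trans far; rewrite leq_mul2r orbT.
set y := last x p1 in re.
have next : exists x' q, [/\ even_site x', path (@adj d) x' q, last x' q = last x p,
    {subset x' :: q <= x :: p} & (3 * 8 ^ n <= (sup_dist x x').+1)%N /\
      (sup_dist x x' <= (3 * 8 ^ n).+1)%N].
  move: pth; rewrite pe cat_path -/y => /andP[_ pth2].
  have [ye|yo] := boolP (even_site y).
    exists y, p2; split=> //; first by rewrite last_cat.
      move=> z; rewrite inE => /orP[/eqP ->|z2].
        have := mem_last x p1; rewrite -/y !inE mem_cat => /orP[->//|->].
        by rewrite orbT.
      by rewrite inE mem_cat z2 !orbT.
    by rewrite re; split; [exact: leqnSn|exact: leqnSn].
  case: p2 pe pth2 => [|y' q] pe /=.
    move=> _; move: far; rewrite pe cats0 -/y re.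
    by move: (8 ^ n)%N p0; lia.
  move=> /andP[yy' q'p]; exists y', q; split=> //.
  - by rewrite (even_adj yy') yo.
  - by rewrite last_cat.
  - by move=> z zq; rewrite inE mem_cat zq !orbT.
  have := sup_dist_triangle y x y'; have := sup_dist_triangle y' x y.
  have := sup_dist_adj yy'; rewrite (sup_distC y' y) re.
  by move: (8 ^ n)%N => a; lia.
have [x' [q [x'e qp ql qs [r1 r2]]]] := next.
have [|s2 s2x s2q] := IH x' q x'e qp.
  rewrite ql; have := sup_dist_triangle x' x (last x p).
  move: far r2 p0.
  by move: (8 ^ n)%N => a; lia.
exists (s1 ++ s2); first exact: (treesS s1x s2x).
by move=> z; rewrite mem_cat => /orP[/s1p//|/s2q/qs].
Qed.

(** Trees are rooted at even points, whereas x may be odd. *)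
Definition rooted_trees n x := flatten [seq trees n x' | x' <- ball_sites x 1 & even_site x'].

Lemma path_contains_rooted_tree n x p : path (@adj d) x p ->
  (8 ^ n < sup_dist x (last x p))%N ->
  exists2 s, s \in rooted_trees n x & {subset s <= x :: p}.
Proof.
move=> pth far.
have [xe|xo] := boolP (even_site x).
  have [s sx sp] := path_contains_tree xe pth (ltnW far).
  exists s => //; apply/flatten_mapP; exists x => //.
  by rewrite mem_filter xe; apply: mem_ball; rewrite sup_distxx.
case: p pth far => [|y p] /=; first by rewrite sup_distxx.
move=> /andP[xy pth] far; have d1 := sup_dist_adj xy.
have ye : even_site y by rewrite (even_adj xy) xo.
have [|s sx sp] := @path_contains_tree n y p ye pth.
  have := sup_dist_triangle y x (last y p).
  by move: far d1; move: (8 ^ n)%N => a; lia.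
exists s; last by move=> z /sp zp; rewrite inE zp orbT.
by apply/flatten_mapP; exists y => //; rewrite mem_filter ye; exact: mem_ball.
Qed.

Lemma l1_path x y : exists p, [/\ path (@adj d) x p, last x p = y &
  size p = \sum_i `|x i - y i|%N]%N.
Proof.
move en : (\sum_i `|x i - y i|%N)%N => n; elim: n x en => [|n IH] x en.
  exists [::]; split=> //=; apply/ffunP => i; move/eqP: en; rewrite sum_nat_eq0 => /forallP/(_ i).
  by rewrite absz_eq0 subr_eq0 => /eqP.
have [i ne] : exists i, x i != y i.
  apply: contrapT => h; move: en; rewrite big1// => i _.
  by apply/eqP; rewrite absz_eq0 subr_eq0; apply/negPn/negP => ne; apply: h; exists i.
pose x' := nb x (i, x i < y i).
have [|p [pp pl ps]] := IH x'.
  have e1 : (\sum_j `|x j - y j| = `|x i - y i| + \sum_(j | j != i) `|x j - y j|)%N.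
    exact: (bigD1 i).
  have e2 : (\sum_j `|x' j - y j| = `|x' i - y i| + \sum_(j | j != i) `|x j - y j|)%N.
    rewrite (bigD1 i)//=; congr (_ + _)%N.
    by apply: eq_bigr => j ji; rewrite !ffunE/= (negbTE ji) addr0.
  have e3 : x' i = x i + (if x i < y i then 1 else -1) by rewrite !ffunE/= eqxx.
  by move: en; rewrite e1 e2 e3 (int_step_closer ne) addSn => -[].
exists (x' :: p); split=> //=; first by rewrite adj_nb.
by rewrite ps.
Qed.

Lemma l1_le_sup x y : (\sum_i `|x i - y i|%N <= d * sup_dist x y)%N.
Proof.
apply: (@leq_trans (\sum_(i < d) sup_dist x y)%N); last by rewrite sum_nat_const card_ord.
by apply: leq_sum => i _; exact: le_sup_dist.
Qed.

End embedded_trees.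

(** * Weak limits and connection events *)

Section weak_limit.
Context {R : realType} {d : nat}.
Local Notation sites := (seq (Zd d)).

Definition large_sum (S : sites) (t : R) : set (Omega R d) :=
  [set phi | t <= \sum_(x <- S) phi x].

Lemma measurable_large_sum S t : measurable (large_sum S t).
Proof.
have := measurable_obs S measurableT (@measurable_itv R (Interval (BLeft t) (BInfty _ false))).
by rewrite setTI; congr measurable; apply/seteqP; split=> phi /=; rewrite in_itv/= andbT.
Qed.

(** A continuous cutoff that separates the half-lines a < 0 and a >= 1. *)
Definition clamp (a : R) : R := Num.min 1 (Num.max 0 a).

Lemma clamp_bounds a : 0 <= clamp a <= 1.
Proof. by rewrite /clamp le_min ler01 le_max lexx/= ge_min lexx. Qed.

Lemma clamp_le (a : R) : a < 0 -> clamp a = 0.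
Proof. by move=> a0; rewrite /clamp max_l ?ltW// min_r. Qed.

Lemma clamp_ge (a : R) : 1 <= a -> clamp a = 1.
Proof. by move=> a1; rewrite /clamp max_r ?min_l//; lra. Qed.

Lemma continuous_clamp : continuous clamp.
Proof.
move=> a; apply: (@continuous_min R R (fun=> 1) (Num.max 0)); first exact: cst_continuous.
by apply: (@continuous_max R R (fun=> 0) id); [exact: cst_continuous|].
Qed.

Lemma continuous_sum_sites (S : sites) :
  continuous (fun phi : {ptws Zd d -> R} => \sum_(x <- S) phi x : R).
Proof.
elim: S => [|x S IH].
  have -> : (fun phi : {ptws Zd d -> R} => \sum_(z <- [::]) phi z) = (fun=> 0 : R).
    by apply/funext => phi; rewrite big_nil.
  by move=> phi; exact: cst_continuous.
have -> : (fun phi : {ptws Zd d -> R} => \sum_(z <- x :: S) phi z) =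
    (fun phi => phi x + \sum_(z <- S) phi z).
  by apply/funext => phi; rewrite big_cons.
by move=> phi; apply: continuousD; [exact: proj_continuous|exact: IH].
Qed.

(** The indicator of a large sum is not continuous; the cutoff loses 1 in the level. *)
Lemma weak_limit_tail (mu_ : nat -> probability (Omega R d) R)
    (mu : probability (Omega R d) R) (S : sites) (t e : R) : weak_cvg mu_ mu ->
  (forall n, (mu_ n (large_sum S t) <= e%:E)%E) -> (mu (large_sum S (t + 1)) <= e%:E)%E.
Proof.
move=> w tails.
pose f (phi : Zd d -> R) := clamp (\sum_(x <- S) phi x - t).
have cf : continuous (f : {ptws Zd d -> R} -> R).
  move=> phi; apply: (@continuous_comp _ _ _
    (fun phi : {ptws Zd d -> R} => \sum_(x <- S) phi x - t) clamp).
    by apply: continuousB; [exact: continuous_sum_sites|exact: cst_continuous].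
  exact: continuous_clamp.
have f01 phi : 0 <= f phi <= 1 by exact: clamp_bounds.
have mf : measurable_fun [set: Omega R d] (fun phi : Omega R d => (f phi)%:E).
  apply/measurable_EFinP.
  apply: (@measurableT_comp _ _ _ _ (measurableTypeR R) _ clamp).
    by apply: continuous_measurable_fun; exact: continuous_clamp.
  by apply: measurable_realfun.measurable_funB => //; exact: measurable_obs.
have bf : exists M, forall phi, `|f phi| <= M.
  by exists 1 => phi; have /andP[f0 f1] := f01 phi; rewrite ger0_norm.
have lim := w f cf bf.
have indE (nu : probability (Omega R d) R) s :
    nu (large_sum S s) = (\int[nu]_phi (\1_(large_sum S s) phi)%:E)%E.
  by rewrite integral_indic ?setIT//; exact: measurable_large_sum.
have mI s : measurable_fun [set: Omega R d] (fun phi => (\1_(large_sum S s) phi : R)%:E).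
  by apply/measurable_EFinP/measurable_indic; exact: measurable_large_sum.
apply: (@le_trans _ _ (\int[mu]_phi (f phi)%:E)%E).
  rewrite indE; apply: ge0_le_integral => //.
  move=> phi _; rewrite lee_fin indicE; case/andP: (f01 phi) => f0 _.
  have [|//] := boolP (phi \in _); rewrite inE /large_sum/= => h.
  by rewrite /f clamp_ge//; lra.
rewrite -(cvg_lim _ lim)//; apply: lime_le; first exact: cvgP lim.
apply: nearW => n; apply: le_trans (tails n); rewrite indE; apply: ge0_le_integral => //.
- by move=> phi _; rewrite lee_fin; case/andP: (f01 phi).
move=> phi _; rewrite lee_fin indicE; case/andP: (f01 phi) => _ f1.
have [//|] := boolP (phi \in _); rewrite notin_setE /large_sum/= => /negP h.
by rewrite /f clamp_le// subr_lt0 ltNge.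
Qed.

(** There are countably many finite paths. *)
Lemma measurable_connect (h : R) (x y : Zd d) :
  measurable (connect_ge h x y : set (Omega R d)).
Proof.
have mh (z : Zd d) : measurable ([set phi | h <= phi z] : set (Omega R d)).
  have := measurable_large_sum [:: z] h; congr measurable.
  by apply/seteqP; split=> phi; rewrite /large_sum /= big_seq1.
have mp (p : sites) : measurable ([set phi | forall z, z \in p -> h <= phi z] : set (Omega R d)).
  elim: p => [|z p IH].
    by have := @measurableT _ (Omega R d); congr measurable; apply/seteqP; split.
  have := measurableI _ _ (mh z) IH; congr measurable; apply/seteqP; split=> phi /=.
    by move=> [hz hp] z'; rewrite inE => /orP[/eqP ->//|/hp].
  by move=> H; split; [exact/H/mem_head|move=> z' z'p; apply: H; rewrite inE z'p orbT].
have -> : connect_ge h x y = \bigcup_(p in [set: sites])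
    (if path (@adj d) x p && (last x p == y) then
       [set phi : Omega R d | forall z, z \in x :: p -> h <= phi z] else set0).
  apply/seteqP; split=> phi /=.
    by move=> [p [pp pl hp]]; exists p => //; rewrite pp pl eqxx.
  by move=> [p _]; case: ifP => // /andP[pp /eqP pl] hp; exists p.
apply: countable_bigcupT_measurable => [|p]; first exact: countableP.
by case: ifP => // _; exact: measurable0.
Qed.

Lemma union_bound (mu : probability (Omega R d) R) (T : eqType) (l : seq T)
    (F : T -> set (Omega R d)) (e : R) (E : set (Omega R d)) :
  measurable E -> (forall t, measurable (F t)) ->
  (forall s, s \in l -> (mu (F s) <= e%:E)%E) ->
  (forall phi, E phi -> exists2 s, s \in l & F s phi) ->
  (mu E <= ((size l)%:R * e)%:E)%E.
Proof.
move=> mE mF; elim: l E mE => [|s l IH] E mE Fe EF.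
  rewrite mul0r; have -> : E = set0 by apply/seteqP; split=> // phi /EF[].
  by rewrite measure0.
have m1 := measurableI _ _ mE (mF s); have m2 := measurableD mE (mF s).
have -> : E = (E `&` F s) `|` (E `\` F s) by rewrite setUIDK.
apply: le_trans (measureU2 _ m1 m2) _.
rewrite -natr1 mulrDl mul1r [(_ + e)%R]addrC EFinD; apply: leeD.
  apply: le_trans (Fe s (mem_head _ _)).
  by apply: le_measure; rewrite ?inE//; exact: subIsetr.
apply: IH => // [t tl|phi [Ephi nF]]; first by apply: Fe; rewrite inE tl orbT.
have [t] := EF _ Ephi; rewrite inE => /orP[/eqP ->|tl Ft]; [by []|by exists t].
Qed.

End weak_limit.

(** * Decay of connection probabilities *)

Section percolation.
Context {R : realType} {d : nat}.
Implicit Types (x y : Zd d) (S : seq (Zd d)).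

Lemma gdist_bounds x y : 0 <= gdist R x y <= (d * sup_dist x y)%:R.
Proof.
rewrite /gdist; set E := [set _ | _ in _].
have Elb : lbound E 0 by move=> _ [p _ <-].
have [p [pp pl ps]] := l1_path x y.
have Ep : E (size p)%:R by exists p.
apply/andP; split; first by apply: lb_le_inf => //; exists (size p)%:R.
apply: le_trans (ge_inf _ Ep) _; first by exists 0.
by rewrite ler_nat ps l1_le_sup.
Qed.

Variables (mu : probability (Omega R d) R) (K : R).
Hypothesis tails : forall S (t : R), sparse S -> (forall x, x \in S -> even_site x) ->
  (mu (large_sum S (t + 1)) <= (expR (K * (size S)%:R - t))%:E)%E.

(** K is the exponential cost per point of S, and 72^d bounds the entropy per point; the
last 1 is the rate of decay that remains. *)
Definition percolation_level : R := K + (72 ^ d)%:R + 1.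
Local Notation h := percolation_level.

Lemma rooted_treesP n x s : s \in rooted_trees n x ->
  [/\ size s = (2 ^ n)%N, sparse s & forall z, z \in s -> even_site z].
Proof.
case/flatten_mapP => x'; rewrite mem_filter => /andP[xe _] sx.
by split; [exact: size_tree sx|exact: sparse_tree sx|exact: even_tree xe sx].
Qed.

Lemma size_rooted_trees n x : (size (rooted_trees n x) <= 3 ^ d * (72 ^ d) ^ (2 ^ n))%N.
Proof.
rewrite -[size _]mul1n /rooted_trees.
apply: leq_trans (size_flatten_le _ (E := (72 ^ d) ^ (2 ^ n)) _) _.
  move=> x'; rewrite mul1n; apply: leq_trans (trees_count n x').
  by rewrite leq_pmull// muln_gt0 !expn_gt0.
rewrite leq_mul// size_filter; apply: leq_trans (count_size _ _) _.
by rewrite size_ball.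
Qed.

(** A connection forces the sum of the spins over one of the trees along the path to be
at least h times its number of points; the tail bound is summed over all trees. *)
Lemma long_connection n x y : (8 ^ n < sup_dist x y)%N ->
  (mu (connect_ge h x y) <= (3 ^+ d * expR (1 - 2 ^+ n))%:E)%E.
Proof.
move=> far; pose t := h * 2 ^+ n - 1.
have := @union_bound R d mu _ (rooted_trees n x) (fun s => large_sum s (t + 1))
  (expR (K * 2 ^+ n - t)) _ (measurable_connect h x y) (fun s => measurable_large_sum s _).
move=> ub; apply: le_trans (ub _ _) _.
- move=> s /rooted_treesP[ss sp se].
  by have := tails t sp se; rewrite ss natrX.
- move=> phi [p [pp pl hp]]; rewrite -pl in far.
  have [s sx sxp] := path_contains_rooted_tree pp far.
  exists s => //; rewrite /large_sum/= /t subrK.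
  have [ss _ _] := rooted_treesP sx.
  rewrite -[2]/(2%:R) -natrX -ss mulr_natr.
  have -> : h *+ size s = \sum_(z <- s) h.
    by rewrite big_const_seq count_predT iter_addr_0.
  rewrite big_seq [X in _ <= X]big_seq; apply: ler_sum => z zs.
  exact/hp/sxp.
rewrite lee_fin; set N := 2 ^+ n.
have A0 : 0 <= (72 ^ d)%:R :> R by exact: ler0n.
apply: (@le_trans _ _ (3 ^+ d * expR ((72 ^ d)%:R * N) * expR (K * N - t))).
  rewrite ler_wpM2r ?expR_ge0//.
  apply: (@le_trans _ _ (3 ^ d * (72 ^ d) ^ (2 ^ n))%:R).
    by rewrite ler_nat size_rooted_trees.
  have -> : N = (2 ^ n)%:R by rewrite /N natrX.
  rewrite natrM natrX ler_wpM2l ?exprn_ge0//; move: (72 ^ d)%N => a; rewrite natrX expRM_natr.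
  rewrite lerXn2r ?nnegrE ?expR_ge0//.
  by apply: le_trans (expR_ge1Dx _); rewrite lerDr.
rewrite -mulrA ler_wpM2l ?exprn_ge0// -expRD ler_expR /t /percolation_level -/N.
by rewrite le_eqVlt; apply/orP; left; apply/eqP; ring.
Qed.

(** The largest scale n with 8^n < |x - y| in the supremum distance; at distances 0 and 1,
n = 0 makes the probability bound trivial. *)
Lemma connection_scale x y : exists2 n,
  gdist R x y <= (2 * d%:R * 2 ^+ n) ^+ 3 &
  (mu (connect_ge h x y) <= (3 ^+ d * expR (1 - 2 ^+ n))%:E)%E.
Proof.
have /andP[_ gd] := gdist_bounds x y.
have d3 : (d <= d ^ 3)%N by case: (d) => // m; rewrite expnS leq_pmulr// expn_gt0.
have [le1|gt1] := leqP (sup_dist x y) 1.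
  exists 0%N.
    apply: le_trans gd _; rewrite expr0 mulr1 -[2]/(2%:R) -natrM -natrX ler_nat.
    rewrite expnMn; apply: (@leq_trans d); first by rewrite -[X in (_ <= X)%N]muln1 leq_mul.
    by apply: leq_trans d3 _; rewrite leq_pmull.
  rewrite expr0 subrr expR0 mulr1; apply: le_trans (probability_le1 _ _) _.
    exact: measurable_connect.
  by rewrite lee_fin exprn_ege1// ler1n.
exists (trunc_log 8 (sup_dist x y).-1); last first.
  apply: long_connection; have := @trunc_logP 8 (sup_dist x y).-1 isT.
  by move: gt1; case: (sup_dist x y) => // m /= m1; rewrite ltnS; apply.
have := @trunc_log_ltn 8 (sup_dist x y).-1 isT.
set n := trunc_log _ _ => nlt.
apply: le_trans gd _; rewrite -[2]/(2%:R) -natrX -!natrM -natrX ler_nat.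
have near : (sup_dist x y <= 8 * 8 ^ n)%N.
  by rewrite -expnS; move: gt1 nlt; case: (sup_dist x y).
apply: leq_trans (leq_mul (leqnn d) near) _.
rewrite !expnMn -expnM mulnC -[(8 ^ n)%N]/((2 ^ 3) ^ n)%N -expnM [(n * 3)%N]mulnC.
by rewrite mulnAC leq_mul// leq_mul.
Qed.

Lemma hplus_finite : (0 < d)%N -> (hplus mu < +oo)%E.
Proof.
move=> d0; apply: le_lt_trans (ltry h).
apply: ereal_inf_lbound; exists h => //.
have D0 : 0 < (2 * d%:R : R) by rewrite mulr_gt0// ltr0n.
(* 2 ^ n is at least the cube root of the graph distance divided by 2 d *)
exists (3 ^+ d * expR 1), (2 * d%:R)^-1, 3^-1; split.
- by rewrite mulr_gt0 ?exprn_gt0 ?expR_gt0.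
- by rewrite invr_gt0.
- by rewrite invr_gt0.
move=> x y; have [n gn le] := connection_scale x y.
apply: le_trans le _; rewrite lee_fin -mulrA ler_wpM2l ?exprn_ge0// expRD.
rewrite ler_wpM2l ?expR_ge0// ler_expR lerN2.
rewrite mulrC ler_pdivrMr// mulrC.
have g0 : 0 <= gdist R x y by have /andP[] := gdist_bounds x y.
have q0 : 0 <= 2 * d%:R * 2 ^+ n :> R by rewrite mulr_ge0 ?exprn_ge0// ltW.
apply: (@le_trans _ _ (((2 * d%:R * 2 ^+ n) ^+ 3) `^ 3^-1)).
  by apply: ge0_ler_powR; rewrite ?nnegrE ?invr_ge0// exprn_ge0.
by rewrite -powR_mulrn// -powRrM divff// powRr1.
Qed.

End percolation.

(** * The finiteness of the critical level *)

Lemma is_derive_of_derivable (R : realType) (f : R -> R) x :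
  derivable f x 1 -> is_derive x (1 : R) f (f^`() x).
Proof. by move=> df; rewrite derive1E; exact: derivableP. Qed.

Lemma support_bounded (R : realType) (g : R -> R) : compactly_supported g ->
  exists A, forall x, A < `|x| -> g x = 0.
Proof.
move=> /compact_bounded [M [_ hM]]; exists (M + 1) => x Mx.
apply: contrapT => gx; have : `|x| <= M + 1.
  apply: (hM (M + 1)); first by rewrite ltrDl.
  by apply: subset_closure; apply/eqP.
by rewrite leNgt Mx.
Qed.

Lemma L1_norm_lt (R : realType) (f : R -> R) (r b : R) : 0 < r -> continuous f ->
  (r%:E * Lnorm lebesgue_measure 1 (EFin \o f) < b%:E)%E ->
  exists2 u, has_integral (fun x => `|f x|) u & r * u < b.
Proof.
move=> r0 cf; rewrite Lnorm1.
have mf : measurable_fun [set: R] (EFin \o f).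
  by apply/measurable_EFinP; exact: continuous_measurable_fun.
set I := (\int[_]_x _)%E => lt.
have I0 : (0 <= I)%E by exact: integral_ge0.
have Ifin : I \is a fin_num.
  rewrite ge0_fin_numE//; move: lt; case: I I0 => [v| |]//= _.
    by rewrite ltry.
  by rewrite gt0_muley ?lte_fin// ltNge leey.
exists (fine I); last by rewrite -lte_fin EFinM fineK.
split; last first.
  by rewrite /Rintegral /I; congr fine; apply: eq_integral.
apply/integrableP; split.
  by apply/measurable_EFinP/measurableT_comp => //; exact/measurable_EFinP.
have -> : (\int[lebesgue_measure]_x `|(EFin \o (fun x => `|f x|%R)) x|)%E = I.
  by apply: eq_integral => x _ /=; rewrite normr_id.
by rewrite ltey_eq Ifin.
Qed.

Theorem theorem5p4 (R : realType) (d : nat) (c : R)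
    (d_ge3 : (3 <= d)%N) (c_gt1 : 1 < c) :
  exists2 c24 : R, 0 < c24 &
    forall (U g : R -> R) (alpha A B beta : R),
      let V : R -> R := fun eta => U eta + g eta in
      0 < alpha -> C2holder alpha U -> C2holder alpha g ->
      (forall eta, 0 <= U eta) -> (forall eta, 0 <= g eta) ->
      (forall eta, U (- eta) = U eta) -> (forall eta, g (- eta) = g eta) ->
      (forall eta, c^-1 <= (U^`(2))%classic eta <= c) ->
      compactly_supported g ->
      0 < A -> (forall eta, A * eta ^+ 2 - B <= V eta) ->
      0 < beta ->
      ((Num.sqrt beta)%:E *
         Lnorm lebesgue_measure 1 (EFin \o (g^`(2))%classic) < c24%:E)%E ->
      forall mu : probability (Omega R d) R,
        Wset V beta mu -> (hplus mu < +oo)%E.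
Proof.
have d0 : (0 < d)%N by exact: leq_trans d_ge3.
pose I := ('I_d * bool)%type; pose i0 : I := (Ordinal d0, true).
(* I indexes the 2 d neighbours of a site *)
exists (mollification_bound (I := I) c / 2).
  by rewrite divr_gt0// (mollification_bound_gt0 i0).
move=> U g alpha A B beta V _ [dU dU1 cU2 _] [dg dg1 cg2 _] _ g0 Ueven geven U2c supp _ _
  beta0 small mu [L [mu_ [_ FL _ gibbs lim]]].
have [A' suppA] := support_bounded supp.
have r0 : 0 < Num.sqrt beta by rewrite sqrtr_gt0.
have [u iu ub] := L1_norm_lt r0 cg2 small.
pose kap := c^-1 / 32 * beta.
have kap0 : 0 < kap by rewrite mulr_gt0// divr_gt0// invr_gt0; lra.
have Veven t : V (- t) = V t by rewrite /V Ueven geven.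
have cont (f : R -> R) : (forall x, derivable f x 1) -> continuous f.
  by move=> df x; apply: differentiable_continuous; apply/derivable1_diffP.
have cV : continuous V.
  by move=> x; apply: continuousD; exact: cont.
apply: (@hplus_finite R d mu (72 / kap)) => // S t sp Se.
apply: (weak_limit_tail lim) => n.
have := @gibbs_tail R d V beta kap (L n) Veven (FL n) cV kap0 _ S (576 * (size S)%:R) _ Se _
  (mu_ n) t (gibbs n).
have -> : 72 / kap * (size S)%:R = 576 * (size S)%:R / (8 * kap).
  by field; rewrite gt_eqF.
apply => [a b||dlt dlt0].
- exact: (@site_pair R I U U^`() (U^`(2))%classic g g^`() (g^`(2))%classic c A' u beta i0 a b
    (fun x => is_derive_of_derivable (dU x)) (fun x => is_derive_of_derivable (dU1 x)) cU2 c_gt1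
    U2c (fun x => is_derive_of_derivable (dg x)) (fun x => is_derive_of_derivable (dg1 x)) cg2
    g0 suppA iu beta0 (ltW ub)).
- by apply: mulr_ge0; exact: ler0n.
- exact: (sparse_dirichlet_bound d_ge3 (FL n) dlt0 sp).
Qed.
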